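(* Assume that $t\mapsto g(t)/t^{q-1}$ is non-increasing on $(0,\infty)$. Let $\Omega,\Omega'$ be bounded open subsets of $\mathbb R^n$ with $\Omega\Subset\Omega'$, let $\psi:\Omega\to[-\infty,\infty]$ and $\vartheta\in W^{s,G}(\Omega,\Omega')\cap L^g_s(\mathbb R^n)$. If $\mathcal K_{\psi,\vartheta}(\Omega,\Omega')$ is non-empty, then there exists a unique solution to the obstacle problem in $\mathcal K_{\psi,\vartheta}(\Omega,\Omega')$. Moreover, the solution to the obstacle problem is a supersolution of $\mathcal Lu=0$ in $\Omega$.
   Context: Fix $n\in\mathbb N$, $s\in(0,1)$, $\Lambda\ge1$. $G(t)=\int_0^tg$ is a differentiable Young function with $g=G'$ strictly increasing, $G(1)=1$, and $1<p\le q$ with $pG(t)\le tg(t)\le qG(t)$ for $t\ge0$. $k$ measurable with $\Lambda^{-1}\le k(x,y)=k(y,x)\le\Lambda$ a.e. $D^su(x,y)=(u(x)-u(y))/|x-y|^s$. $\|u\|_{L^G(\Omega)}=\inf\{\lambda>0:\int_\Omega G(|u|/\lambda)\le1\}$. $W^{s,G}(\Omega,\Omega')$ is the set of measurable $u$ with $\int_\Omega G(|u|)<\infty$ and $\int_\Omega\int_{\Omega'}G(|D^su|)|x-y|^{-n}dydx<\infty$, with norm $\|u\|_{L^G(\Omega)}+\inf\{\lambda>0:\int_\Omega\int_{\Omega'}G(|D^su|/\lambda)|x-y|^{-n}dydx\le1\}$; $W^{s,G}_0(\Omega,\Omega')$ is the closure of $C_c^\infty(\Omega)$ in this norm. $W^{s,G}_{\mathrm{loc}}(\Omega)$: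 $\int_DG(|u|)+\int_D\int_DG(|D^su|)|x-y|^{-n}<\infty$ for every open $D\Subset\Omega$. $L^g_s(\mathbb R^n)$: measurable $u$ with $g(|u|)$ locally integrable and $\int g(|u(x)|/(1+|x|)^s)(1+|x|)^{-n-s}dx<\infty$. $\mathcal E(u,v)=\int_{\mathbb R^n}\int_{\mathbb R^n}g(|D^su|)\frac{D^su}{|D^su|}D^sv\frac{k(x,y)}{|x-y|^n}dydx$. $\mathcal K_{\psi,\vartheta}(\Omega,\Omega')=\{u\in W^{s,G}(\Omega,\Omega'):u\ge\psi\text{ a.e. in }\Omega,\ u-\vartheta\in W^{s,G}_0(\Omega,\Omega')\}$; $u\in\mathcal K_{\psi,\vartheta}(\Omega,\Omega')$ is a solution to the obstacle problem if $\mathcal E(u,v-u)\ge0$ for all $v\in\mathcal K_{\psi,\vartheta}(\Omega,\Omega')$. A supersolution of $\mathcal Lu=0$ in $\Omega$ is $u\in W^{s,G}_{\mathrm{loc}}(\Omega)$ with $u_-\in L^g_s(\mathbb R^n)$ and $\mathcal E(u,\varphi)\ge0$ for all nonnegative $\varphi\in C_c^\infty(\Omega)$. *)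

(* Defs.v *)
From HB Require Import structures.
From mathcomp Require Import all_boot all_order all_algebra.
From mathcomp Require Import all_classical all_reals all_analysis.
Set Implicit Arguments. Unset Strict Implicit. Unset Printing Implicit Defensive.
Import Order.TTheory GRing.Theory Num.Theory numFieldNormedType.Exports.
Local Open Scope classical_set_scope.
Local Open Scope ring_scope.

Section FracOrlicz.
Variable R : realType.

(* Integral of a non-negative function over R^m, built as the iterated
   Lebesgue integral (Tonelli); for m = 0, R^0 is a point of mass 1. *)
Fixpoint iint (m : nat) : ('rV[R]_m -> \bar R) -> \bar R :=
  match m with
  | 0 => fun f => f 0
  | m'.+1 => fun f => (\int[@lebesgue_measure R]_(t in [set: R])
        iint (fun x : 'rV[R]_m' => f (row_mx (t%:M : 'rV[R]_1) x)))%E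
  end.

Definition iint_on m (A : set 'rV[R]_m) (f : 'rV[R]_m -> \bar R) : \bar R :=
  iint (fun x => if `[< A x >] then f x else 0%E).

Definition sint m (f : 'rV[R]_m -> R) : \bar R :=
  (iint (fun x => (Num.max (f x) 0)%:E) - iint (fun x => (Num.max (- f x) 0)%:E))%E.

(* Lebesgue outer measure (outer regularity), Caratheodory measurability *)
Definition louter m (E : set 'rV[R]_m) : \bar R :=
  ereal_inf [set iint (fun x => (\1_U x)%:E) | U in [set U | open U /\ E `<=` U]].

Definition lmeasurable m (A : set 'rV[R]_m) : Prop :=
  forall E, louter E = (louter (E `&` A) + louter (E `\` A))%E.

Definition lmeasurable_fun m (u : 'rV[R]_m -> R) : Prop :=
  forall t : R, lmeasurable [set x | u x < t].

Definition ae m (P : 'rV[R]_m -> Prop) : Prop := louter [set x | ~ P x] = 0%E.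

Definition enorm m (x : 'rV[R]_m) : R := Num.sqrt (\sum_i x 0 i ^+ 2).

Definition ebounded m (A : set 'rV[R]_m) : Prop :=
  exists M : R, forall x, A x -> enorm x <= M.

Definition ei m (i : 'I_m) : 'rV[R]_m := delta_mx 0 i.

Fixpoint pder m (l : seq 'I_m) (f : 'rV[R]_m -> R) : 'rV[R]_m -> R :=
  match l with
  | [::] => f
  | i :: l' => fun x => derive (pder l' f) x (ei i)
  end.

Definition smooth m (f : 'rV[R]_m -> R) : Prop :=
  forall l : seq 'I_m, continuous (pder l f) /\
    forall (i : 'I_m) x, derivable (pder l f) x (ei i).

Definition Cc_inf m (O : set 'rV[R]_m) (f : 'rV[R]_m -> R) : Prop :=
  smooth f /\ exists K, [/\ compact K, K `<=` O & forall x, ~ K x -> f x = 0].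

Definition diff_young (G g : R -> R) : Prop :=
  [/\ forall t : R, 0 <= t ->
        (G t)%:E = (\int[@lebesgue_measure R]_(x in `[0%R, t]%classic) (g x)%:E)%E,
      g 0 = 0,
      forall a b : R, 0 <= a -> a < b -> g a < g b,
      forall t : R, 0 < t -> is_derive t 1 G (g t) &
      g x @[x --> +oo] --> +oo].

Section Spaces.
Variables (n : nat) (s : R) (G g : R -> R).

Definition Ds (u : 'rV[R]_n -> R) (x y : 'rV[R]_n) : R :=
  (u x - u y) / (enorm (x - y)) `^ s.

Definition kern (x y : 'rV[R]_n) : R := (enorm (x - y) ^+ n)^-1.

Definition dint_on (A B : set 'rV[R]_n) (F : 'rV[R]_n -> 'rV[R]_n -> \bar R) : \bar R :=
  iint_on [set z : 'rV[R]_(n + n) | A (lsubmx z) /\ B (rsubmx z)]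
          (fun z => F (lsubmx z) (rsubmx z)).

Definition gag_mod (A B : set 'rV[R]_n) (u : 'rV[R]_n -> R) (lam : R) : \bar R :=
  dint_on A B (fun x y => (G (`|Ds u x y| / lam) * kern x y)%:E).

Definition Wsp (Om Om' : set 'rV[R]_n) (u : 'rV[R]_n -> R) : Prop :=
  [/\ lmeasurable_fun u,
      (iint_on Om (fun x => (G `|u x|)%:E) < +oo)%E &
      (gag_mod Om Om' u 1 < +oo)%E].

Definition lux_norm (Om : set 'rV[R]_n) (u : 'rV[R]_n -> R) : \bar R :=
  ereal_inf [set lam%:E | lam in [set lam : R | 0 < lam /\
     (iint_on Om (fun x => (G (`|u x| / lam))%:E) <= 1)%E]].

Definition gag_norm (Om Om' : set 'rV[R]_n) (u : 'rV[R]_n -> R) : \bar R :=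
  ereal_inf [set lam%:E | lam in [set lam : R | 0 < lam /\
     (gag_mod Om Om' u lam <= 1)%E]].

Definition Wnorm (Om Om' : set 'rV[R]_n) (u : 'rV[R]_n -> R) : \bar R :=
  (lux_norm Om u + gag_norm Om Om' u)%E.

(* W^{s,G}_0(Om, Om'): limits of C_c^oo(Om) functions in the W-norm
   (elements vanish outside Om, as the C_c^oo(Om) functions do). *)
Definition W0 (Om Om' : set 'rV[R]_n) (w : 'rV[R]_n -> R) : Prop :=
  ae (fun x => ~ Om x -> w x = 0) /\
  exists phi : nat -> 'rV[R]_n -> R,
    (forall k, Cc_inf Om (phi k)) /\
    (Wnorm Om Om' (fun x => w x - phi k x) @[k --> \oo] --> 0%E).

Definition Wloc (Om : set 'rV[R]_n) (u : 'rV[R]_n -> R) : Prop :=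
  lmeasurable_fun u /\
  forall D : set 'rV[R]_n, open D -> compact (closure D) -> closure D `<=` Om ->
    (iint_on D (fun x => (G `|u x|)%:E) + gag_mod D D u 1 < +oo)%E.

Definition Lgs (u : 'rV[R]_n -> R) : Prop :=
  [/\ lmeasurable_fun u,
      forall K : set 'rV[R]_n, compact K ->
        (iint_on K (fun x => (g `|u x|)%:E) < +oo)%E &
      (iint (fun x => (g (`|u x| / (1 + enorm x) `^ s)
                        * (1 + enorm x) `^ (- (n%:R + s)))%:E) < +oo)%E].

Definition Eform (k : 'rV[R]_n -> 'rV[R]_n -> R) (u v : 'rV[R]_n -> R) : \bar R :=
  sint (fun z : 'rV[R]_(n + n) =>
    let x := lsubmx z in let y := rsubmx z in
    g `|Ds u x y| * (Ds u x y / `|Ds u x y|) * Ds v x y * k x y * kern x y).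

Definition Kset (Om Om' : set 'rV[R]_n) (psi : 'rV[R]_n -> \bar R)
    (theta : 'rV[R]_n -> R) (u : 'rV[R]_n -> R) : Prop :=
  [/\ Wsp Om Om' u,
      ae (fun x => Om x -> (psi x <= (u x)%:E)%E) &
      W0 Om Om' (fun x => u x - theta x)].

Definition obstacle_solution k (Om Om' : set 'rV[R]_n) psi theta u : Prop :=
  Kset Om Om' psi theta u /\
  forall v, Kset Om Om' psi theta v -> (0 <= Eform k u (fun x => (v x - u x)%R))%E.

Definition supersolution k (Om : set 'rV[R]_n) (u : 'rV[R]_n -> R) : Prop :=
  [/\ Wloc Om u,
      Lgs (fun x => Num.max (- u x) 0) &
      forall phi, Cc_inf Om phi -> (forall x, 0 <= phi x) -> (0 <= Eform k u phi)%E].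

End Spaces.
End FracOrlicz.

(* Main.v *)
(* Existence is by direct minimization of
     J(u) = int int (G|D^s u| - G|D^s theta|) k(x,y) |x-y|^(-n)
   over the competitors. Tails are absorbed by |x - y| >= c (1 + |y|) for x in
   Om and y off Om', so J is finite and coercive. Nothing is known about weak
   compactness; instead the convexity gap
     (G|a| + G|b|) / 2 - G|(a + b) / 2|
   of two almost minimizers has small integral. Integrating it over Om x A, where
   A lies in Om' \ Om and both functions agree with theta, shows that a fast
   minimizing sequence converges a.e. (Borel-Cantelli); by Fatou and dominated
   convergence it then converges in modular, which by the Delta_2 scaling of G is
   norm convergence. The first variation of J at the minimizer is the
   variational inequality; strict monotonicity of g and a Poincare inequality give
   uniqueness, and adding nonnegative test functions gives the supersolution
   property. All of this is done for Borel representatives. *)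
Require Import Defs.
From HB Require Import structures.
From mathcomp Require Import all_boot all_order all_algebra.
From mathcomp Require Import all_classical all_reals all_analysis.
From mathcomp Require Import measurable_realfun ring lra zify.
Import Order.TTheory GRing.Theory Num.Theory numFieldNormedType.Exports.
Local Open Scope classical_set_scope.
Local Open Scope ring_scope.
Set Implicit Arguments. Unset Strict Implicit. Unset Printing Implicit Defensive.

(** The statement works with iterated integrals of arbitrary functions and with Caratheodory
    measurability for [louter]. Limit theorems need a genuine measure, so [leb] is built along the
    recursion of [iint]; Caratheodory measurable functions are shown to be a.e. Borel, and [iint] to
    ignore null sets. The form integrates over all pairs of points, while the space controls only
    [Om] x [Om']. The quantity [bint] masters the remaining pairs: it is finite whenever the
    increment vanishes off [Om], and it bounds every difference of energies. The convexity gap sees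
    a function only through the differences [u x - u y], so on [Om] x [Om] it cannot separate
    functions that differ by a constant. A point [y] of [A] pins the value at [y] to the datum, and
    the gap then detects [u x - v x]. Its positivity is uniform only on bounded ranges of the
    quotients; hence the truncation at growing levels, with Chebyshev's inequality for the part
    above them. *)

Record young_pair (R : realType) (G g : R -> R) (p q : R) : Prop := YoungPair {
  yp_p1 : 1 < p;
  yp_pq : p <= q;
  yp_g0 : g 0 = 0;
  yp_ginc : forall a b, 0 <= a -> a < b -> g a < g b;
  yp_der : forall t : R, 0 < t -> is_derive t 1 G (g t);
  yp_G1 : G 1 = 1;
  yp_grow : forall t, 0 <= t -> p * G t <= t * g t /\ t * g t <= q * G t }.

(** * Young functions and their convexity gap *)

Section YoungFunction.
Variables (R : realType) (G g : R -> R) (p q : R).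
Hypothesis Y : young_pair G g p q.

Let p0 : 0 < p. Proof. exact: lt_trans (yp_p1 Y). Qed.
Let q0 : 0 < q. Proof. exact: lt_le_trans (yp_pq Y). Qed.
Let q1 : 1 < q. Proof. exact: lt_le_trans (yp_p1 Y) (yp_pq Y). Qed.

Lemma young_g_ge0 (t : R) : 0 <= t -> 0 <= g t.
Proof.
rewrite le_eqVlt => /predU1P[<-|t0]; first by rewrite (yp_g0 Y).
by rewrite -(yp_g0 Y); apply/ltW/(yp_ginc Y).
Qed.

Lemma young_g_gt0 (t : R) : 0 < t -> 0 < g t.
Proof. by move=> t0; rewrite -(yp_g0 Y); exact: (yp_ginc Y). Qed.

Lemma young_g_le (a b : R) : 0 <= a -> a <= b -> g a <= g b.
Proof.
by move=> a0; rewrite le_eqVlt => /predU1P[->//|ab]; apply/ltW/(yp_ginc Y).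
Qed.

Lemma young_G0 : G 0 = 0.
Proof.
have [] := yp_grow Y (lexx 0); rewrite mul0r pmulr_rle0// pmulr_rge0// => h1 h2.
by apply/le_anti; rewrite h1 h2.
Qed.

Lemma young_G_gt0 (t : R) : 0 < t -> 0 < G t.
Proof.
move=> t0; have [_ h] := yp_grow Y (ltW t0).
by rewrite -(pmulr_rgt0 _ q0) (lt_le_trans _ h)// mulr_gt0// young_g_gt0.
Qed.

Lemma young_G_ge0 (t : R) : 0 <= t -> 0 <= G t.
Proof.
by rewrite le_eqVlt => /predU1P[<-|/young_G_gt0/ltW//]; rewrite young_G0.
Qed.

(** The derivative of [G t * t ^ (- r)] has the sign of [t * g t - r * G t], which the growth
    condition fixes for [r = p] and for [r = q]; one mean value identity thus yields both power
    comparisons. *)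
Lemma young_MVT_powR (r a b : R) : 0 < a -> a <= b -> exists2 c, 0 < c &
  G b * b `^ (- r) - G a * a `^ (- r) =
  c `^ (- r - 1) * (c * g c - r * G c) * (b - a).
Proof.
move=> a0 ab.
have D (x : R) : 0 < x -> is_derive x 1 (fun t => G t * t `^ (- r))
    (x `^ (- r - 1) * (x * g x - r * G x)).
  move=> x0; have dG := yp_der Y x0; have dP := is_derive1_powR (- r) x0.
  apply: is_derive_eq; rewrite /GRing.scale/=.
  have -> : x `^ (- r) = x `^ (- r - 1) * x.
    rewrite -{3}(powRr1 (ltW x0)) -powRD ?subrK//.
    by apply/implyP => _; rewrite gt_eqF.
  ring.
have [] := @MVT_segment R (fun t => G t * t `^ (- r))
  (fun x => x `^ (- r - 1) * (x * g x - r * G x)) a b ab.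
- by move=> x /[!in_itv]/= /andP[ax _]; apply: D; exact: lt_trans ax.
- apply: derivable_within_continuous => x /[!in_itv]/= /andP[ax _].
  by have [] := D x (lt_le_trans a0 ax).
- move=> c /[!in_itv]/= /andP[ac _] ->; exists c => //; exact: lt_le_trans ac.
Qed.

Lemma young_powR_p (a b : R) : 0 < a -> a <= b -> G a * b `^ p <= G b * a `^ p.
Proof.
move=> a0 ab; have b0 := lt_le_trans a0 ab.
have [c c0 E] := young_MVT_powR p a0 ab.
have : 0 <= G b * b `^ (- p) - G a * a `^ (- p).
  rewrite E mulr_ge0 ?subr_ge0// mulr_ge0 ?powR_ge0// subr_ge0.
  by have [] := yp_grow Y (ltW c0).
by rewrite !powRN subr_ge0 ler_pdivrMr ?powR_gt0// mulrAC ler_pdivlMr ?powR_gt0.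
Qed.

Lemma young_powR_q (a b : R) : 0 < a -> a <= b -> G b * a `^ q <= G a * b `^ q.
Proof.
move=> a0 ab; have b0 := lt_le_trans a0 ab.
have [c c0 E] := young_MVT_powR q a0 ab.
have : G b * b `^ (- q) - G a * a `^ (- q) <= 0.
  rewrite E mulr_le0_ge0 ?subr_ge0// mulr_ge0_le0 ?powR_ge0// subr_le0.
  by have [] := yp_grow Y (ltW c0).
by rewrite !powRN subr_le0 ler_pdivrMr ?powR_gt0// mulrAC ler_pdivlMr ?powR_gt0.
Qed.

Lemma young_scale_le1 (l t : R) : 0 <= l <= 1 -> 0 <= t -> G (l * t) <= l `^ p * G t.
Proof.
move=> /andP[l0 l1] t0.
have [->|ln0] := eqVneq l 0.
  by rewrite mul0r young_G0 mulr_ge0 ?powR_ge0 ?young_G_ge0.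
have [->|tn0] := eqVneq t 0; first by rewrite mulr0 young_G0 mulr0.
have {}l0 : 0 < l by rewrite lt_def ln0.
have {}t0 : 0 < t by rewrite lt_def tn0.
have := @young_powR_p (l * t) t (mulr_gt0 l0 t0) (ler_piMl (ltW t0) l1).
by rewrite powRM ?(ltW l0) ?(ltW t0)// mulrA ler_pM2r ?powR_gt0// (mulrC (G t)).
Qed.

Lemma young_scale_ge1 (l t : R) : 1 <= l -> 0 <= t -> G (l * t) <= l `^ q * G t.
Proof.
move=> l1 t0; have l0 : 0 < l := lt_le_trans ltr01 l1.
have [->|tn0] := eqVneq t 0; first by rewrite mulr0 young_G0 mulr0.
have {}t0 : 0 < t by rewrite lt_def tn0.
have := @young_powR_q t (l * t) t0 (ler_peMl (ltW t0) l1).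
by rewrite powRM ?(ltW l0) ?(ltW t0)// mulrA ler_pM2r ?powR_gt0// (mulrC (G t)).
Qed.

Lemma young_scale_le1_q (l t : R) : 0 < l <= 1 -> 0 <= t ->
  l `^ q * G t <= G (l * t).
Proof.
move=> /andP[l0 l1] t0.
have li1 : 1 <= l^-1 by rewrite invf_ge1.
have := young_scale_ge1 li1 (mulr_ge0 (ltW l0) t0).
rewrite mulKf ?gt_eqF// -powR_inv1 ?(ltW l0)// -powRrM mulN1r powRN.
by rewrite ler_pdivlMl ?powR_gt0.
Qed.

Lemma young_G_le (a b : R) : 0 <= a -> a <= b -> G a <= G b.
Proof.
rewrite le_eqVlt => /predU1P[<- b0|a0 ab]; first by rewrite young_G0 young_G_ge0.
have b0 : 0 < b by exact: lt_le_trans ab.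
have -> : a = (a / b) * b by rewrite divfK ?gt_eqF.
have h0 : 0 < a / b by rewrite divr_gt0.
have h1 : a / b <= 1 by rewrite ler_pdivrMr// mul1r.
apply: le_trans (@young_scale_le1 (a / b) b _ (ltW b0)) _; first by rewrite (ltW h0).
rewrite ler_piMl ?young_G_ge0 ?(ltW b0)//.
by rewrite -(powRr0 (a / b)) ger_powR ?(ltW p0)// h0.
Qed.

Lemma young_G_add (a b : R) : 0 <= a -> 0 <= b -> G (a + b) <= 2 `^ q * (G a + G b).
Proof.
move=> a0 b0.
wlog ab : a b a0 b0 / a <= b.
  move=> H; have [/H->//|/ltW /H] := leP a b.
  by rewrite addrC (addrC (G b)); apply.
apply: (@le_trans _ _ (G (2 * b))).
  by apply: young_G_le; [exact: addr_ge0|lra].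
apply: le_trans (young_scale_ge1 _ b0) _; first by lra.
by rewrite ler_wpM2l ?powR_ge0// lerDr young_G_ge0.
Qed.

(** Only [t * g t] is comparable with [G t]: the upper bound is used at [l * t] and the lower one at
    [t], whence the factor [q / p]. *)
Lemma young_g_scale (l t : R) : 1 <= l -> 0 <= t -> g (l * t) <= q / p * l `^ q * g t.
Proof.
move=> l1 t0; have l0 : 0 < l := lt_le_trans ltr01 l1.
have [->|tn0] := eqVneq t 0; first by rewrite mulr0 (yp_g0 Y) mulr0.
have {}t0 : 0 < t by rewrite lt_def tn0.
rewrite -(ler_pM2l t0).
have [_ h1] := yp_grow Y (mulr_ge0 (ltW l0) (ltW t0)).
have [h2 _] := yp_grow Y (ltW t0).
have h3 := young_scale_ge1 l1 (ltW t0).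
have h4 : t * g (l * t) <= l * t * g (l * t).
  rewrite -mulrA ler_peMl// mulr_ge0 ?(ltW t0)// young_g_ge0//.
  by rewrite mulr_ge0 ?(ltW l0) ?(ltW t0).
apply: le_trans h4 (le_trans h1 _).
apply: le_trans (ler_wpM2l (ltW q0) h3) _.
have -> : t * (q / p * l `^ q * g t) = q * l `^ q / p * (t * g t) by ring.
apply: le_trans (ler_wpM2l _ h2); last first.
  by rewrite divr_ge0 ?(ltW p0)// mulr_ge0 ?powR_ge0// (ltW q0).
rewrite le_eqVlt; apply/orP; left; apply/eqP; field.
by rewrite gt_eqF.
Qed.

Lemma young_g_add (a b : R) : 0 <= a -> 0 <= b ->
  g (a + b) <= q / p * 2 `^ q * (g a + g b).
Proof.
move=> a0 b0.
wlog ab : a b a0 b0 / a <= b.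
  move=> H; have [/H->//|/ltW /H] := leP a b.
  by rewrite addrC (addrC (g b)); apply.
apply: (@le_trans _ _ (g (2 * b))).
  by apply: young_g_le; [exact: addr_ge0|lra].
apply: le_trans (young_g_scale _ b0) _; first by lra.
rewrite ler_wpM2l ?lerDr ?young_g_ge0//.
by rewrite mulr_ge0 ?powR_ge0// divr_ge0 ?(ltW q0) ?(ltW p0).
Qed.

Lemma young_ineq_l (e : R) : 0 < e -> exists2 C, 0 <= C &
  forall a b, 0 <= a -> 0 <= b -> a * g b <= e * G a + C * G b.
Proof.
(* Threshold between two cases. If [b <= d * a], then [a * g b] is at most [q * d ^ (p - 1) * G a],
   and [d] makes this coefficient at most [e]; if [b > d * a], then [a < b / d] gives the constant
   [q / d]. *)
move=> e0; pose d := Num.min 1 ((e / q) `^ (p - 1)^-1).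
have p10 : 0 < p - 1 by rewrite subr_gt0 (yp_p1 Y).
have d0 : 0 < d by rewrite lt_min ltr01 powR_gt0// divr_gt0.
have d1 : d <= 1 by rewrite ge_min lexx.
exists (q / d); first by rewrite divr_ge0 ?(ltW q0) ?(ltW d0).
move=> a b a0 b0.
have [ba|ba] := leP b (d * a); last first.
  have h : a * g b <= q / d * G b.
    have [_ h] := yp_grow Y b0.
    rewrite mulrAC ler_pdivlMr// (le_trans _ h)// mulrC mulrA.
    by rewrite ler_wpM2r ?young_g_ge0 ?(ltW ba).
  by rewrite (le_trans h)// lerDr mulr_ge0 ?young_G_ge0 ?(ltW e0).
have h : a * g b <= e * G a.
  have da0 : 0 <= d * a by rewrite mulr_ge0 ?(ltW d0).
  have [_ h1] := yp_grow Y da0.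
  have h2 := young_scale_le1 (introT andP (conj (ltW d0) d1)) a0.
  have h3 : q * d `^ (p - 1) <= e.
    rewrite mulrC -ler_pdivlMr//.
    have -> : e / q = ((e / q) `^ (p - 1)^-1) `^ (p - 1).
      by rewrite -powRrM mulVf ?gt_eqF// powRr1// divr_ge0 ?(ltW e0) ?(ltW q0).
    rewrite ge0_ler_powR ?(ltW p10)// ?nnegrE ?powR_ge0 ?(ltW d0)//.
    by rewrite ge_min lexx orbT.
  have h4 : a * g b <= a * g (d * a) by rewrite ler_wpM2l// young_g_le.
  apply: le_trans h4 _; rewrite -(ler_pM2l d0) mulrA (le_trans h1)//.
  apply: le_trans (ler_wpM2l (ltW q0) h2) _.
  rewrite -(mulr_powRB1 (ltW d0) p0) mulrA (mulrA d) ler_wpM2r ?young_G_ge0//.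
  by rewrite mulrCA ler_wpM2l ?(ltW d0).
by rewrite (le_trans h)// lerDl mulr_ge0 ?young_G_ge0 ?divr_ge0 ?(ltW q0) ?(ltW d0).
Qed.

Lemma young_ineq_r (e : R) : 0 < e -> exists2 C, 0 <= C &
  forall a b, 0 <= a -> 0 <= b -> a * g b <= C * G a + e * G b.
Proof.
(* The split is now [a <= d * b], where [a * g b <= d * q * G b] and [d * q <= e]; otherwise
   [b < a / d], and scaling [G] from [a] to [a / d] costs [d ^ (- q)]. *)
move=> e0; pose d := Num.min 1 (e / q).
have d0 : 0 < d by rewrite lt_min ltr01 divr_gt0.
have d1 : d <= 1 by rewrite ge_min lexx.
exists (q * d^-1 `^ q); first by rewrite mulr_ge0 ?powR_ge0 ?(ltW q0).
move=> a b a0 b0.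
have [ba|ba] := leP a (d * b).
  have h : a * g b <= e * G b.
    have [_ h] := yp_grow Y b0.
    apply: (@le_trans _ _ (d * b * g b)); first by rewrite ler_wpM2r ?young_g_ge0.
    rewrite -mulrA (le_trans (ler_wpM2l (ltW d0) h))// mulrA.
    rewrite ler_wpM2r ?young_G_ge0// -ler_pdivlMr// ge_min lexx orbT//.
  rewrite (le_trans h)// lerDr mulr_ge0 ?young_G_ge0 ?mulr_ge0 ?powR_ge0 ?(ltW q0)//.
have h : a * g b <= q * d^-1 `^ q * G a.
  have da0 : 0 <= d^-1 * a by rewrite mulr_ge0 ?invr_ge0 ?(ltW d0).
  have [_ h1] := yp_grow Y da0.
  have h2 := @young_scale_ge1 d^-1 a; rewrite invf_ge1// in h2.
  have {}h2 := h2 d1 a0.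
  have h4 : a * g b <= d^-1 * a * g (d^-1 * a).
    apply: ler_pM => //; first exact: young_g_ge0.
      by rewrite ler_peMl// invf_ge1.
    by rewrite young_g_le// ler_pdivlMl// ltW.
  by rewrite (le_trans h4)// (le_trans h1)// -mulrA ler_wpM2l// (ltW q0).
by rewrite (le_trans h)// lerDl mulr_ge0 ?young_G_ge0 ?(ltW e0).
Qed.

End YoungFunction.

Definition even_ext (R : realType) (G : R -> R) (t : R) : R := G `|t|.
(** The factor [t / |t|] is the one of [Eform]. It vanishes at 0 since division by 0 gives 0, so
    [odd_ext g] is the derivative of [even_ext G] at every point, 0 included. *)
Definition odd_ext (R : realType) (g : R -> R) (t : R) : R := g `|t| * (t / `|t|).

Section EvenYoung.
Variables (R : realType) (G g : R -> R) (p q : R).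
Hypothesis Y : young_pair G g p q.
Local Notation GG := (even_ext G).
Local Notation gg := (odd_ext g).

Let p0 : 0 < p. Proof. exact: lt_trans (yp_p1 Y). Qed.
Let q0 : 0 < q. Proof. exact: lt_le_trans (yp_pq Y). Qed.

Definition convex_gap (a b : R) : R := (GG a + GG b) / 2 - GG ((a + b) / 2).

Lemma even_ext_ge0 (a : R) : 0 <= GG a.
Proof. exact: (young_G_ge0 Y). Qed.

Lemma even_ext0 : GG 0 = 0.
Proof. by rewrite /even_ext normr0 (young_G0 Y). Qed.

Lemma even_extN (a : R) : GG (- a) = GG a.
Proof. by rewrite /even_ext normrN. Qed.

Lemma odd_ext0 : gg 0 = 0.
Proof. by rewrite /odd_ext mul0r mulr0. Qed.

Lemma odd_extN (a : R) : gg (- a) = - gg a.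
Proof. by rewrite /odd_ext normrN mulNr mulrN. Qed.

Lemma odd_ext_ge0 (a : R) : 0 <= a -> gg a = g a.
Proof.
rewrite le_eqVlt => /predU1P[<-|a0]; first by rewrite odd_ext0 (yp_g0 Y).
by rewrite /odd_ext gtr0_norm// divff ?gt_eqF// mulr1.
Qed.

Lemma norm_odd_ext (a : R) : `|gg a| = g `|a|.
Proof.
have [->|a0] := eqVneq a 0; first by rewrite odd_ext0 normr0 (yp_g0 Y).
rewrite /odd_ext normrM normf_div normr_id divff ?normr_eq0// mulr1.
by rewrite ger0_norm// (young_g_ge0 Y).
Qed.

Lemma even_ext_add (a b : R) : GG (a + b) <= 2 `^ q * (GG a + GG b).
Proof.
apply: le_trans (young_G_add Y (normr_ge0 a) (normr_ge0 b)).
by apply: (young_G_le Y) => //; exact: ler_normD.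
Qed.

Lemma even_ext_sub (a b : R) : GG (a - b) <= 2 `^ q * (GG a + GG b).
Proof. by rewrite -[GG b]even_extN; exact: even_ext_add. Qed.

Let slope (a b : R) : 0 < a -> a < b -> exists2 c, a < c < b &
  G b - G a = g c * (b - a).
Proof.
move=> a0 ab; have [] := @MVT R G g a b ab.
- by move=> x /[!in_itv]/= /andP[ax _]; apply: (yp_der Y); exact: lt_trans ax.
- apply: derivable_within_continuous => x /[!in_itv]/= /andP[ax _].
  by have [] := yp_der Y (lt_le_trans a0 ax).
- by move=> c /[!in_itv]/= h ->; exists c.
Qed.

(** Strict convexity on the half-line with its end point: at [b = 0] it reads [G a < a * g a], which
    is where [p > 1] enters. *)
Let tangent_pos (a b : R) : 0 <= a -> 0 <= b -> a != b ->
  G a + g a * (b - a) < G b.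
Proof.
rewrite [0 <= a]le_eqVlt => /predU1P[<-|a0].
  rewrite le_eqVlt => /predU1P[<-|b0 _]; first by rewrite eqxx.
  by rewrite (young_G0 Y) (yp_g0 Y) mul0r addr0 (young_G_gt0 Y).
rewrite le_eqVlt => /predU1P[<- _|b0 ab].
  rewrite sub0r mulrN (young_G0 Y) subr_lt0.
  have [h _] := yp_grow Y (ltW a0); rewrite mulrC (lt_le_trans _ h)//.
  by rewrite ltr_pMl ?(young_G_gt0 Y)// (yp_p1 Y).
have [ltab|ltba] := ltP a b.
  have [c /andP[ac cb] E] := slope a0 ltab.
  rewrite -ltrBrDl E ltr_pM2r ?subr_gt0//.
  exact: (yp_ginc Y) (ltW a0) ac.
have {ltba} ltba : b < a by rewrite lt_neqAle eq_sym ab.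
have [c /andP[bc ca] E] := slope b0 ltba.
have gca : g c < g a by apply: (yp_ginc Y) => //; exact: ltW (lt_trans b0 bc).
have : g c * (a - b) < g a * (a - b) by rewrite ltr_pM2r// subr_gt0.
rewrite -E; lra.
Qed.

(** By symmetry [a >= 0]. The tangent line then has nonnegative slope, so its value at [b < 0] is at
    most its value at [- b], and the half-line inequality applies; only [a = - b] needs a separate
    look. *)
Lemma even_ext_tangent_lt (a b : R) : a != b -> GG a + gg a * (b - a) < GG b.
Proof.
wlog a0 : a b / 0 <= a.
  move=> H ab; have [/H->//|/ltW a0] := leP 0 a.
  have := H (- a) (- b); rewrite oppr_ge0 (inj_eq oppr_inj) => /(_ a0 ab).
  by rewrite !even_extN odd_extN -opprD mulrNN.
move=> ab; rewrite odd_ext_ge0// {1}/even_ext ger0_norm//.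
have [b0|b0] := leP 0 b.
  by rewrite /even_ext (ger0_norm b0) tangent_pos.
rewrite /even_ext (ltr0_norm b0).
have [E|ne] := eqVneq a (- b).
  rewrite -E gtrDl pmulr_rlt0 ?(young_g_gt0 Y)//; last by rewrite E oppr_gt0.
  by rewrite subr_lt0 (lt_le_trans b0).
have bn : 0 <= - b by rewrite oppr_ge0 ltW.
apply: le_lt_trans (tangent_pos a0 bn ne).
by rewrite lerD2l ler_wpM2l ?(young_g_ge0 Y)// lerD2r (le_trans (ltW b0)).
Qed.

Lemma even_ext_tangent (a b : R) : GG a + gg a * (b - a) <= GG b.
Proof.
have [->|/even_ext_tangent_lt/ltW//] := eqVneq a b.
by rewrite subrr mulr0 addr0.
Qed.

Lemma odd_ext_mono (a b : R) : 0 <= (gg a - gg b) * (a - b).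
Proof. by have := even_ext_tangent a b; have := even_ext_tangent b a; nra. Qed.

Lemma odd_ext_mono_lt (a b : R) : a != b -> 0 < (gg a - gg b) * (a - b).
Proof.
move=> ab; have h := even_ext_tangent_lt ab; rewrite eq_sym in ab.
by have := even_ext_tangent_lt ab; nra.
Qed.

Lemma even_ext_convex (t a b : R) : 0 <= t <= 1 ->
  GG ((1 - t) * a + t * b) <= (1 - t) * GG a + t * GG b.
Proof.
move=> /andP[t0 t1]; set m := (1 - t) * a + t * b.
have ha := even_ext_tangent m a; have hb := even_ext_tangent m b.
have t1' : 0 <= 1 - t by rewrite subr_ge0.
have h1 := ler_wpM2l t1' ha; have h2 := ler_wpM2l t0 hb.
apply: le_trans (lerD h1 h2); rewrite le_eqVlt; apply/orP; left; apply/eqP.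
rewrite /m; ring.
Qed.

Lemma convex_gap_ge0 (a b : R) : 0 <= convex_gap a b.
Proof.
have := even_ext_tangent ((a + b) / 2) a; have := even_ext_tangent ((a + b) / 2) b.
rewrite /convex_gap; set m := GG ((a + b) / 2); set s := gg _.
have -> : b - (a + b) / 2 = (b - a) / 2 by lra.
have -> : a - (a + b) / 2 = - ((b - a) / 2) by lra.
lra.
Qed.

Lemma convex_gap_gt0 (a b : R) : a != b -> 0 < convex_gap a b.
Proof.
move=> ab; have m1 : (a + b) / 2 != a.
  by apply: contra ab => /eqP h; apply/eqP; lra.
have := even_ext_tangent ((a + b) / 2) b; have := even_ext_tangent_lt m1.
rewrite /convex_gap; set m := GG ((a + b) / 2); set s := gg _.
have -> : b - (a + b) / 2 = (b - a) / 2 by lra.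
have -> : a - (a + b) / 2 = - ((b - a) / 2) by lra.
lra.
Qed.

(* Where [|a|] dominates [|b|] and [|f|] the gap is comparable to [GG a],
   because [G (r * t) <= r `^ p * G t] with [r `^ p < 1 / 2] for some
   [r > 1 / 2]; elsewhere the second term takes over. *)
Lemma convex_gap_coercive : exists c C : R, [/\ 0 < c, 0 <= C &
  forall a b f, c * GG (a - f) <= convex_gap a b + C * (GG b + GG f)].
Proof.
have pp1 : 0 < 1 + p by rewrite addr_gt0.
(* The exponent [2 / (1 + p)] is below 1, so [r > 1 / 2]; multiplied by [p] it exceeds 1, so
   [r ^ p < 1 / 2]. *)
pose r : R := 2^-1 `^ (2 / (1 + p)).
have r0 : 0 < r by rewrite powR_gt0// invr_gt0.
have h2 : 0 < (2^-1 : R) < 1 by lra.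
have mono (x y : R) : x < y -> 2^-1 `^ y < 2^-1 `^ x :> R.
  move=> xy; rewrite /powR gt_eqF; last by lra.
  by rewrite ltr_expR ltr_nM2r// ln_lt0.
have rhalf : 2^-1 < r.
  rewrite -[X in X < _](@powRr1 R 2^-1); last by lra.
  by apply: mono; rewrite ltr_pdivrMr// mul1r; have := yp_p1 Y; lra.
have rp : r `^ p < 2^-1.
  rewrite /r -powRrM -[X in _ < X](@powRr1 R 2^-1); last by lra.
  apply: mono; rewrite mulrAC ltr_pdivlMr// mul1r.
  by have := yp_p1 Y; lra.
have r1 : r <= 1.
  rewrite leNgt; apply/negP => r1; have : 1 <= r `^ p.
    by rewrite -(powRr0 r) ler_powR// ltW.
  by lra.
(* Dominance threshold: [|b| < e * |a|] puts [|(a + b) / 2|] below [r * |a|], because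
   [(1 + e) / 2 = r]. *)
pose e := 2 * r - 1; have e0 : 0 < e by rewrite /e; lra.
have e1 : e <= 1 by rewrite /e; lra.
pose K : R := 2 `^ q.
have K0 : 0 < K by rewrite powR_gt0.
pose d := 2^-1 - r `^ p; have d0 : 0 < d by rewrite /d subr_gt0.
pose L := (e^-1 `^ q); have L0 : 0 <= L by exact: powR_ge0.
have dK : 0 <= d / K by rewrite divr_ge0 ?(ltW d0) ?(ltW K0).
have KLK : 0 <= K * L * K + K by rewrite addr_ge0 ?mulr_ge0 ?(ltW K0).
exists (d / K), (d / K * (K * L * K + K)); split; first exact: divr_gt0.
  exact: mulr_ge0.
move=> a b f.
have Gb := even_ext_ge0 b; have Gf := even_ext_ge0 f.
have ab := convex_gap_ge0 a b.
have [hM|hM] := leP (e * `|a|) (`|b| + `|f|).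
  have hG : GG (a - f) <= (K * L * K + K) * (GG b + GG f).
    apply: le_trans (even_ext_sub _ _) _; rewrite -/K.
    have ha : GG a <= L * K * (GG b + GG f).
      have -> : GG a = G (e^-1 * (e * `|a|)) by rewrite mulKf ?gt_eqF.
      apply: le_trans (young_scale_ge1 Y _ _) _.
      - by rewrite invf_ge1.
      - by rewrite mulr_ge0 ?(ltW e0).
      rewrite -mulrA ler_wpM2l// (le_trans (young_G_le Y _ hM))//.
        by rewrite mulr_ge0 ?(ltW e0).
      exact: (young_G_add Y).
    rewrite mulrDl mulrDr lerD//.
      by rewrite -!mulrA ler_wpM2l ?(ltW K0)// mulrA.
    by rewrite ler_wpM2l ?(ltW K0)// lerDr.
  have := ler_wpM2l (ltW (divr_gt0 d0 K0)) hG; rewrite mulrA => h.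
  by rewrite (le_trans h)// lerDr.
have bf : `|b| < e * `|a| /\ `|f| < e * `|a|.
  by split; apply: le_lt_trans hM; rewrite ?lerDl ?lerDr.
have gap : d * GG a <= convex_gap a b.
  have hm : GG ((a + b) / 2) <= r `^ p * GG a.
    rewrite /even_ext (le_trans _ (young_scale_le1 Y _ _))//; last by rewrite (ltW r0).
    apply: (young_G_le Y) => //; rewrite normrM (@ger0_norm _ 2^-1); last by lra.
    have := ler_normD a b; rewrite /e in bf; case: bf => bf _; lra.
  rewrite /convex_gap /d; lra.
have hG : GG (a - f) <= K * GG a.
  apply: le_trans (young_scale_ge1 Y _ (normr_ge0 a)); last by lra.
  apply: (young_G_le Y) => //; have := ler_normB a f; case: bf => _ bf.
  have : e * `|a| <= `|a| by rewrite ler_piMl.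
  lra.
have h3 := ler_wpM2l (ltW (divr_gt0 d0 K0)) hG.
apply: (@le_trans _ _ (d * GG a)).
  by rewrite (le_trans h3)// mulrA divfK ?gt_eqF.
rewrite (le_trans gap)// lerDl.
apply: mulr_ge0; [exact: mulr_ge0|exact: addr_ge0].
Qed.

Lemma is_derive_even_ext (x : R) : is_derive x 1 GG (gg x).
Proof.
have pos (y : R) : 0 < y -> is_derive y 1 GG (g y).
  move=> y0; apply: (@near_eq_is_derive _ _ _ G).
    near=> z; rewrite /even_ext gtr0_norm//; near: z; exact: lt_nbhsr.
  exact: (yp_der Y).
have [x0|x0|<-] := ltgtP 0 x.
- by rewrite odd_ext_ge0 ?(ltW x0)//; exact: pos.
- have nx0 : 0 < - x by rewrite oppr_gt0.
  have -> : GG = (fun z => GG (- z)) by apply/funext => z; rewrite even_extN.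
  rewrite -[X in gg X]opprK odd_extN odd_ext_ge0 ?(ltW nx0)//.
  have h := @is_derive1_comp _ GG -%R x (g (- x)) (- 1) (pos _ nx0) (is_deriveNid x (1 : R)).
  by rewrite mulrN1 in h.
(* At 0 the difference quotient is at most [|h| ^ (p - 1)], from [G |h| <= |h| ^ p * G 1], and it
   tends to 0 since [p > 1]. *)
- rewrite odd_ext0.
  suff cv : h^-1 *: ((GG \o shift 0) (h *: (1 : R)) - GG 0) @[h --> 0^'] --> (0 : R).
    by split; [apply/cvg_ex; exists 0|exact: cvg_lim].
  apply/cvgrPdist_le => /= e e0.
  have p10 : 0 < p - 1 by rewrite subr_gt0 (yp_p1 Y).
  near=> h.
  have h0 : h != 0 by near: h; exact: nbhs_dnbhs_neq.
  have hd : `|h| < Num.min 1 (e `^ (p - 1)^-1).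
    by near: h; apply: dnbhs0_lt; rewrite lt_min ltr01 powR_gt0.
  rewrite sub0r normrN /= addr0 even_ext0 subr0 /GRing.scale/= mulr1.
  rewrite normrM normfV ger0_norm ?even_ext_ge0// ler_pdivrMl ?normr_gt0//.
  move: hd; rewrite lt_min => /andP[hd1 hde].
  have := @young_scale_le1 _ _ _ _ _ Y `|h| 1.
  rewrite normr_ge0 (ltW hd1) mulr1 (yp_G1 Y) mulr1 => /(_ isT ler01) hh.
  rewrite (le_trans hh)// -mulr_powRB1// ler_wpM2l//.
  have -> : e = (e `^ (p - 1)^-1) `^ (p - 1).
    by rewrite -powRrM mulVf ?gt_eqF// powRr1// ltW.
  by rewrite ge0_ler_powR ?(ltW p10)// ?nnegrE ?powR_ge0 ?(ltW hde).
Unshelve. all: by end_near. Qed.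

Lemma continuous_even_ext : continuous GG.
Proof.
move=> x; have [dG _] := is_derive_even_ext x.
exact/differentiable_continuous/derivable1_diffP.
Qed.

(** Compactness replaces a modulus of uniform convexity: the gap is continuous and positive off the
    diagonal, so it has a positive minimum on the compact set of pairs in question. *)
Lemma convex_gap_bounded_below (M e : R) : 0 < e -> exists2 d, 0 < d &
  forall a b, `|a| <= M -> `|b| <= M -> e <= `|a - b| -> d <= convex_gap a b.
Proof.
move=> e0.
pose A : set (R * R) := (`[- M, M] `*` `[- M, M])%classic `&`
  [set z | e <= `|z.1 - z.2|].
have cA : compact A.
  apply: (@subclosed_compact _ _ (`[- M, M] `*` `[- M, M])%classic).
  - apply: closedI.
      apply: (@closedI _ (fst @^-1` `[- M, M]) (snd @^-1` `[- M, M])).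
        apply: (@closed_comp (R * R)%type R fst `[- M, M]).
          by move=> z _; exact: cvg_fst.
        exact: interval_closed.
      apply: (@closed_comp (R * R)%type R snd `[- M, M]).
        by move=> z _; exact: cvg_snd.
      exact: interval_closed.
    apply: (@closed_comp _ _ (fun z : R * R => `|z.1 - z.2|) [set x | e <= x]).
      move=> z _; apply: cvg_norm; apply: cvgB; [exact: cvg_fst|exact: cvg_snd].
    exact: closed_ge.
  - by apply: compact_setX; exact: segment_compact.
  - by move=> z [].
have [A0|/set0P A0] := eqVneq A set0.
  exists 1 => // a b ha hb hab; exfalso.
  have : A (a, b) by split => //; split; rewrite /= in_itv/= -ler_norml.
  by rewrite A0.
have cgap : {within A, continuous (fun z : R * R => convex_gap z.1 z.2)}.
  apply: continuous_subspaceT => z; rewrite /convex_gap.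
  apply: cvgB.
    apply: cvgMl; apply: cvgD.
      by apply: (@continuous_comp _ _ _ fst GG); [exact: cvg_fst|exact: continuous_even_ext].
    by apply: (@continuous_comp _ _ _ snd GG); [exact: cvg_snd|exact: continuous_even_ext].
  apply: (@continuous_comp _ _ _ (fun z : R * R => (z.1 + z.2) / 2) GG).
    by apply: cvgMl; apply: cvgD; [exact: cvg_fst|exact: cvg_snd].
  exact: continuous_even_ext.
have [c cA' hmin] := compact_EVT_min A0 cA cgap.
exists (convex_gap c.1 c.2).
  apply: convex_gap_gt0; move: cA'; rewrite inE => -[_ /= h].
  by apply/eqP => E; move: (lt_le_trans e0 h); rewrite E subrr normr0 ltxx.
move=> a b ha hb hab; apply: (hmin (a, b)); rewrite inE.
by split => //; split; rewrite /= in_itv/= -ler_norml.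
Qed.

Lemma measurable_even_ext : measurable_fun setT GG.
Proof. by apply: continuous_measurable_fun; exact: continuous_even_ext. Qed.

Lemma measurable_odd_ext : measurable_fun setT gg.
Proof.
apply: nondecreasing_measurable => // x y xy.
have := odd_ext_mono y x; have := odd_ext_mono_lt; move: xy.
rewrite le_eqVlt => /predU1P[->//|xy] /(_ y x); rewrite gt_eqF// => /(_ isT) + _.
by rewrite pmulr_lgt0 ?subr_gt0// => /ltW.
Qed.

End EvenYoung.

(** * Iterated Lebesgue integral as a Borel measure *)

Section BorelRow.
Variable R : realType.

(** Generating by coordinates rather than by open sets makes measurability of maps into row vectors
    a coordinatewise check. That this is the Borel sigma-algebra follows from [open_measurable_rV]
    and [measurable_rV_ind]. *)
Definition coord_system (m : nat) : set (set 'rV[R]_m) :=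
  [set A | exists i (B : set R), measurable B /\ A = [set x : 'rV[R]_m | B (x 0 i)]].

HB.instance Definition _ (m : nat) :=
  @isMeasurable.Build (sigma_display (@coord_system m)) 'rV[R]_m
    <<s @coord_system m >> (@sigma_algebra0 _ setT (@coord_system m))
    (@sigma_algebraC _ (@coord_system m))
    (@sigma_algebra_bigcup _ setT (@coord_system m)).

Lemma measurable_coord (m : nat) (i : 'I_m) :
  measurable_fun setT (fun x : 'rV[R]_m => x 0 i).
Proof.
move=> _ B mB; rewrite setTI; apply: sub_sigma_algebra.
by exists i, B; split.
Qed.

Lemma measurable_fun_rV d (T : measurableType d) (m : nat) (f : T -> 'rV[R]_m) :
  (forall i, measurable_fun setT (fun x => f x 0 i)) -> measurable_fun setT f.
Proof.
move=> mf; apply: (measurability (@coord_system m)) => //.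
move=> _ [_ [i [B [mB ->]]] <-]; exact: mf.
Qed.

(** The same gluing as in the recursive clause of [iint], so that [leb] can follow that
    recursion. *)
Definition consr (m : nat) (z : measurableTypeR R * 'rV[R]_m) : 'rV[R]_m.+1 :=
  row_mx (z.1%:M : 'rV[R]_1) z.2.

Lemma measurable_consr m : measurable_fun setT (@consr m).
Proof.
apply: measurable_fun_rV => i; rewrite /consr.
under eq_fun do rewrite mxE.
case: splitP => j _.
  under eq_fun do rewrite mxE [j]ord1 eqxx mulr1n.
  exact: measurable_fst.
apply: (@measurableT_comp _ _ _ _ _ _ (fun x : 'rV[R]_m => x 0 j) _ snd).
  exact: measurable_coord.
exact: measurable_snd.
Qed.


Definition unconsr (m : nat) (x : 'rV[R]_m.+1) : measurableTypeR R * 'rV[R]_m :=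
  (x 0 0, @rsubmx R 1 1 m x).

Lemma consrK m : cancel (@consr m) (@unconsr m).
Proof.
move=> [t x]; rewrite /consr /unconsr row_mxKr; congr (_, _).
rewrite mxE; case: splitP => [j _|j]; first by rewrite [j]ord1 mxE eqxx mulr1n.
by [].
Qed.

Lemma measurable_unconsr m : measurable_fun setT (@unconsr m).
Proof.
apply/measurable_fun_pairP; split; first exact: measurable_coord.
apply: measurable_fun_rV => i; rewrite /unconsr /comp /=.
under eq_fun do rewrite mxE.
exact: measurable_coord.
Qed.

Section step.
Variables (m : nat) (mu : {sigma_finite_measure set 'rV[R]_m -> \bar R}).

Definition leb_step : {measure set 'rV[R]_m.+1 -> \bar R} :=
  measure_function_pushforward__canonical__measure_function_Measure
    (product_measure1 (@lebesgue_measure R) mu) (@measurable_consr m).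

Lemma sigma_finite_leb_step : sigma_finite setT leb_step.
Proof.
have /sigma_finiteP[F [TF ndF Foo]] := sigma_finiteT (@lebesgue_measure R).
have /sigma_finiteP[K [TK ndK Koo]] := sigma_finiteT mu.
exists (fun k => @unconsr m @^-1` (F k `*` K k)).
  apply/seteqP; split => // x _.
  have [i _ Fi] : (\bigcup_i F i) (unconsr x).1 by rewrite -TF.
  have [j _ Kj] : (\bigcup_i K i) (unconsr x).2 by rewrite -TK.
  exists (maxn i j) => //; split.
  - by move: Fi; exact/subsetPset/ndF/leq_maxl.
  - by move: Kj; exact/subsetPset/ndK/leq_maxr.
move=> k; have [mF F1] := Foo k; have [mK K1] := Koo k.
have mFK : measurable (F k `*` K k) by exact: measurableX.
split; first by rewrite -[X in measurable X]setTI; exact: measurable_unconsr.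
rewrite /leb_step /= /pushforward -comp_preimage.
have -> : @unconsr m \o @consr m = id by apply/funext => z; exact: consrK.
by rewrite preimage_id product_measure1E// lte_mul_pinfty// ge0_fin_numE.
Qed.

(** Sigma-finiteness has to travel with the measure through the recursion, since the next product
    measure and Tonelli's theorem require it. *)
Definition leb_step_sf : {sigma_finite_measure set 'rV[R]_m.+1 -> \bar R} :=
  HB.pack_for (sigma_finite_measure 'rV[R]_m.+1 R) (Measure.sort leb_step)
    (Measure.class leb_step)
    (@Measure_isSigmaFinite.Build _ 'rV[R]_m.+1 R leb_step sigma_finite_leb_step).
End step.

Fixpoint leb (m : nat) : {sigma_finite_measure set 'rV[R]_m -> \bar R} :=
  match m with
  | 0 => @dirac _ 'rV[R]_0 (0 : 'rV[R]_0) R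
  | m'.+1 => leb_step_sf (leb m')
  end.

(** The link between the integral of the statement and measure theory: induction on the dimension,
    one Tonelli step per coordinate. Integrands that are Borel only up to a null set are covered
    later by [iint_ae]. *)
Lemma iint_leb (m : nat) (f : 'rV[R]_m -> \bar R) : measurable_fun setT f ->
  (forall x, 0 <= f x)%E -> iint f = (\int[leb m]_x f x)%E.
Proof.
elim: m f => [|m IH] f mf f0 /=; first by rewrite integral_dirac// diracT mul1e.
rewrite ge0_integral_pushforward//=; last exact: measurable_consr.
rewrite preimage_setT fubini_tonelli1//; last first.
  exact: measurableT_comp mf (@measurable_consr m).
apply: eq_integral => t _; rewrite IH//.
apply: (measurableT_comp mf).
exact: measurableT_comp (@measurable_consr m) (measurable_pair1 t).
Qed.

End BorelRow.

(** * Cubes, open sets and the Borel sigma-algebra of row vectors *)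

Section CubesAndOpenSets.
Variable R : realType.

Definition cube (m : nat) (c : 'rV[R]_m) (r : R) : set 'rV[R]_m :=
  [set x | forall i, `|x 0 i - c 0 i| < r].

Lemma ball_cube m (c : 'rV[R]_m) (r : R) : 0 < r -> ball c r = cube c r.
Proof.
move=> r0; apply/seteqP; split => x.
  by move=> [_ h] i; have := h 0 i; rewrite /ball/= distrC.
move=> h; split => // i j; rewrite ord1 /ball/= distrC; exact: h.
Qed.

Lemma measurable_cube m (c : 'rV[R]_m) (r : R) : measurable (cube c r).
Proof.
have -> : cube c r = \bigcap_(i in [set: 'I_m]) ((fun x : 'rV[R]_m => x 0 i) @^-1` (ball (c 0 i) r)).
  apply/seteqP; split => x h i.
    by move=> _; rewrite /ball/= distrC; exact: h.
  by have := h i I; rewrite /ball/= distrC.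
apply: fin_bigcap_measurable => // i _.
by rewrite -[X in measurable X]setTI; apply: measurable_coord => //; exact: measurable_ball.
Qed.

Lemma open_cube m (c : 'rV[R]_m) (r : R) : open (cube c r).
Proof.
have [r0|r0] := ltP 0 r; first by rewrite -ball_cube//; exact: ball_open.
case: m c => [|m] c.
  have -> : cube c r = setT by apply/seteqP; split => // x _ [].
  exact: openT.
have -> : cube c r = set0; last exact: open0.
apply/seteqP; split => // x /(_ ord0).
by rewrite ltNge (le_trans r0).
Qed.

Lemma leb_cube m (c : 'rV[R]_m) (r : R) : 0 <= r ->
  leb R m (cube c r) = ((2 * r) ^+ m)%:E.
Proof.
move=> r0; elim: m c => [|m IH] c.
  rewrite expr0 /= /dirac/= indicE; congr (_ %:E).
  by rewrite mem_set// => -[].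
rewrite /= /pushforward.
have -> : @consr R m @^-1` cube c r =
    ball (c 0 0) r `*` cube (@rsubmx R 1 1 m c) r.
  apply/seteqP; split => -[t x].
    move=> h; split => /=.
      have := h 0; rewrite /consr mxE; case: splitP => [j _|//].
      by rewrite [j]ord1 mxE eqxx mulr1n /ball/= distrC.
    move=> i; have := h (rshift 1 i).
    have -> : consr (t, x) 0 (rshift 1 i) = x 0 i by exact: row_mxEr.
    by rewrite mxE.
  move=> [/= h1 h2] i; rewrite /consr mxE; case: splitP => j ij.
    rewrite [j]ord1 mxE eqxx mulr1n distrC; move: h1; rewrite /ball/=.
    by rewrite [i](_ : i = 0)//; apply/val_inj; rewrite /= ij [j]ord1.
  have := h2 j; rewrite mxE.
  by rewrite (_ : i = @rshift 1 m j)//; apply/val_inj; rewrite /= ij.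
rewrite product_measure1E//; last first.
- exact: measurable_cube.
- exact: measurable_ball.
rewrite IH exprS EFinM mulr_natl; congr (_ * _)%E.
exact: lebesgue_measure_ball.
Qed.

(** Cubes are finite intersections of coordinate cylinders, and an open set is the union of the
    countably many cubes of rational centre and radius [1 / (k + 1)] that it contains. *)
Lemma open_measurable_rV m (A : set 'rV[R]_m) : open A -> measurable A.
Proof.
move=> oA.
pose F (z : 'rV[rat]_m * nat) : set 'rV[R]_m :=
  if `[< cube (map_mx ratr z.1) z.2.+1%:R^-1 `<=` A >]
  then cube (map_mx ratr z.1) z.2.+1%:R^-1 else set0.
have -> : A = \bigcup_z F z.
  apply/seteqP; split => x; last first.
    by move=> [z _]; rewrite /F; case: asboolP => // h; exact: h.
  move=> Ax; have /nbhs_ballP[e /= e0 eA] : nbhs x A by exact: open_nbhs_nbhs.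
  have [k /= ke] : exists k : nat, k.+1%:R^-1 < e / 2.
    have e20 : 0 < e / 2 by rewrite divr_gt0.
    have [k] := ltr_add_invr e20.
    by rewrite add0r; exists k.
  have k0 : 0 < k.+1%:R^-1 :> R by rewrite invr_gt0.
  have /choice[c hc] : forall i, exists q : rat, `|x 0 i - ratr q| < k.+1%:R^-1.
    move=> i; have [q] := @rat_in_itvoo R (x 0 i) (x 0 i + k.+1%:R^-1) ltac:(by rewrite ltrDl).
    rewrite in_itv/= => /andP[h1 h2]; exists q.
    by rewrite distrC gtr0_norm ?subr_gt0// ltrBlDl.
  exists (\row_i c i, k) => //; rewrite /F /=.
  case: asboolP => [_|[]].
    by move=> i; rewrite !mxE.
  move=> y hy; apply: eA; rewrite ball_cube// => i.
  have := hy i; have := hc i; rewrite /= !mxE; set ki := k.+1%:R^-1 in ke *; move=> h1 h2.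
  rewrite (_ : y 0 i - x 0 i = (y 0 i - ratr (c i)) - (x 0 i - ratr (c i))); last by ring.
  by apply: le_lt_trans (ler_normB _ _) _; lra.
apply: countable_bigcupT_measurable => // z; rewrite /F.
by case: asboolP => // _; exact: measurable_cube.
Qed.

Lemma continuous_measurable_rV m (f : 'rV[R]_m -> R) :
  continuous f -> measurable_fun setT f.
Proof.
move=> cf; apply: (measurability _ (RGenOpens.measurableE R)).
move=> _ [_ [a [b ->]] <-]; rewrite setTI; apply: open_measurable_rV.
by apply: open_comp => [x _|]; [exact: cf|exact: interval_open].
Qed.

(** Induction principle for Borel sets. Coordinates are continuous, so preimages of open intervals
    are open, and the generators lie in any sigma-algebra that contains the open sets. *)
Lemma measurable_rV_ind m (D : set (set 'rV[R]_m)) :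
  sigma_algebra setT D -> (forall U, open U -> D U) -> measurable `<=` D.
Proof.
move=> sD oD; have [D0 DC DU] := sD.
apply: smallest_sub => // _ [i [B [mB ->]]].
pose E : set (set R) := [set B | D [set x : 'rV[R]_m | B (x 0 i)]].
suff : measurable `<=` E by apply.
have sE : sigma_algebra setT E.
  split; rewrite /E /=.
  - by rewrite (_ : [set x | _] = set0).
  - move=> A DA; have := DC _ DA; congr D; apply/seteqP; split => x //=.
  - by move=> A DA; have := DU _ DA; congr D; apply/seteqP; split.
have coordc : continuous (fun x : 'rV[R]_m => x 0 i) by move=> x; exact: coord_continuous.
have oE B' : open B' -> E B'.
  by move=> oB; apply: oD; apply: (@open_comp _ _ (fun x : 'rV[R]_m => x 0 i)) => // x _; exact: coordc.
move=> B0 mB0; have : (@RGenOpens.G R).-sigma.-measurable B0 by rewrite -(RGenOpens.measurableE R).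
move: B0 {mB0}; apply: smallest_sub => // _ [a [b ->]]; apply: oE.
exact: interval_open.
Qed.

End CubesAndOpenSets.

(** * Outer regularity, and agreement of [louter] with [leb] on Borel sets *)

Section OuterRegularity.
Variables (R : realType) (m : nat).
Local Notation mu := (leb R m).

Lemma iint_indic (A : set 'rV[R]_m) : measurable A ->
  iint (fun x => (\1_A x)%:E) = mu A.
Proof.
move=> mA; rewrite iint_leb//; first by rewrite integral_indic// setIT.
by apply/measurable_EFinP; exact: measurable_indic.
Qed.

Lemma louter_open (U E : set 'rV[R]_m) : open U -> E `<=` U -> (louter E <= mu U)%E.
Proof.
move=> oU EU; apply: ereal_inf_lbound; exists U => //.
by rewrite iint_indic//; exact: open_measurable_rV.
Qed.

Lemma louter_ge0 (E : set 'rV[R]_m) : (0 <= louter E)%E.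
Proof.
apply: le_ereal_inf_tmp => _ [U [oU _] <-].
by rewrite iint_indic ?measure_ge0//; exact: open_measurable_rV.
Qed.

Lemma le_louter (A B : set 'rV[R]_m) : A `<=` B -> (louter A <= louter B)%E.
Proof.
move=> AB; apply: ereal_inf_le_tmp => _ [U [oU BU] <-].
by exists U => //; split => //; exact: subset_trans BU.
Qed.

Lemma louter_adherent (E : set 'rV[R]_m) (e : R) : 0 < e -> (louter E < +oo)%E ->
  exists U, [/\ open U, E `<=` U & (mu U < louter E + e%:E)%E].
Proof.
move=> e0 Eoo; have fE : louter E \is a fin_num by rewrite ge0_fin_numE// louter_ge0.
have [_ [U [oU EU] <-] h] := lb_ereal_inf_adherent e0 fE.
by exists U; split => //; rewrite -iint_indic//; exact: open_measurable_rV.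
Qed.

Lemma louterU (A B : set 'rV[R]_m) : (louter (A `|` B) <= louter A + louter B)%E.
Proof.
have [->|Aoo] := eqVneq (louter A) +oo%E.
  by rewrite addye ?leey// gt_eqF// (lt_le_trans _ (louter_ge0 _)).
have [->|Boo] := eqVneq (louter B) +oo%E.
  by rewrite addey ?leey// gt_eqF// (lt_le_trans _ (louter_ge0 _)).
apply/lee_addgt0Pr => e e0.
have e20 : 0 < e / 2 by rewrite divr_gt0.
rewrite -ltey in Aoo; rewrite -ltey in Boo.
have [U [oU AU hU]] := louter_adherent e20 Aoo.
have [V [oV BV hV]] := louter_adherent e20 Boo.
have h : (louter (A `|` B) <= mu (U `|` V))%E.
  by apply: louter_open; [exact: openU|exact: setUSS].
apply: (le_trans h).
apply: le_trans (measureU2 _ _ _) _; [exact: open_measurable_rV|exact: open_measurable_rV|].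
apply: le_trans (leeD (ltW hU) (ltW hV)) _.
by rewrite addeACA -EFinD -splitr.
Qed.

Lemma nonincreasing_mu_lt (F : (set 'rV[R]_m)^nat) (e : \bar R) :
  (forall i, measurable (F i)) -> nonincreasing_seq F -> (mu (F 0%N) < +oo)%E ->
  (mu (\bigcap_n F n) < e)%E -> exists n, (mu (F n) < e)%E.
Proof.
move=> mF dF F0 Fe; apply: contrapT => /forallNP h.
have mcap : measurable (\bigcap_n F n) by exact: bigcapT_measurable.
have cv := nonincreasing_cvg_mu F0 mF mcap dF.
move: Fe; rewrite ltNge => /negP; apply.
rewrite -(cvg_lim _ cv)//; apply: lime_ge; first exact: cvgP cv.
by apply: nearW => n; rewrite leNgt; exact/negP/h.
Qed.

End OuterRegularity.

Section LebesgueOuterMeasure.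
Variables (R : realType) (m : nat).
Local Notation mu := (leb R m).
Local Notation T := 'rV[R]_m.

Lemma bigcup_cube : \bigcup_(k : nat) cube (0 : T) k.+1%:R = setT.
Proof.
apply/seteqP; split => // x _.
have [M hM] : exists M : R, forall i, `|x 0 i| <= M.
  exists (\sum_i `|x 0 i|) => i; rewrite (bigD1 i)//= lerDl.
  by apply: sumr_ge0.
exists (Num.truncn `|M|) => // i; rewrite mxE subr0.
by rewrite (le_lt_trans (hM i))// (le_lt_trans (ler_norm _))// truncnS_gt.
Qed.

Lemma leb_cube_fin (r : R) : (mu (cube (0 : T) r) < +oo)%E.
Proof.
have [r0|r0] := leP 0 r; first by rewrite leb_cube// ltey.
apply: (@le_lt_trans _ _ (mu (cube (0 : T) 0))); last by rewrite leb_cube// ltey.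
apply: le_measure; rewrite ?inE; [exact: measurable_cube|exact: measurable_cube|].
by move=> x h i; exact: lt_trans (h i) r0.
Qed.

(** The condition is symmetric in [B] and its complement, which makes closure under complements
    immediate. The overlap of [U] and [V] stands for an open set minus a closed one, and the window
    [Q] of finite measure permits continuity from above. *)
Definition regular_in (Q : set T) : set (set T) :=
  [set B | forall e : R, 0 < e -> exists U V, [/\ open U, open V, B `<=` U,
    ~` B `<=` V & (mu (U `&` V `&` Q) < e%:E)%E]].

(** [U] serves as its own outer set. Its complement is covered by its neighbourhoods of width
    [1 / (j + 1)], whose traces on [U] decrease to the empty set because [U] is open. *)
Lemma regular_in_open (Q U : set T) : open Q -> (mu Q < +oo)%E -> open U ->
  regular_in Q U.
Proof.
move=> oQ Qoo oU e e0.
pose V (j : nat) : set T := \bigcup_(y in ~` U) cube y j.+1%:R^-1.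
have oV j : open (V j) by apply: bigcup_open => y _; exact: open_cube.
have mF j : measurable (U `&` V j `&` Q).
  by apply: open_measurable_rV; apply: openI => //; exact: openI.
have dF : nonincreasing_seq (fun j => U `&` V j `&` Q).
  move=> i j ij; apply/subsetPset => x [[Ux [y Uy h]] Qx]; split => //; split => //.
  exists y => // l; apply: lt_le_trans (h l) _.
  by rewrite lef_pV2 ?posrE// ler_nat.
have F0 : (mu (U `&` V 0%N `&` Q) < +oo)%E.
  apply: le_lt_trans Qoo; apply: le_measure; rewrite ?inE//.
  exact: open_measurable_rV.
have cap0 : \bigcap_j (U `&` V j `&` Q) = set0.
  apply/seteqP; split => // x h.
  have [[Ux _] _] := h 0%N I.
  have /nbhs_ballP[d /= d0 dU] : nbhs x U by exact: open_nbhs_nbhs.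
  have [j] := ltr_add_invr d0; rewrite add0r => jd.
  have [[_ [y Uy hy]] _] := h j I; apply: Uy; apply: dU.
  rewrite ball_cube// => i; rewrite distrC; exact: lt_trans (hy i) jd.
have [|j hj] := @nonincreasing_mu_lt R m _ e%:E mF dF F0.
  by rewrite cap0 measure0 lte_fin.
exists U, (V j); split => // x Ux; exists x => // i.
by rewrite subrr normr0 invr_gt0.
Qed.

Lemma regular_in_sigma (Q : set T) : open Q -> (mu Q < +oo)%E ->
  sigma_algebra setT (regular_in Q).
Proof.
move=> oQ Qoo; split.
- by apply: regular_in_open => //; exact: open0.
- move=> A hA e e0; have [U [V [oU oV AU AV h]]] := hA e e0.
  exists V, U; split => //.
  + by rewrite setTD.
  + by rewrite setTD setCK.
  + by rewrite (setIC V).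
- move=> A hA e e0.
  have e20 : 0 < e / 2 by rewrite divr_gt0.
  have /choice[UV hUV] : forall i : nat, exists UV : set T * set T,
      [/\ open UV.1, open UV.2, A i `<=` UV.1, ~` A i `<=` UV.2 &
      (mu (UV.1 `&` UV.2 `&` Q) < (e / 2 / (2 ^ i.+1)%:R)%:E)%E].
    move=> i; have [U [V h]] := hA i (e / 2 / (2 ^ i.+1)%:R)
      ltac:(by rewrite divr_gt0// ltr0n expn_gt0).
    by exists (U, V).
  pose U := \bigcup_i (UV i).1.
  have oU : open U by apply: bigcup_open => i _; case: (hUV i).
  (* Only finite intersections of the sets [(UV i).2] are known to be open. The infinite
     intersection meets [U] inside [Q] in measure at most [e / 2], so continuity from above allows
     stopping at some [N]. *)
  pose W N : set T := \big[setI/setT]_(i < N) (UV i).2.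
  have oW N : open (W N).
    rewrite /W; elim/big_ind : _ => [|X Z|i _]; [exact: openT|exact: openI|].
    by case: (hUV i).
  have WP N x : W N x <-> forall i, (i < N)%N -> (UV i).2 x.
    by rewrite /W -(bigcap_mkord N (fun i => (UV i).2)); split => [h i iN|h i iN]; exact: h.
  have mF j : measurable (U `&` W j `&` Q).
    by apply: open_measurable_rV; apply: openI => //; exact: openI.
  have mG j : measurable ((UV j).1 `&` (UV j).2 `&` Q).
    apply: open_measurable_rV; apply: openI => //.
    by have [oU1 oU2 _ _ _] := hUV j; exact: openI.
  have dF : nonincreasing_seq (fun j => U `&` W j `&` Q).
    move=> i j ij; apply/subsetPset => x [[Ux /WP h] Qx]; split => //; split => //.
    by apply/WP => l li; apply: h; exact: leq_trans ij.
  have F0 : (mu (U `&` W 0%N `&` Q) < +oo)%E.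
    apply: le_lt_trans Qoo; apply: le_measure; rewrite ?inE//.
    exact: open_measurable_rV.
  have [|N hN] := @nonincreasing_mu_lt R m _ e%:E mF dF F0.
    apply: (@le_lt_trans _ _ (e / 2)%:E); last by rewrite lte_fin; lra.
    apply: le_trans (epsilon_trick0 xpredT (ltW e20)).
    apply: (@le_trans _ _ (\sum_(0 <= i <oo) mu ((UV i).1 `&` (UV i).2 `&` Q))%E).
      apply: measure_sigma_subadditive => //; first exact: bigcapT_measurable.
      move=> x h; have [[[i _ Ui] _] Qx] := h 0%N I.
      exists i => //; split => //; split => //.
      by have [[_ /WP hW] _] := h i.+1 I; exact: hW.
    by apply: lee_nneseries => // i _; have [_ _ _ _ /ltW] := hUV i.
  exists U, (W N); split => //.
    by move=> x [i _ Ai]; exists i => //; have [_ _ h _ _] := hUV i; exact: h.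
  move=> x nA; apply/WP => i _; have [_ _ _ h _] := hUV i; apply: h => Ai.
  by apply: nA; exists i.
Qed.

(** Regularity is available only inside windows of finite measure. The outer sets found in the cubes
    of half-side [i + 1] are cut down to these cubes and united; the excess over [B] in the [i]-th
    cube is below [e / 2 ^ (i + 1)]. *)
Lemma louter_measurable (B : set T) : measurable B -> (louter B <= mu B)%E.
Proof.
move=> mB; apply/lee_addgt0Pr => e e0.
have reg k : regular_in (cube 0 k.+1%:R) B.
  have oQ : open (cube (0 : T) k.+1%:R) by exact: open_cube.
  apply: (measurable_rV_ind (regular_in_sigma oQ (leb_cube_fin _))) => //.
  by move=> U oU; apply: regular_in_open => //; exact: leb_cube_fin.
have /choice[UV hUV] : forall i : nat, exists UV : set T * set T,
    [/\ open UV.1, open UV.2, B `<=` UV.1, ~` B `<=` UV.2 &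
    (mu (UV.1 `&` UV.2 `&` cube 0 i.+1%:R) < (e / (2 ^ i.+1)%:R)%:E)%E].
  move=> i; have [U [V h]] := reg i (e / (2 ^ i.+1)%:R)
    ltac:(by rewrite divr_gt0// ltr0n expn_gt0).
  by exists (U, V).
pose U := \bigcup_i ((UV i).1 `&` cube (0 : T) i.+1%:R).
have oU : open U.
  apply: bigcup_open => i _; apply: openI; last exact: open_cube.
  by case: (hUV i).
pose E i := (UV i).1 `&` (UV i).2 `&` cube (0 : T) i.+1%:R.
have mE i : measurable (E i).
  apply: open_measurable_rV; apply: openI; last exact: open_cube.
  by have [oU1 oU2 _ _ _] := hUV i; exact: openI.
apply: (@le_trans _ _ (mu U)).
  apply: louter_open => // x Bx.
  have [k _ kx] : (\bigcup_(k : nat) cube (0 : T) k.+1%:R) x by rewrite bigcup_cube.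
  by exists k => //; split => //; have [_ _ h _ _] := hUV k; exact: h.
apply: (@le_trans _ _ (mu (B `|` \bigcup_i E i))).
  apply: le_measure; rewrite ?inE; first exact: open_measurable_rV.
    by apply: measurableU => //; exact: bigcupT_measurable.
  move=> x [i _ [Ux Qx]]; have [Bx|nBx] := pselect (B x); first by left.
  right; exists i => //; split => //; split => //.
  by have [_ _ _ h _] := hUV i; exact: h.
apply: le_trans (measureU2 _ mB _) _; first exact: bigcupT_measurable.
rewrite leeD2l//; apply: le_trans (epsilon_trick0 xpredT (ltW e0)).
apply: (@le_trans _ _ (\sum_(0 <= i <oo) mu (E i))%E).
  by apply: measure_sigma_subadditive => //; exact: bigcupT_measurable.
by apply: lee_nneseries => // i _; have [_ _ _ _ /ltW] := hUV i.
Qed.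

Lemma louterE (B : set T) : measurable B -> louter B = mu B.
Proof.
move=> mB; apply/eqP; rewrite eq_le louter_measurable//=.
apply: le_ereal_inf_tmp => _ [U [oU BU] <-].
rewrite iint_indic; last exact: open_measurable_rV.
by apply: le_measure => //; rewrite inE//; exact: open_measurable_rV.
Qed.

Lemma louter_Gdelta (E : set T) : (louter E < +oo)%E -> exists H,
  [/\ measurable H, E `<=` H & mu H = louter E].
Proof.
move=> Eoo.
have /choice[U hU] : forall i : nat, exists U, [/\ open U, E `<=` U &
    (mu U < louter E + (i.+1%:R^-1)%:E)%E].
  by move=> i; apply: louter_adherent => //; rewrite invr_gt0.
have mU i : measurable (U i) by apply: open_measurable_rV; case: (hU i).
have mH : measurable (\bigcap_i U i) by exact: bigcapT_measurable.
have EH : E `<=` \bigcap_i U i by move=> x Ex i _; have [_ h _] := hU i; exact: h.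
exists (\bigcap_i U i); split => //.
apply/eqP; rewrite eq_le -{2}louterE// le_louter// andbT.
apply/lee_addgt0Pr => e e0; have [i] := ltr_add_invr e0; rewrite add0r => ie.
have [_ _ /ltW h] := hU i.
apply: (@le_trans _ _ (mu (U i))).
  by apply: le_measure; rewrite ?inE// => x; exact.
by apply: (le_trans h); rewrite leeD2l// lee_fin ltW.
Qed.

(** Null sets of the outer measure are the subsets of Borel null sets: a G-delta hull gives one
    direction, [louterE] the other. *)
Lemma ae_leb (P : T -> Prop) : ae P <-> {ae mu, forall x, P x}.
Proof.
rewrite /ae; split => [P0|[N [mN N0 PN]]].
  have [|H [mH PH muH]] := @louter_Gdelta [set x | ~ P x]; first by rewrite P0.
  by exists H; split => //; rewrite muH.
apply/eqP; rewrite eq_le louter_ge0 andbT -N0 -(louterE mN).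
exact: le_louter.
Qed.

Lemma measurable_lmeasurable (A : set T) : measurable A -> lmeasurable A.
Proof.
move=> mA E; apply/eqP; rewrite eq_le; apply/andP; split.
  by apply: le_trans (louterU _ _); apply: le_louter => x Ex; have [Ax|nAx] := pselect (A x); [left|right].
apply: le_ereal_inf_tmp => _ [U [oU EU] <-].
have mU : measurable U by exact: open_measurable_rV.
rewrite iint_indic// (measureDI mu mU mA) addeC; apply: leeD.
  apply: le_trans (louter_measurable _); last exact: measurableD.
  by apply: le_louter; exact: setSD.
apply: le_trans (louter_measurable _); last exact: measurableI.
by apply: le_louter; exact: setSI.
Qed.

Lemma measurable_fun_lmeasurable (u : T -> R) : measurable_fun setT u ->
  lmeasurable_fun u.
Proof.
move=> mu' t; apply: measurable_lmeasurable.
rewrite (_ : [set x | u x < t] = setT `&` u @^-1` `]-oo, t[%classic).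
  by apply: mu' => //; exact: measurable_itv.
by rewrite setTI; apply/seteqP; split => x; rewrite /= in_itv.
Qed.

(** Cutting with cubes makes the outer measures finite. The Caratheodory identity, tested on the
    hull [H k] cut with its cube, then lets the finite measure of the part in [A] be cancelled, and
    the difference is null. *)
Lemma lmeasurable_borel (A : set T) : lmeasurable A -> exists B,
  [/\ measurable B, A `<=` B & mu.-negligible (B `\` A)].
Proof.
move=> lA; pose Q k := cube (0 : T) k.+1%:R.
have mQ k : measurable (Q k) by exact: measurable_cube.
have Aoo k : (louter (A `&` Q k) < +oo)%E.
  apply: (@le_lt_trans _ _ (mu (Q k))); last exact: leb_cube_fin.
  by rewrite -louterE//; exact: le_louter.
have /choice[H hH] := fun k => louter_Gdelta (Aoo k).
have neg k : mu.-negligible ((H k `&` Q k) `\` A).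
  have [mH AH muH] := hH k.
  have mHQ : measurable (H k `&` Q k) by exact: measurableI.
  have h1 := lA (H k `&` Q k).
  have h2 : (louter (A `&` Q k) <= louter (H k `&` Q k `&` A))%E.
    by apply: le_louter => x [Ax Qx]; split => //; split => //; exact: AH.
  have h3 : (louter (H k `&` Q k) <= louter (A `&` Q k))%E.
    by rewrite -muH -(louterE mH); exact: le_louter.
  have /(ae_leb (fun x => ~ ((H k `&` Q k) `\` A) x)) : louter [set x | ~ ~ ((H k `&` Q k) `\` A) x] = 0%E.
    rewrite (_ : [set x | _] = (H k `&` Q k) `\` A); last first.
      by apply/seteqP; split => x /= h; [exact: contrapT|exact].
    apply/eqP; rewrite eq_le louter_ge0 andbT.
    have fA : louter (A `&` Q k) \is a fin_num by rewrite ge0_fin_numE ?louter_ge0.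
    move: h3; rewrite h1 => h3.
    have := le_trans (leeD2r (louter ((H k `&` Q k) `\` A)) h2) h3.
    by rewrite -[X in (_ <= X)%E]adde0 leeD2lE.
  case=> N [mN N0 sN]; exists N; split => // x hx; apply: sN => /=.
  by move=> h; exact: h.
exists (\bigcup_k (H k `&` Q k)); split.
- apply: bigcupT_measurable => k; apply: measurableI => //.
  by case: (hH k).
- move=> x Ax; have [k _ kx] : (\bigcup_k Q k) x by rewrite bigcup_cube.
  by exists k => //; split => //; have [_ h _] := hH k; apply: h; split.
- rewrite setDE setI_bigcupl; apply: negligible_bigcup => k.
  by rewrite -setDE.
Qed.

End LebesgueOuterMeasure.

(** * Iterated integrals of arbitrary functions, Borel representatives, Tonelli *)

Lemma measurable_in_set d (T : measurableType d) (N : set T) : measurable N ->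
  measurable_fun setT (fun x => x \in N).
Proof.
move=> mN; apply: (measurable_fun_bool true); rewrite setTI (_ : _ @^-1` _ = N)//.
by apply/seteqP; split => x /=; [exact: set_mem|exact: mem_set].
Qed.

Section IteratedIntegral.
Variable R : realType.

(** The integral of a nonnegative function is a supremum over the simple functions below it, hence
    monotone for arbitrary integrands; this makes [iint] usable on functions that are not Borel. *)
Lemma ge0_integral_mono d (T : measurableType d) (mu : {measure set T -> \bar R})
    (f g : T -> \bar R) : (forall x, 0 <= f x)%E -> (forall x, f x <= g x)%E ->
  (\int[mu]_x f x <= \int[mu]_x g x)%E.
Proof.
move=> f0 fg; have g0 x : (0 <= g x)%E by exact: le_trans (fg x).
rewrite !ge0_integralTE//; apply: ereal_sup_le => _ [h hf <-].
by exists h => // x; exact: le_trans (fg x).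
Qed.

Lemma iint_ge0 m (f : 'rV[R]_m -> \bar R) : (forall x, 0 <= f x)%E -> (0 <= iint f)%E.
Proof.
elim: m f => [|m IH] f f0 //=; apply: integral_ge0 => t _.
by apply: IH => x.
Qed.

Lemma iint_le m (f g : 'rV[R]_m -> \bar R) : (forall x, 0 <= f x)%E ->
  (forall x, f x <= g x)%E -> (iint f <= iint g)%E.
Proof.
elim: m f g => [|m IH] f g f0 fg //=; apply: ge0_integral_mono => t.
  by apply: iint_ge0 => x.
by apply: IH => x.
Qed.

(** Let [N] be a Borel null set outside which [f = f']. Then [f] lies between the Borel functions
    that equal [f'] off [N] and are 0, respectively [+oo], on [N]; both have the integral of
    [f']. *)
Lemma iint_ae m (f f' : 'rV[R]_m -> \bar R) : measurable_fun setT f' ->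
  (forall x, 0 <= f x)%E -> (forall x, 0 <= f' x)%E ->
  ae (fun x => f x = f' x) -> iint f = (\int[leb R m]_x f' x)%E.
Proof.
move=> mf' f0 f'0 /ae_leb[N [mN N0 sN]].
pose h c x := if x \in N then c else f' x.
have mh c : measurable_fun setT (h c).
  by apply: measurable_fun_ifT => //; exact: measurable_in_set.
have h0 c x : (0 <= c)%E -> (0 <= h c x)%E by move=> c0; rewrite /h; case: ifP.
have hE c : (0 <= c)%E -> (\int[leb R m]_x h c x = \int[leb R m]_x f' x)%E.
  move=> c0; apply: ge0_ae_eq_integral => //; first by move=> x _; exact: h0.
  exists N; split => // x /= hx; apply: contrapT => nN; apply: hx => _.
  by rewrite /h memNset.
have fE x : ~ N x -> f x = f' x.
  by move=> nN; apply: contrapT => hx; apply: nN; exact: sN.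
apply/eqP; rewrite eq_le; apply/andP; split.
  rewrite -(hE +oo%E)// -iint_leb//; last by move=> x; exact: h0.
  apply: iint_le => // x; rewrite /h; case: ifPn => [_|]; first exact: leey.
  by rewrite notin_setE => /fE ->.
rewrite -(hE 0%E)// -iint_leb//; last by move=> x; exact: h0.
apply: iint_le => x; first exact: h0.
rewrite /h; case: ifPn => //.
by rewrite notin_setE => /fE ->.
Qed.

(** A Borel hull is taken for each rational sublevel set. Off a Borel null set [N] that contains all
    the exceptional sets, the sublevel sets of [u] are unions of these hulls; on [N] the
    representative is 0. *)
Lemma lmeasurable_fun_borel m (u : 'rV[R]_m -> R) : lmeasurable_fun u ->
  exists u' : 'rV[R]_m -> R, measurable_fun setT u' /\ ae (fun x => u x = u' x).
Proof.
move=> lu.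
have /choice[B hB] : forall r : rat, exists B, [/\ measurable B,
    [set x | u x < ratr r] `<=` B & (leb R m).-negligible (B `\` [set x | u x < ratr r])].
  by move=> r; exact: lmeasurable_borel.
have [N [mN N0 sN]] : (leb R m).-negligible
    (\bigcup_(r : rat) (B r `\` [set x | u x < ratr r])).
  pose F (k : nat) := if unpickle k is Some r then B r `\` [set x | u x < ratr r] else set0.
  have cov : \bigcup_(r : rat) (B r `\` [set x | u x < ratr r]) `<=` \bigcup_k F k.
    by move=> x [r _ hx]; exists (pickle r); [exact: I|rewrite /F pickleK; exact: hx].
  apply: negligibleS cov _; apply: negligible_bigcup => k; rewrite /F.
  case: (unpickle k) => [r|]; last exact: negligible_set0.
  by have [] := hB r.
have uB x : ~ N x -> forall r : rat, B r x -> u x < ratr r.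
  move=> nN r Br; apply: contrapT => h; apply: nN; apply: sN.
  by exists r.
exists (fun x => if x \in N then 0 else u x); split; last first.
  apply/ae_leb; exists N; split => // x /= hx; apply: contrapT => nN; apply: hx.
  by rewrite memNset.
apply: (measurability _ (RGenInftyO.measurableE R)).
move=> _ [_ [t ->] <-]; rewrite setTI.
have -> : (fun x => if x \in N then 0 else u x) @^-1` `]-oo, t[%classic =
    (N `&` [set x | 0 < t]) `|` (~` N `&` \bigcup_(r in [set r : rat | ratr r <= t]) B r).
  apply/seteqP; split => x; rewrite /= in_itv/=.
    case: ifPn => [/set_mem Nx t0|]; first by left.
    rewrite notin_setE => nN ut; right; split => //.
    have [r] := rat_in_itvoo ut; rewrite in_itv/= => /andP[ur rt].
    by exists r; [exact: ltW|have [_ h _] := hB r; exact: h].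
  case=> [[Nx t0]|[nN [r /= rt Br]]]; first by rewrite mem_set.
  by rewrite memNset// (lt_le_trans (uB _ nN _ Br)).
apply: measurableU.
  have [t0|t0] := pselect (0 < t).
    by rewrite (_ : [set _ | 0 < t] = setT) ?setIT//; apply/seteqP; split.
  by rewrite (_ : [set _ | 0 < t] = set0) ?setI0//; apply/seteqP; split.
apply: measurableI; first exact: measurableC.
rewrite bigcup_mkcond; apply: bigcupT_measurable_rat => r.
by case: ifP => // _; have [] := hB r.
Qed.

Lemma row_mx_0l (T : 'rV[R]_0) n (y : 'rV[R]_n) : row_mx T y = y :> 'rV_(0 + n).
Proof.
apply/rowP => i; rewrite mxE; case: splitP => [[]//|j ij].
by congr (y _ _); exact/val_inj.
Qed.

Lemma row_mx_consr m n (t : 'rV[R]_1) (x : 'rV[R]_m) (y : 'rV[R]_n) :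
  row_mx (row_mx t x : 'rV[R]_m.+1) y = row_mx t (row_mx x y) :> 'rV[R]_(m + n).+1.
Proof.
apply/rowP => i; rewrite [LHS]mxE [RHS]mxE.
case: (@splitP m.+1 n i) => j ij; case: (@splitP 1 (m + n) i) => k ik;
  have e := etrans (esym ij) ik; clear ij ik; rewrite ?mxE ?mxE.
- case: (@splitP 1 m j) => l jl; first by rewrite (ord1 k) (ord1 l).
  have := etrans (esym jl) e; have := ltn_ord k; clear; lia.
- case: (@splitP 1 m j) => l jl.
    have := etrans (esym jl) e; have := ltn_ord l; clear; lia.
  have {}e := etrans (esym jl) e; case: (splitP k) => r kr.
    congr (x _ _); apply/val_inj => /=; move: e kr; clear; lia.
  have := ltn_ord l; move: e kr; clear; lia.
- have := ltn_ord k; move: e; clear; lia.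
- case: (splitP k) => r kr.
    have := ltn_ord r; move: e kr; clear; lia.
  congr (y _ _); apply/val_inj => /=; move: e kr; clear; lia.
Qed.

(** Holds for arbitrary [f], because both sides unfold to the same nest of one-dimensional integrals
    once the blocks are reassociated. *)
Lemma iint_row_mx m n (f : 'rV[R]_(m + n) -> \bar R) :
  iint f = iint (fun x : 'rV[R]_m => iint (fun y : 'rV[R]_n => f (row_mx x y))).
Proof.
elim: m f => [|m IH] f /=.
  by congr iint; apply/funext => y; rewrite row_mx_0l.
apply: eq_integral => t _; rewrite IH; congr iint; apply/funext => x.
by congr iint; apply/funext => y; rewrite row_mx_consr.
Qed.

Lemma measurable_lsubmx m n : measurable_fun setT (@lsubmx R 1 m n).
Proof.
apply: measurable_fun_rV => i; under eq_fun do rewrite mxE.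
exact: measurable_coord.
Qed.

Lemma measurable_rsubmx m n : measurable_fun setT (@rsubmx R 1 m n).
Proof.
apply: measurable_fun_rV => i; under eq_fun do rewrite mxE.
exact: measurable_coord.
Qed.

Lemma measurable_row_mx m n :
  measurable_fun setT (fun z : 'rV[R]_m * 'rV[R]_n => row_mx z.1 z.2).
Proof.
apply: measurable_fun_rV => i; under eq_fun do rewrite mxE.
case: splitP => j _.
  apply: (@measurableT_comp _ _ _ _ _ _ (fun x : 'rV[R]_m => x 0 j) _ fst).
    exact: measurable_coord.
  exact: measurable_fst.
apply: (@measurableT_comp _ _ _ _ _ _ (fun x : 'rV[R]_n => x 0 j) _ snd).
  exact: measurable_coord.
exact: measurable_snd.
Qed.

Section tonelli.
Variables (m n : nat) (f : 'rV[R]_(m + n) -> \bar R).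
Hypotheses (mf : measurable_fun setT f) (f0 : forall z, (0 <= f z)%E).

Let mfp : measurable_fun setT (fun z : 'rV[R]_m * 'rV[R]_n => f (row_mx z.1 z.2)).
Proof. exact: measurableT_comp mf (@measurable_row_mx m n). Qed.

Lemma measurable_tonelli :
  measurable_fun setT (fun x => \int[leb R n]_y f (row_mx x y))%E.
Proof.
have h := @measurable_fun_fubini_tonelli_F _ _ _ _ R (leb R n) _ mfp.
by apply: h => -[x y].
Qed.

Lemma leb_tonelli : (\int[leb R (m + n)]_z f z =
  \int[leb R m]_x \int[leb R n]_y f (row_mx x y))%E.
Proof.
rewrite -iint_leb// iint_row_mx -iint_leb; last 2 first.
- exact: measurable_tonelli.
- by move=> x; exact: integral_ge0.
congr iint; apply/funext => x; rewrite iint_leb//.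
exact: measurableT_comp mfp (measurable_pair1 x).
Qed.

Lemma leb_tonelli_swap : (\int[leb R (m + n)]_z f z =
  \int[leb R n]_y \int[leb R m]_x f (row_mx x y))%E.
Proof.
rewrite leb_tonelli; have := @fubini_tonelli _ _ _ _ R (leb R m) (leb R n) _ mfp.
by apply => -[x y].
Qed.

End tonelli.

Lemma ae_lsubmx m n (P : 'rV[R]_m -> Prop) : {ae leb R m, forall x, P x} ->
  {ae leb R (m + n), forall z, P (lsubmx z)}.
Proof.
move=> [N [mN N0 sN]]; exists (@lsubmx R 1 m n @^-1` N).
have mlN : measurable (@lsubmx R 1 m n @^-1` N).
  by rewrite -[X in measurable X]setTI; exact: measurable_lsubmx.
split => //; last by move=> z /= hz; exact: sN.
rewrite -(setIT (_ @^-1` _)) -integral_indic// leb_tonelli_swap; first last.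
- by move=> z; rewrite lee_fin.
- by apply/measurable_EFinP; exact: measurable_indic.
apply: integral0_eq => y _; rewrite -[RHS]N0 -[in RHS](setIT N) -integral_indic//.
by apply: eq_integral => x _; congr (_ %:E); rewrite -[in RHS](@row_mxKl _ _ m n x y).
Qed.

Lemma ae_rsubmx m n (P : 'rV[R]_n -> Prop) : {ae leb R n, forall x, P x} ->
  {ae leb R (m + n), forall z, P (rsubmx z)}.
Proof.
move=> [N [mN N0 sN]]; exists (@rsubmx R 1 m n @^-1` N).
have mlN : measurable (@rsubmx R 1 m n @^-1` N).
  by rewrite -[X in measurable X]setTI; exact: measurable_rsubmx.
split => //; last by move=> z /= hz; exact: sN.
rewrite -(setIT (_ @^-1` _)) -integral_indic// leb_tonelli; first last.
- by move=> z; rewrite lee_fin.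
- by apply/measurable_EFinP; exact: measurable_indic.
apply: integral0_eq => x _; rewrite -[RHS]N0 -[in RHS](setIT N) -integral_indic//.
by apply: eq_integral => y _; congr (_ %:E); rewrite -[in RHS](@row_mxKr _ _ m n x y).
Qed.

End IteratedIntegral.

(** * Euclidean norm and kernel integrals *)

Section EuclideanNorm.
Variables (R : realType) (n : nat).
Local Notation T := 'rV[R]_n.

Lemma enorm_ge0 (x : T) : 0 <= enorm x.
Proof. exact: sqrtr_ge0. Qed.

Lemma coord_le_enorm (x : T) i : `|x 0 i| <= enorm x.
Proof.
rewrite -sqrtr_sqr ler_sqrt; last by apply: sumr_ge0 => j _; exact: sqr_ge0.
by rewrite (bigD1 i)//= lerDl; apply: sumr_ge0 => j _; exact: sqr_ge0.
Qed.

Lemma coord_le_norm (x : T) i : `|x 0 i| <= `|x|.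
Proof.
rewrite [leRHS](mx_normrE x); apply/bigmax_geP; right => /=.
by exists (0, i).
Qed.

Lemma norm_le_coord (x : T) (M : R) : 0 <= M -> (forall i, `|x 0 i| <= M) -> `|x| <= M.
Proof.
move=> M0 h; rewrite [leLHS](mx_normrE x); apply/bigmax_leP; split => //.
by move=> [i j] _ /=; rewrite ord1.
Qed.

Lemma norm_le_enorm (x : T) : `|x| <= enorm x.
Proof. by apply: norm_le_coord; [exact: enorm_ge0|exact: coord_le_enorm]. Qed.

Lemma enorm_le_norm (x : T) : enorm x <= n%:R * `|x|.
Proof.
rewrite -(@ger0_norm _ (n%:R * `|x|)) ?mulr_ge0// -sqrtr_sqr ler_sqrt ?sqr_ge0//.
apply: (@le_trans _ _ (\sum_(i < n) `|x| ^+ 2)).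
  apply: ler_sum => i _; rewrite -real_normK ?num_real// lerXn2r ?nnegrE//.
  exact: coord_le_norm.
rewrite sumr_const card_ord exprMn -[leLHS]mulr_natl ler_wpM2r ?sqr_ge0//.
by rewrite -natrX ler_nat; case: n => // k; rewrite leq_pmulr.
Qed.

Lemma enormN (x : T) : enorm (- x) = enorm x.
Proof. by rewrite /enorm; under eq_bigr do rewrite mxE sqrrN. Qed.

Lemma enormB (x y : T) : enorm (x - y) = enorm (y - x).
Proof. by rewrite -enormN opprB. Qed.

Lemma enorm_gt0 (x : T) : x != 0 -> 0 < enorm x.
Proof. by move=> x0; rewrite (lt_le_trans _ (norm_le_enorm _))// normr_gt0. Qed.

Lemma enorm0 : enorm (0 : T) = 0.
Proof.
rewrite /enorm big1 ?sqrtr0// => i _.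
by rewrite mxE expr0n.
Qed.

Lemma measurable_enorm : measurable_fun setT (@enorm R n).
Proof.
apply: (@measurableT_comp _ _ _ _ _ _ (@Num.sqrt R) _ (fun x : T => \sum_i x 0 i ^+ 2)).
  by apply: continuous_measurable_fun; exact: sqrt_continuous.
by apply: measurable_sum => i; apply: measurable_funX; exact: measurable_coord.
Qed.

Lemma cubeP (c x : T) (r : R) : 0 < r -> cube c r x <-> `|x - c| < r.
Proof. by move=> r0; rewrite -ball_cube// -ball_normE /= distrC. Qed.

End EuclideanNorm.

(** * Integrability of the tail weight and of the kernel near the diagonal *)

Section DyadicBounds.
Variables (R : realType) (n : nat).
Local Notation T := 'rV[R]_n.
Local Notation mu := (leb R n).

(** [f] is dominated by the sum over [j] of the height [a j] on [cube c (r j)], and these step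
    functions have integrals bounded by a geometric series. The radii may grow, as for the tail
    weight, or shrink, as near the diagonal. *)
Lemma dyadic_bound (c : T) (f : T -> R) (r a : nat -> R) (A th : R) :
  measurable_fun setT f -> (forall y, 0 <= f y) ->
  (forall j, 0 < r j) -> (forall j, 0 <= a j) ->
  (forall y, f y != 0 -> exists j, cube c (r j) y /\ f y <= a j) ->
  0 <= th < 1 -> (forall j, a j * (2 * r j) ^+ n <= A * th ^+ j) ->
  (\int[mu]_y (f y)%:E <= (A / (1 - th))%:E)%E.
Proof.
move=> mf f0 r0 a0 hf /andP[th0 th1] hA.
have A0 : 0 <= A.
  apply: le_trans (_ : a 0%N * (2 * r 0%N) ^+ n <= A).
    by rewrite mulr_ge0// exprn_ge0// mulr_ge0// ltW.
  by rewrite -[leRHS]mulr1 -[X in _ <= _ * X](expr0 th).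
have mg j : measurable_fun setT (fun y => (a j * \1_(cube c (r j)) y)%:E).
  apply/measurable_EFinP; apply: measurable_funM => //.
  by apply: measurable_indic; exact: measurable_cube.
have g0 j y : (0 <= (a j * \1_(cube c (r j)) y)%:E)%E.
  by rewrite lee_fin mulr_ge0// indicE.
apply: (@le_trans _ _ (\int[mu]_y \sum_(0 <= j <oo) (a j * \1_(cube c (r j)) y)%:E)%E).
  apply: ge0_le_integral => //.
  - by move=> y _; rewrite lee_fin.
  - exact/measurable_EFinP.
  - have := @ge0_emeasurable_sum _ _ R setT
      (fun j y => (a j * \1_(cube c (r j)) y)%:E) xpredT.
    by apply => [k y _ _|k _]; [exact: g0|exact: mg].
  - move=> y _; have [->|fy] := eqVneq (f y) 0; first exact: nneseries_ge0.
    have [j [cj fj]] := hf y fy.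
    rewrite (@nneseriesD1 _ _ j)//= indicE mem_set// mulr1.
    rewrite -[leLHS]adde0 leeD ?lee_fin//.
    exact: nneseries_ge0.
rewrite integral_nneseries//.
apply: lime_le; first by apply: is_cvg_nneseries => j _ _; apply: integral_ge0 => y _; exact: g0.
apply: nearW => N.
apply: (@le_trans _ _ (\sum_(0 <= j < N) (A * th ^+ j)%:E)%E).
  apply: lee_sum => j _.
  rewrite (eq_integral (fun y => ((a j)%:E * (\1_(cube c (r j)) y)%:E)%E)); last first.
    by move=> y _; rewrite EFinM.
  rewrite ge0_integralZl; [|by []| |by move=> y _; rewrite lee_fin indicE|
    by rewrite lee_fin]; last first.
    by apply/measurable_EFinP; apply: measurable_indic; exact: measurable_cube.
  rewrite integral_indic ?setIT//; last exact: measurable_cube.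
  apply: (@le_trans _ _ ((a j)%:E * ((2 * r j) ^+ n)%:E)%E).
    by rewrite le_eqVlt; apply/orP; left; apply/eqP; congr (_ * _)%E; exact: leb_cube (ltW (r0 j)).
  by rewrite -EFinM lee_fin.
rewrite sumEFin lee_fin.
have [th00|thn0] := eqVneq th 0; last first.
  apply: (@geometric_le_lim R N A th) => //; first by rewrite lt_def thn0.
  by rewrite ger0_norm.
rewrite th00 subr0 divr1; case: N => [|N]; first by rewrite big_nil.
rewrite big_nat_recl// expr0 mulr1 big1 ?addr0// => i _.
by rewrite expr0n mulr0.
Qed.

Lemma powR_exprn (h a : R) j : 0 <= h -> (h ^+ j) `^ a = (h `^ a) ^+ j.
Proof.
by move=> h0; rewrite -powR_mulrn// powRAC powR_mulrn ?powR_ge0.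
Qed.

Lemma powRN_le (a b e : R) : 0 < a -> a <= b -> 0 <= e -> b `^ (- e) <= a `^ (- e).
Proof.
move=> a0 ab e0; have b0 := lt_le_trans a0 ab.
rewrite !powRN lef_pV2 ?posrE ?powR_gt0//.
by rewrite ge0_ler_powR ?nnegrE ?(ltW a0) ?(ltW b0).
Qed.

Lemma powR_lt1 (h a : R) : 0 < h -> h < 1 -> 0 < a -> h `^ a < 1.
Proof.
move=> h0 h1 a0; have := @gt0_ltr_powR R a a0 h 1.
by rewrite powR1 !nnegrE => /(_ (ltW h0) ler01 h1).
Qed.

Lemma tail_weight_integrable (s : R) : 0 < s ->
  (\int[mu]_y ((1 + enorm y) `^ (- (n%:R + s)))%:E < +oo)%E.
Proof.
move=> s0; set e := n%:R + s; pose r j : R := 2 ^+ j.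
have e0 : 0 <= e by rewrite addr_ge0// ltW.
(* For the least [j] with [|y| < 2 ^ j] one has [2 ^ j <= 2 * (1 + enorm y)], hence the factor
   [2 ^ e]. Against the volume of the cube, the exponent [- (n + s)] leaves the ratio
   [2 ^ (- s)]. *)
pose a j : R := 2 `^ e * (r j) `^ (- e).
have r0 j : 0 < r j by rewrite exprn_gt0.
have th0 : 0 <= (2^-1 : R) `^ s by exact: powR_ge0.
have th1 : (2^-1 : R) `^ s < 1 by apply: powR_lt1 => //; lra.
have a0 j : 0 <= a j by rewrite mulr_ge0// powR_ge0.
apply: (@le_lt_trans _ _ (2 `^ e * 2 ^+ n / (1 - 2^-1 `^ s))%:E); last exact: ltey.
apply: (@dyadic_bound 0 _ r a) => //.
- apply: (@measurableT_comp _ _ _ _ _ _ (fun x : R => x `^ (- e))).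
    exact: measurable_powR.
  by apply: measurable_funD => //; exact: measurable_enorm.
- by move=> y; exact: powR_ge0.
- move=> y _.
  have ex : exists j, `|y| < r j.
    exists (Num.truncn `|y|).+1; apply: lt_le_trans (truncnS_gt _) _.
    by rewrite /r -natrX ler_nat ltnW// ltn_expl.
  exists (ex_minn ex); case: ex_minnP => j hj jmin.
  have B0 : 0 < 1 + enorm y by rewrite ltr_wpDr ?enorm_ge0.
  split; first by apply/cubeP; rewrite ?subr0.
  have rB : r j <= 2 * (1 + enorm y).
    have ye := norm_le_enorm y; have y0 := normr_ge0 y.
    case: j hj jmin => [|j] hj jmin; first by rewrite /r expr0; lra.
    have : ~~ (`|y| < r j) by apply/negP => /jmin; rewrite ltnn.
    by rewrite -leNgt /r exprS; lra.
  have := powRN_le (r0 j) rB e0; rewrite powRM ?(ltW B0)// /a => h.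
  have := ler_wpM2l (powR_ge0 2 e) h; rewrite mulrA.
  have -> : (2 : R) `^ e * 2 `^ (- e) = 1 by rewrite powRN divff// gt_eqF// powR_gt0.
  by rewrite mul1r.
- by rewrite th0.
- move=> j; rewrite /a le_eqVlt; apply/orP; left; apply/eqP.
  have rn0 : r j != 0 by rewrite gt_eqF.
  rewrite /e opprD [r j `^ _]powRD; last by rewrite rn0 implybT.
  rewrite powR_invn ?(ltW (r0 j))// exprMn.
  have -> : r j `^ (- s) = (2^-1 `^ s) ^+ j.
    by rewrite -powR_exprn// exprVn -[(2 ^+ j)^-1]powR_inv1 ?(ltW (r0 j))// -powRrM mulN1r.
  by field; rewrite expf_neq0.
Qed.

Lemma near_kernel_integrable (al rho : R) : 0 < al -> 0 < rho -> exists C : R,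
  forall x : T, (\int[mu]_y
    (\1_(cube x rho) y * ((enorm (x - y)) `^ al * (enorm (x - y) ^+ n)^-1))%:E <= C%:E)%E.
Proof.
move=> al0 rho0; pose h : R := 2^-1.
have h0 : 0 < h by rewrite invr_gt0.
have h1 : h < 1 by rewrite /h; lra.
pose r j := rho * h ^+ j.
have r0 j : 0 < r j by rewrite mulr_gt0// exprn_gt0.
(* On the shell [r j.+1 <= |x - y| < r j] of the sup norm, [enorm (x - y)] lies between [r j.+1] and
   [n * r j], which bounds the two factors of the kernel separately. *)
pose a j := (n%:R * r j) `^ al * (r j.+1 ^+ n)^-1.
exists ((n%:R * rho) `^ al * 4 ^+ n / (1 - h `^ al)) => x.
apply: (@dyadic_bound x _ r a).
- apply: measurable_funM; first by apply: measurable_indic; exact: measurable_cube.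
  have me : measurable_fun setT (fun y : T => enorm (x - y)).
    apply: (@measurableT_comp _ _ _ _ _ _ (@enorm R n)); first exact: measurable_enorm.
    apply: measurable_fun_rV => i; under eq_fun do rewrite !mxE.
    by apply: measurable_funB => //; exact: measurable_coord.
  apply: measurable_funM.
    exact: (measurableT_comp (@measurable_powR R al) me).
  under eq_fun do rewrite -powR_inv1 ?exprn_ge0 ?enorm_ge0//.
  exact: (measurableT_comp (@measurable_powR R (- 1)) (measurable_funX n me)).
- by move=> y; rewrite !mulr_ge0 ?powR_ge0 ?invr_ge0 ?exprn_ge0 ?enorm_ge0// indicE.
- exact: r0.
- by move=> j; rewrite mulr_ge0 ?powR_ge0// invr_ge0 exprn_ge0// (ltW (r0 _)).
- move=> y; rewrite indicE; have [/set_mem cy|_] := boolP (y \in cube x rho); last by rewrite mul0r eqxx.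
  rewrite mul1r => fy.
  (* The diagonal lies outside the support, since [0 ^ al = 0] for [al > 0]. *)
  have xy : x != y.
    apply: contra fy => /eqP ->; rewrite subrr enorm0.
    by rewrite [0 `^ al]powR0 ?mul0r ?eqxx // gt_eqF.
  set d := `|x - y|; have d0 : 0 < d by rewrite normr_gt0 subr_eq0.
  have drho : d < rho by rewrite /d distrC; apply/cubeP.
  have ex : exists j, r j.+1 <= d.
    have [j] := ltr_add_invr (divr_gt0 d0 rho0); rewrite add0r ltr_pdivlMr// => hj.
    exists j; apply: le_trans (ltW hj); rewrite /r mulrC ler_wpM2r ?(ltW rho0)//.
    rewrite /h exprVn lef_pV2 ?posrE ?exprn_gt0 ?ltr0n//.
    by rewrite -natrX ler_nat ltnW// ltn_expl.
  exists (ex_minn ex); case: ex_minnP => j hj jmin.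
  have dj : d < r j.
    case: j hj jmin => [|j] hj jmin; first by rewrite /r expr0 mulr1.
    by rewrite ltNge; apply/negP => /jmin; rewrite ltnn.
  split; first by apply/cubeP; rewrite // distrC.
  apply: ler_pM; rewrite ?powR_ge0 ?invr_ge0 ?exprn_ge0 ?enorm_ge0//.
    have e1 : enorm (x - y) <= n%:R * r j.
      by apply: (le_trans (enorm_le_norm _)); rewrite ler_wpM2l// (ltW dj).
    have e2 : 0 <= n%:R * r j by rewrite mulr_ge0// (ltW (r0 j)).
    by rewrite ge0_ler_powR ?(ltW al0)// nnegrE ?enorm_ge0.
  rewrite lef_pV2 ?posrE ?exprn_gt0//; last by rewrite enorm_gt0 ?subr_eq0.
  rewrite lerXn2r ?nnegrE ?enorm_ge0 ?(ltW (r0 _))//.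
  by apply: (le_trans hj); exact: norm_le_enorm.
- by rewrite powR_ge0 powR_lt1.
- move=> j; rewrite /a le_eqVlt; apply/orP; left; apply/eqP.
  have E1 : (n%:R * r j) `^ al = (n%:R * rho) `^ al * (h `^ al) ^+ j.
    by rewrite -powR_exprn ?(ltW h0)// -powRM ?exprn_ge0 ?(ltW h0) ?mulr_ge0 ?(ltW rho0)// mulrA.
  have E2 : 2 * r j = 4 * r j.+1 by rewrite /r exprS; set t := h ^+ j; rewrite /h; field.
  have : r j.+1 ^+ n != 0 by rewrite expf_neq0// gt_eqF.
  rewrite E1 E2 (exprMn _ 4); move: (r j.+1 ^+ n) (4 ^+ n) ((h `^ al) ^+ j) => D F H D0.
  by field.
Qed.

End DyadicBounds.

(** * Distance between [Om] and the complement of [Om'] *)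

Section Geometry.
Variables (R : realType) (n : nat) (Om Om' : set 'rV[R]_n).
Local Notation T := 'rV[R]_n.
Hypotheses (oOm' : open Om') (bOm : ebounded Om) (cOm : closure Om `<=` Om').

Lemma ebounded_norm (A : set T) : ebounded A ->
  exists2 M, 0 < M & forall x, A x -> `|x| <= M.
Proof.
move=> [M hM]; exists (`|M| + 1); first by rewrite ltr_wpDl.
move=> x Ax; apply: (le_trans (norm_le_enorm x)); apply: (le_trans (hM x Ax)).
by apply: (le_trans (ler_norm M)); rewrite lerDl.
Qed.

Lemma ebounded_measure_fin (A : set T) : measurable A -> ebounded A ->
  (leb R n A < +oo)%E.
Proof.
move=> mA /ebounded_norm[M M0 hM].
apply: (@le_lt_trans _ _ (leb R n (cube 0 (M + 1)))); last exact: leb_cube_fin.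
apply: le_measure; rewrite ?inE//; first exact: measurable_cube.
move=> x Ax; apply/cubeP; first by rewrite addr_gt0.
by rewrite subr0 (le_lt_trans (hM x Ax))// ltrDl.
Qed.

Lemma compact_closure_ebounded : compact (closure Om).
Proof.
apply: bounded_closed_compact; last exact: closed_closure.
have [M M0 hM] := ebounded_norm bOm.
exists M; split; first exact: num_real.
move=> M' MM' x cx; apply: ltW; apply: contrapT => /negP; rewrite -leNgt => h.
have e0 : 0 < (M' - M) by rewrite subr_gt0.
have [y [Oy hy]] := cx _ (nbhsx_ballx x (M' - M) e0).
move: hy; rewrite -ball_normE /= => hy.
have := ler_distD 0 x y; rewrite subr0 sub0r normrN => h2.
have h3 := hM y Oy; have := ler_normD (x - y) y; rewrite subrK.
by move: h hy h3; lra.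
Qed.

(** Each point of the compact closure of [Om] has a ball inside [Om'] that stays there after a small
    move of the centre; compactness makes the radius uniform. *)
Lemma separation : exists2 d : R, 0 < d & forall x y, Om x -> ~ Om' y -> d <= `|x - y|.
Proof.
have /compact_near_coveringP cov := compact_closure_ebounded.
have near_ball x : closure Om x ->
    \forall x' \near x & e \near 0^'+, ball x' e `<=` Om'.
  move=> cx; have /nbhs_ballP[r /= r0 rO] : nbhs x Om'.
    by apply: open_nbhs_nbhs; split => //; exact: cOm.
  have r20 : 0 < r / 2 by rewrite divr_gt0.
  exists (ball x (r / 2), [set e | 0 < e < r / 2]).
    split => /=; first exact: nbhsx_ballx.
    by near=> e; apply/andP; split; near: e; [exact: nbhs_right_gt|exact: nbhs_right_lt].
  move=> [y e] [/= xy /andP[e0 er]] z yz; apply: rO.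
  rewrite (splitr r); apply: ball_triangle xy _.
  by apply: le_ball yz; exact: ltW.
have h := cov R (0^'+) (fun e x => ball x e `<=` Om') (at_right_proper_filter 0) near_ball.
have [e [he e0]] := @filter_ex _ _ (at_right_proper_filter (0 : R)) _ (filterI h (nbhs_right_gt (0 : R))).
exists e => // x y Ox nOy; rewrite leNgt; apply/negP => xy; apply: nOy.
by apply: (he _ (subset_closure Ox)); rewrite -ball_normE.
Unshelve. all: by end_near. Qed.

Lemma tail_comparison : exists2 c : R, 0 < c &
  forall x y, Om x -> ~ Om' y -> c * (1 + enorm y) <= enorm (x - y).
Proof.
have [d d0 hd] := separation; have [M M0 hM] := ebounded_norm bOm.
(* [1 + enorm y] is at most [1 + n * M + n * |x - y|], and the constant part is absorbed through
   [1 <= |x - y| / d]. *)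
pose K := (1 + n%:R * M) / d + n%:R.
have K0 : 0 < K.
  by rewrite ltr_wpDr// divr_gt0// ltr_wpDr// mulr_ge0// ltW.
exists K^-1; first by rewrite invr_gt0.
move=> x y Ox nOy; rewrite ler_pdivrMl//.
have dxy := hd x y Ox nOy.
have h1 : `|y| <= M + `|x - y|.
  have := ler_distD x y 0; rewrite !subr0 distrC => h.
  by have := hM x Ox; lra.
have h2 := enorm_le_norm y; have h3 := norm_le_enorm (x - y).
apply: (@le_trans _ _ (K * `|x - y|)); last by rewrite ler_pM2l.
apply: (@le_trans _ _ (1 + n%:R * (M + `|x - y|))).
  by rewrite lerD2l (le_trans h2)// ler_wpM2l.
rewrite /K mulrDl mulrDr addrA lerD2r.
by rewrite mulrAC ler_pdivlMr// ler_wpM2l// addr_ge0// mulr_ge0// (ltW M0).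
Qed.

(** A point maximizing the first coordinate over the closure of [Om] is pushed outwards in that
    direction by [e / 2]. The cube of radius [e / 2] around it stays in [Om'], and its points have a
    first coordinate larger than any in [Om]. *)
Lemma cube_outside : (0 < n)%N -> Om !=set0 -> exists c r, 0 < r /\
  cube c r `<=` Om' `\` Om.
Proof.
move=> n0 Om0; pose i0 := Ordinal n0.
have c0 : closure Om !=set0 by case: Om0 => x Ox; exists x; exact: subset_closure.
have cf : {within closure Om, continuous (fun x : T => x 0 i0)}.
  by apply: continuous_subspaceT => x; exact: coord_continuous.
have [x0 /set_mem x0c hmax] := EVT_max_rV c0 compact_closure_ebounded cf.
have /nbhs_ballP[e /= e0 eO] : nbhs x0 Om'.
  by apply: open_nbhs_nbhs; split => //; exact: cOm.
pose c := x0 + (e / 2) *: delta_mx 0 i0.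
have e20 : 0 < e / 2 by rewrite divr_gt0.
exists c, (e / 2); split => // y hy; split.
  apply: eO; rewrite ball_cube// => i.
  have := hy i; rewrite /c !mxE; have [->|_] := eqVneq i i0 => /=.
    rewrite mulr1 => h; have := ler_normD (y 0 i0 - (x0 0 i0 + e / 2)) (e / 2).
    rewrite (gtr0_norm e20) [_ + e / 2 in X in X <= _](_ : _ = y 0 i0 - x0 0 i0); last by ring.
    by move: h; lra.
  by rewrite mulr0 addr0 => h; lra.
move=> Oy; have := hmax y; rewrite inE => /(_ (subset_closure Oy)).
have := hy i0; rewrite /c !mxE eqxx mulr1 ltr_norml => /andP[h1 h2].
by move: h1; lra.
Qed.

Lemma ebounded_dist (A B : set T) : ebounded A -> ebounded B ->
  exists2 M, 0 < M & forall x y, A x -> B y -> enorm (x - y) <= M.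
Proof.
move=> /ebounded_norm[M M0 hM] /ebounded_norm[N N0 hN].
exists (n%:R * (M + N) + 1); first by rewrite ltr_wpDl// mulr_ge0// addr_ge0 ?(ltW M0) ?(ltW N0).
move=> x y Ax By; apply: (le_trans (enorm_le_norm _)).
rewrite ler_wpDr// ler_wpM2l// (le_trans (ler_normB _ _))//.
by apply: lerD; [exact: hM|exact: hN].
Qed.

End Geometry.

(** * Modulars and the abstract setting *)

Section Pairs.
Variables (R : realType) (n : nat) (s : R).
Local Notation T := 'rV[R]_n.
Local Notation Z := 'rV[R]_(n + n).
Local Notation mu2 := (leb R (n + n)).

Definition Dz (u : T -> R) (z : Z) : R := Ds s u (lsubmx z) (rsubmx z).
Definition kz (z : Z) : R := kern (lsubmx z) (rsubmx z).
Definition swapz (z : Z) : Z := row_mx (rsubmx z) (lsubmx z).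
Definition pairs (Om Om' : set T) : set Z :=
  [set z | Om (lsubmx z) /\ Om' (rsubmx z)].

Lemma DzE u z : Dz u z = (u (lsubmx z) - u (rsubmx z)) / enorm (lsubmx z - rsubmx z) `^ s.
Proof. by []. Qed.

Lemma kz_ge0 z : 0 <= kz z.
Proof. by rewrite invr_ge0 exprn_ge0// enorm_ge0. Qed.

Lemma kz_swap z : kz (swapz z) = kz z.
Proof. by rewrite /kz /swapz row_mxKl row_mxKr /kern enormB. Qed.

Lemma Dz_swap u z : Dz u (swapz z) = - Dz u z.
Proof.
by rewrite /Dz /swapz row_mxKl row_mxKr /Ds enormB -mulNr opprB.
Qed.

Lemma DzD u v z : Dz (fun x => u x + v x) z = Dz u z + Dz v z.
Proof. by rewrite /Dz /Ds -mulrDl; congr (_ / _); ring. Qed.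

Lemma DzB u v z : Dz (fun x => u x - v x) z = Dz u z - Dz v z.
Proof. by rewrite /Dz /Ds -mulrBl; congr (_ / _); ring. Qed.

Lemma DzZ c u z : Dz (fun x => c * u x) z = c * Dz u z.
Proof. by rewrite /Dz /Ds mulrA mulrBr. Qed.

Lemma Dz_row u x y : Dz u (row_mx x y) = Ds s u x y.
Proof. by rewrite /Dz row_mxKl row_mxKr. Qed.

Lemma kz_row (x y : T) : kz (row_mx x y) = kern x y.
Proof. by rewrite /kz row_mxKl row_mxKr. Qed.

Lemma measurable_lsub (f : T -> R) : measurable_fun setT f ->
  measurable_fun setT (fun z : Z => f (lsubmx z)).
Proof. by move=> mf; exact: measurableT_comp mf (@measurable_lsubmx R n n). Qed.

Lemma measurable_rsub (f : T -> R) : measurable_fun setT f ->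
  measurable_fun setT (fun z : Z => f (rsubmx z)).
Proof. by move=> mf; exact: measurableT_comp mf (@measurable_rsubmx R n n). Qed.

Lemma measurable_enorm_diff :
  measurable_fun setT (fun z : Z => enorm (lsubmx z - rsubmx z)).
Proof.
apply: (measurableT_comp (@measurable_enorm R n)).
apply: measurable_fun_rV => i; under eq_fun do rewrite !mxE.
by apply: measurable_funB => //; exact: measurable_coord.
Qed.

Lemma measurable_kz : measurable_fun setT kz.
Proof.
rewrite /kz /kern; under eq_fun do rewrite -powR_inv1 ?exprn_ge0 ?enorm_ge0//.
exact: measurableT_comp (@measurable_powR R (- 1)) (measurable_funX n measurable_enorm_diff).
Qed.

Lemma measurable_Dz u : measurable_fun setT u -> measurable_fun setT (Dz u).
Proof.
move=> mu'; rewrite /Dz /Ds.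
apply: measurable_funM.
  by apply: measurable_funB; [exact: measurable_lsub|exact: measurable_rsub].
under eq_fun do rewrite -powRN.
exact: measurableT_comp (@measurable_powR R (- s)) measurable_enorm_diff.
Qed.

Lemma measurable_swapz : measurable_fun setT swapz.
Proof.
apply: measurable_fun_rV => i; under eq_fun do rewrite mxE.
by case: splitP => j _; under eq_fun do rewrite mxE; exact: measurable_coord.
Qed.

Lemma integral_swap (f : Z -> \bar R) : measurable_fun setT f ->
  (forall z, 0 <= f z)%E -> (\int[mu2]_z f (swapz z) = \int[mu2]_z f z)%E.
Proof.
move=> mf f0; rewrite leb_tonelli_swap//; last exact: measurableT_comp mf measurable_swapz.
rewrite [RHS]leb_tonelli//; apply: eq_integral => y _; apply: eq_integral => x _.
by rewrite /swapz row_mxKl row_mxKr.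
Qed.

Definition tailw (y : T) : R := (1 + enorm y) `^ (- (n%:R + s)).

Lemma measurable_tailw : measurable_fun setT tailw.
Proof.
apply: (measurableT_comp (@measurable_powR R _)).
by apply: measurable_funD => //; exact: measurable_enorm.
Qed.

End Pairs.

Section Modulars.
Variables (R : realType) (n : nat) (s : R) (G g : R -> R) (Om Om' : set 'rV[R]_n).
Local Notation T := 'rV[R]_n.

Definition modL (h : T -> R) : \bar R :=
  (\int[leb R n]_(x in Om) (even_ext G (h x))%:E)%E.
Definition modD (h : T -> R) : \bar R :=
  (\int[leb R (n + n)]_(z in pairs Om Om') (even_ext G (Dz s h z) * kz z)%:E)%E.
Definition modW (h : T -> R) : \bar R := (modL h + modD h)%E.
(** Absolute version of the pairing in [Eform], without the coefficient [k]. Its finiteness makes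
    the form, the energy differences and the first variation absolutely convergent. *)
Definition bint (u h : T -> R) : \bar R :=
  (\int[leb R (n + n)]_z (g `|Dz s u z| * `|Dz s h z| * kz z)%:E)%E.

Lemma modLE h : modL h = (\int[leb R n]_(x in Om) (even_ext G (h x))%:E)%E.
Proof. by []. Qed.

Lemma modDE h : modD h =
  (\int[leb R (n + n)]_(z in pairs Om Om') (even_ext G (Dz s h z) * kz z)%:E)%E.
Proof. by []. Qed.

End Modulars.

(* [th] is a Borel representative of the exterior datum. *)
Record energy_setting (R : realType) (n : nat) (s p q : R) (G g : R -> R)
    (Om Om' : set 'rV[R]_n) (th : 'rV[R]_n -> R) : Prop := EnergySetting {
  es_n : (0 < n)%N;
  es_s : 0 < s;
  es_Y : young_pair G g p q;
  es_Om : open Om;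
  es_Om' : open Om';
  es_bOm : ebounded Om;
  es_bOm' : ebounded Om';
  es_cOm : closure Om `<=` Om';
  es_th : measurable_fun setT th;
  es_tail : (\int[leb R n]_y
    (g (`|th y| / (1 + enorm y) `^ s) * tailw s y)%:E < +oo)%E;
  es_modth : (modW s G Om Om' th < +oo)%E }.

Lemma measurable_normf d (X : measurableType d) (R : realType) (f : X -> R) :
  measurable_fun setT f -> measurable_fun setT (fun x => `|f x|).
Proof. by move=> mf; exact: measurableT_comp (@normr_measurable R setT) mf. Qed.

(** * Auxiliary integration lemmas *)

Section IntegralEFin.
Context d (X : measurableType d) (R : realType) (m : {measure set X -> \bar R}).
Implicit Types (D : set X) (f h : X -> R).

Lemma integralZ_EFin D f (c : R) : measurable D -> measurable_fun setT f ->
  (forall x, 0 <= f x) -> 0 <= c ->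
  (\int[m]_(x in D) (c * f x)%:E = c%:E * \int[m]_(x in D) (f x)%:E)%E.
Proof.
move=> mD mf f0 c0; under eq_integral do rewrite EFinM.
rewrite ge0_integralZl//.
- by apply: measurable_funTS; exact/measurable_EFinP.
- by move=> x _; rewrite lee_fin.
Qed.

Lemma integralD_EFin D f h : measurable D -> measurable_fun setT f ->
  measurable_fun setT h -> (forall x, 0 <= f x) -> (forall x, 0 <= h x) ->
  (\int[m]_(x in D) (f x + h x)%:E =
   \int[m]_(x in D) (f x)%:E + \int[m]_(x in D) (h x)%:E)%E.
Proof.
move=> mD mf mh f0 h0; under eq_integral do rewrite EFinD.
rewrite ge0_integralD//.
- by move=> x _; rewrite lee_fin.
- by apply: measurable_funTS; exact/measurable_EFinP.
- by move=> x _; rewrite lee_fin.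
- by apply: measurable_funTS; exact/measurable_EFinP.
Qed.

Lemma le_integral_EFin D f h : measurable D -> measurable_fun setT f ->
  measurable_fun setT h -> (forall x, 0 <= f x) -> (forall x, D x -> f x <= h x) ->
  (\int[m]_(x in D) (f x)%:E <= \int[m]_(x in D) (h x)%:E)%E.
Proof.
move=> mD mf mh f0 fh; apply: ge0_le_integral => //.
- by move=> x _; rewrite lee_fin.
- by apply: measurable_funTS; exact/measurable_EFinP.
- by apply: measurable_funTS; exact/measurable_EFinP.
Qed.

Lemma integral_mul_indic D f : measurable D ->
  (\int[m]_(x in D) (f x)%:E = \int[m]_x (f x * \1_D x)%:E)%E.
Proof.
move=> mD; rewrite integral_mkcond; apply: eq_integral => x _.
by rewrite patchE indicE; case: ifPn => _; rewrite ?mulr1 ?mulr0.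
Qed.

End IntegralEFin.

Lemma measurable_le_set d (X : measurableType d) (R : realType) (f h : X -> R) :
  measurable_fun setT f -> measurable_fun setT h -> measurable [set x | f x <= h x].
Proof. by move=> mf mh; rewrite -[X in measurable X]setTI; exact: measurable_fun_le. Qed.

Lemma measurable_lt_set d (X : measurableType d) (R : realType) (f h : X -> R) :
  measurable_fun setT f -> measurable_fun setT h -> measurable [set x | f x < h x].
Proof.
move=> mf mh; rewrite (_ : mkset _ = ~` [set x | h x <= f x]).
  by apply: measurableC; exact: measurable_le_set.
by apply/seteqP; split => x /=; rewrite ltNge => /negP.
Qed.

Section GenericIntegrable.
Context d (X : measurableType d) (R : realType) (m : {measure set X -> \bar R}).
Implicit Types f F : X -> R.
Local Notation intg f := (m.-integrable setT (EFin \o f)).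

Lemma dominated_intg f F : measurable_fun setT f -> intg F ->
  (forall z, `|f z| <= F z) -> intg f.
Proof.
move=> mf iF fF; apply: le_integrable iF => //; first exact/measurable_EFinP.
by move=> z _ /=; rewrite lee_fin (le_trans (fF z))// ler_norm.
Qed.

Lemma intgD f1 f2 : intg f1 -> intg f2 -> intg (fun z => f1 z + f2 z).
Proof. by move=> i1 i2; exact (integrableD measurableT i1 i2). Qed.

Lemma intgB f1 f2 : intg f1 -> intg f2 -> intg (fun z => f1 z - f2 z).
Proof. by move=> i1 i2; exact (integrableB measurableT i1 i2). Qed.

Lemma intgZ (c : R) f1 : intg f1 -> intg (fun z => c * f1 z).
Proof. by move=> i1; exact (integrableZl measurableT c i1). Qed.

Lemma le_integral_comb (D : set X) (a b : R) f f1 f2 : measurable D ->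
  measurable_fun setT f -> measurable_fun setT f1 -> measurable_fun setT f2 ->
  (forall x, 0 <= f x) -> (forall x, 0 <= f1 x) -> (forall x, 0 <= f2 x) ->
  0 <= a -> 0 <= b -> (forall x, D x -> f x <= a * f1 x + b * f2 x) ->
  (\int[m]_(x in D) (f x)%:E <=
   a%:E * \int[m]_(x in D) (f1 x)%:E + b%:E * \int[m]_(x in D) (f2 x)%:E)%E.
Proof.
move=> mD mf m1 m2 f0 f10 f20 a0 b0 h.
have ma : measurable_fun setT (fun x => a * f1 x) by exact: measurable_funM.
have mb : measurable_fun setT (fun x => b * f2 x) by exact: measurable_funM.
rewrite -!integralZ_EFin// -integralD_EFin//; first last.
- by move=> x; rewrite mulr_ge0.
- by move=> x; rewrite mulr_ge0.
by apply: le_integral_EFin => //; exact: measurable_funD.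
Qed.

Lemma Rintegral_indic_fin (D : set X) f (b : R) : measurable D ->
  measurable_fun setT f -> (forall x, 0 <= f x) ->
  (\int[m]_(x in D) (f x)%:E = b%:E)%E ->
  intg (fun x => f x * \1_D x) /\ Rintegral m setT (fun x => f x * \1_D x) = b.
Proof.
move=> mD mf f0 fb; rewrite (integral_mul_indic _ f mD) in fb.
have fD0 x : 0 <= f x * \1_D x by rewrite mulr_ge0// indicE.
split; last by rewrite /Rintegral fb.
apply/integrableP; split.
  by apply/measurable_EFinP; apply: measurable_funM => //; exact: measurable_indic.
rewrite (eq_integral (fun x => (f x * \1_D x)%:E)); first by rewrite fb ltry.
by move=> x _ /=; rewrite ger0_norm.
Qed.

End GenericIntegrable.

Section GenericLimits.
Context d (X : measurableType d) (R : realType) (m : {measure set X -> \bar R}).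
Implicit Types (f : X -> R) (D : set X).

Lemma fatou_bound D (f_ : nat -> X -> R) f (C : \bar R) : measurable D ->
  (forall k, measurable_fun setT (f_ k)) -> (forall k x, 0 <= f_ k x) ->
  (forall x, D x -> f_ ^~ x @ \oo --> f x) ->
  (\forall k \near \oo, (\int[m]_(x in D) (f_ k x)%:E <= C)%E) ->
  (\int[m]_(x in D) (f x)%:E <= C)%E.
Proof.
move=> mD mf f0 ff hC; pose F k x := (f_ k x)%:E.
have : (\int[m]_(x in D) limn_einf (F^~ x) <= limn_einf (fun k => \int[m]_(x in D) F k x))%E.
  apply: fatou => //.
  - by move=> k; apply: measurable_funTS; exact/measurable_EFinP.
  - by move=> k x _; rewrite lee_fin.
rewrite [leLHS](eq_integral (fun x => (f x)%:E)); last first.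
  move=> x /set_mem Dx; have h : F^~ x @ \oo --> (f x)%:E.
    by apply: cvg_EFin; [exact: nearW|exact: ff].
  by have [] := cvg_limn_einf_sup h.
move=> /le_trans; apply; apply: le_trans (limn_einf_sup _) _.
rewrite limn_esup_lim; apply: lime_le; first exact: is_cvg_esups.
case: hC => N _ hN; exists N => // k /= Nk.
by apply: ge_ereal_sup => _ [l /= kl <-]; apply: hN => /=; exact: leq_trans kl.
Qed.

Lemma integral_ae_eq_EFin D f f' : measurable D -> measurable_fun setT f ->
  measurable_fun setT f' -> {ae m, forall x, f x = f' x} ->
  (\int[m]_(x in D) (f x)%:E = \int[m]_(x in D) (f' x)%:E)%E.
Proof.
move=> mD mf mf' h; apply: ae_eq_integral => //.
- by apply: measurable_funTS; exact/measurable_EFinP.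
- by apply: measurable_funTS; exact/measurable_EFinP.
- by apply: filterS h => x -> _.
Qed.

Lemma Rintegral_ae_eq f f' : measurable_fun setT f ->
  measurable_fun setT f' -> {ae m, forall x, f x = f' x} ->
  Rintegral m setT f = Rintegral m setT f'.
Proof. by move=> mf mf' h; rewrite /Rintegral (integral_ae_eq_EFin _ mf mf' h). Qed.

End GenericLimits.

Lemma cvg_of_geometric_steps (R : realType) (u : nat -> R) :
  (\forall k \near \oo, `|u k.+1 - u k| <= (2^-1) ^+ k) -> cvgn u.
Proof.
move=> [N _ hN]; pose v k := u (k + N)%N.
have h k : `|telescope v k| <= (2^-1 : R) ^+ k.
  rewrite /telescope /v /=; apply: le_trans (hN _ _) _ => /=; first exact: leq_addl.
  by apply: ler_wiXn2l; [rewrite invr_ge0|rewrite invf_le1// ler1n|exact: leq_addr].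
have c1 : cvgn (series (geometric (1 : R) 2^-1)).
  by apply: is_cvg_geometric_series; rewrite ger0_norm ?invr_ge0// invf_lt1// ltr1n.
have c2 : cvgn [normed series (telescope v)].
  apply: (series_le_cvg _ _ _ c1) => k /=; first exact: normr_ge0.
    by rewrite mul1r exprn_ge0// invr_ge0.
  by rewrite mul1r; exact: h.
have /cvg_ex[l hl] := normed_cvg c2; rewrite telescopeK in hl.
have hv : v @ \oo --> l + v 0%N.
  suff : (fun k => (v k - v 0%N) + v 0%N) @ \oo --> l + v 0%N.
    by under eq_fun do rewrite subrK.
  by apply: cvgD; [exact: hl|exact: cvg_cst].
apply/cvg_ex; exists (l + v 0%N); rewrite -(cvg_shiftn N); exact: hv.
Qed.

(** * Test functions *)

Section TestFunctions.
Variables (R : realType) (n : nat).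
Local Notation T := 'rV[R]_n.
Implicit Types (f h : T -> R) (x y : T) (Om : set T).

Lemma pder_lincomb (a b : R) f h (l : seq 'I_n) : smooth f -> smooth h ->
  pder l (fun x => a * f x + b * h x) = (fun x => a * pder l f x + b * pder l h x) /\
  forall i x, derivable (fun x => a * pder l f x + b * pder l h x) x (ei R i).
Proof.
move=> sf sh; have D l' i x : is_derive x (ei R i) (fun x => a * pder l' f x + b * pder l' h x)
    (a * 'D_(ei R i) (pder l' f) x + b * 'D_(ei R i) (pder l' h) x).
  have [_ df] := sf l'; have [_ dh] := sh l'.
  have i1 := is_deriveZ a (derivableP (df i x)).
  have i2 := is_deriveZ b (derivableP (dh i x)).
  exact: is_deriveD i1 i2.
split; last by move=> i x; have [] := D l i x.
elim: l => [//|i l IH] /=; rewrite IH; apply/funext => x.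
by have [_ ->] := D l i x.
Qed.

Lemma smooth_lincomb (a b : R) f h : smooth f -> smooth h ->
  smooth (fun x => a * f x + b * h x).
Proof.
move=> sf sh l; have [-> dl] := pder_lincomb a b l sf sh; split => //.
have [cf _] := sf l; have [ch _] := sh l.
by move=> x; exact: (cvgD (cvgM (cvg_cst a) (cf x)) (cvgM (cvg_cst b) (ch x))).
Qed.

Lemma Cc_inf_lincomb (a b : R) Om f h : Cc_inf Om f -> Cc_inf Om h ->
  Cc_inf Om (fun x => a * f x + b * h x).
Proof.
move=> [sf [K [cK KO K0]]] [sh [K' [cK' KO' K0']]]; split; first exact: smooth_lincomb.
exists (K `|` K'); split; [exact: compactU|by move=> x [/KO|/KO']|].
by move=> x nK; rewrite K0 ?K0' ?mulr0 ?addr0// => Kx; apply: nK; [right|left].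
Qed.

Lemma Cc_inf_continuous Om f : Cc_inf Om f -> continuous f.
Proof. by case=> sf _; have [] := sf [::]. Qed.

Lemma Cc_inf_measurable Om f : Cc_inf Om f -> measurable_fun setT f.
Proof. by move=> /Cc_inf_continuous; exact: continuous_measurable_rV. Qed.

Lemma Cc_inf_out Om f : Cc_inf Om f -> forall x, ~ Om x -> f x = 0.
Proof. by move=> [_ [K [_ KO K0]]] x nO; apply: K0 => /KO. Qed.

Lemma compact_supp_bounded (K : set T) f : compact K -> continuous f ->
  (forall x, ~ K x -> f x = 0) -> exists2 B : R, 0 <= B & forall x, `|f x| <= B.
Proof.
move=> cK cf f0; have [K0|/set0P Kn] := eqVneq K set0.
  by exists 0 => // x; rewrite f0 ?normr0// K0.
have cnf : {within K, continuous (fun x => `|f x|)}.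
  apply: continuous_subspaceT => x; apply: continuous_comp; [exact: cf|exact: norm_continuous].
have [c _ hc] := EVT_max_rV Kn cK cnf.
exists `|f c| => // x; have [Kx|nKx] := pselect (K x); first by apply: hc; rewrite inE.
by rewrite f0// normr0.
Qed.

Lemma pder_supp (K : set T) f (l : seq 'I_n) : compact K -> (forall x, ~ K x -> f x = 0) ->
  forall x, ~ K x -> pder l f x = 0.
Proof.
move=> cK f0; elim: l => [//|i l IH] x nKx /=.
have oK : open (~` K).
  by apply: closed_openC; apply: compact_closed cK; exact: norm_hausdorff.
have nx : \forall y \near x, pder l f y = 0.
  by apply: filterS IH _; apply: open_nbhs_nbhs.
by rewrite (near_eq_derive (g := cst 0)) ?derive_cst.
Qed.

(** The partial derivatives are continuous with compact support, hence bounded. As only derivatives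
    along the axes are given, the segment from [x] to [y] is replaced by a path that changes one
    coordinate at a time. *)
Lemma Cc_inf_lipschitz Om f : Cc_inf Om f ->
  exists2 L : R, 0 <= L & forall x y, `|f x - f y| <= L * enorm (x - y).
Proof.
move=> [sf [K [cK KO K0]]].
have /choice[B hB] : forall i : 'I_n, exists B : R, 0 <= B /\ forall x, `|pder [:: i] f x| <= B.
  move=> i; have [cf _] := sf [:: i].
  by have [B B0 hB] := compact_supp_bounded cK cf (pder_supp [:: i] cK K0); exists B.
have B0 i : 0 <= B i by case: (hB i).
have line i x (t : R) : `|f (t *: ei R i + x) - f x| <= B i * `|t|.
  have [_ df] := sf [::]; have [cf _] := sf [::].
  pose psi (r : R) := f (r *: ei R i + x).
  have dpsi (r : R) : is_derive r 1 psi (pder [:: i] f (r *: ei R i + x)).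
    have E : (fun h : R => h^-1 *: (psi (h *: 1 + r) - psi r)) =
        (fun h : R => h^-1 *: (f (h *: ei R i + (r *: ei R i + x)) - f (r *: ei R i + x))).
      apply/funext => h; rewrite /psi; congr (_ *: (f _ - _)).
      by rewrite addrA -scalerDl /GRing.scale /= mulr1.
    apply: DeriveDef; first by rewrite /derivable E; exact: df.
    by rewrite /derive E.
  have cpsi : continuous psi.
    by move=> r; apply/differentiable_continuous/derivable1_diffP; have [] := dpsi r.
  have main (a b : R) : a <= b -> `|psi b - psi a| <= B i * `|b - a|.
    move=> ab; have [c _ ->] := MVT_segment ab (fun r _ => dpsi r) (continuous_subspaceT cpsi).
    by rewrite normrM ler_wpM2r//; case: (hB i).
  have -> : f x = psi 0 by rewrite /psi scale0r add0r.
  rewrite -[X in `|X - _|]/(psi t); case: (leP 0 t) => [/main|/ltW/main]; rewrite ?subr0//.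
  by rewrite distrC sub0r normrN.
(* Corners of that path: the first [j] coordinates come from [y], the others from [x]. *)
pose z x y (j : nat) : T := \row_i (if (i < j)%N then y 0 i else x 0 i).
exists (\sum_i B i); first by apply: sumr_ge0.
move=> x y; have step j : (j <= n)%N -> `|f (z x y j) - f x| <= \sum_(i < n | (i < j)%N) B i * enorm (x - y).
  elim: j => [|j IH] jn.
    by rewrite big_pred0// (_ : z x y 0%N = x) ?subrr ?normr0//; apply/rowP => i; rewrite mxE.
  pose i0 := Ordinal jn.
  have -> : z x y j.+1 = (y 0 i0 - x 0 i0) *: ei R i0 + z x y j.
    apply/rowP => i; rewrite !mxE eqxx /= ltnS leq_eqVlt.
    have [ij|ij] := eqVneq i i0.
      by rewrite ij /= eqxx ltnn /= mulr1 subrK.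
    have -> : (i == j :> nat) = false by apply/negP => /eqP h; move: ij; rewrite -val_eqE /= h eqxx.
    by rewrite /= mulr0 add0r.
  rewrite (bigD1 i0)//= (le_trans (ler_distD (f (z x y j)) _ _))// lerD//.
    apply: (le_trans (line _ _ _)); rewrite ler_wpM2l//.
    have := coord_le_enorm (x - y) i0; rewrite !mxE distrC; exact.
  apply: (le_trans (IH (ltnW jn))); rewrite le_eqVlt; apply/orP; left; apply/eqP.
  apply: eq_bigl => i; have [->|ij] := eqVneq i i0; first by rewrite andbF /= ltnn.
  have ne : (i : nat) != j by rewrite -(inj_eq val_inj) /= in ij.
  by rewrite andbT; apply/idP/idP; move: ne; lia.
have := step n (leqnn n); rewrite (_ : z x y n = y); last first.
  by apply/rowP => i; rewrite mxE ltn_ord.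
rewrite distrC => /le_trans; apply; rewrite mulr_suml le_eqVlt; apply/orP; left; apply/eqP.
by apply: eq_bigl => i; rewrite ltn_ord.
Qed.

End TestFunctions.

(** * The energy *)

Section Energy.
Variables (R : realType) (n : nat) (s p q : R) (G g : R -> R).
Variables (Om Om' : set 'rV[R]_n) (th : 'rV[R]_n -> R).
Hypothesis E : energy_setting s p q G g Om Om' th.
Local Notation T := 'rV[R]_n.
Local Notation Z := 'rV[R]_(n + n).
Local Notation mu := (leb R n).
Local Notation mu2 := (leb R (n + n)).
Local Notation GG := (even_ext G).
Local Notation gg := (odd_ext g).
Local Notation Dz := (Dz s).
Local Notation pairs := (pairs Om Om').
Local Notation modL := (modL G Om).
Local Notation modD := (modD s G Om Om').
Local Notation modW := (modW s G Om Om').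
Local Notation bint := (bint s g).
Local Notation tailw := (tailw s).
Implicit Types (u h v w : T -> R) (z : Z) (x y : T).
Let Y := es_Y E.
Let s0 := es_s E.
Let oOm' := es_Om' E.
Let cOm := es_cOm E.
Let bOm := es_bOm E.
Let p0 : 0 < p. Proof. exact: lt_trans (yp_p1 Y). Qed.
Let q0 : 0 < q. Proof. exact: lt_le_trans (yp_pq Y). Qed.

(** * Bounds for [bint] over all pairs of points *)

Lemma measurable_g : measurable_fun setT (fun t : R => g `|t|).
Proof.
have -> : (fun t : R => g `|t|) = (fun t => `|gg t|).
  by apply/funext => t; rewrite (norm_odd_ext Y).
by apply: measurableT_comp => //; exact: (measurable_odd_ext Y).
Qed.

Lemma mOm : measurable Om. Proof. exact: open_measurable_rV (es_Om E). Qed.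
Lemma mOm' : measurable Om'. Proof. exact: open_measurable_rV oOm'. Qed.

Lemma measurable_pairs : measurable pairs.
Proof.
have -> : pairs = (setT `&` @lsubmx R 1 n n @^-1` Om) `&` (setT `&` @rsubmx R 1 n n @^-1` Om').
  by rewrite !setTI.
apply: measurableI.
  by apply: measurable_lsubmx => //; exact: mOm.
by apply: measurable_rsubmx => //; exact: mOm'.
Qed.

Lemma g_ge0 (t : R) : 0 <= g `|t|.
Proof. exact: (young_g_ge0 Y). Qed.

(** The comparison [enorm (x - y) >= c * (1 + enorm y)] bounds the quotient of [u] by [|u x|] plus
    the weighted datum [|th y| / (1 + enorm y) ^ s], and turns the kernel times the quotient of [h]
    into [|h x| * tailw y]. The bound is a sum of products in separate variables. *)
Lemma tail_pointwise : exists2 C : R, 0 < C & forall (u h : T -> R) (x y : T),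
  (forall y, ~ Om y -> u y = th y) -> (forall y, ~ Om y -> h y = 0) ->
  Om x -> ~ Om' y ->
  g `|Ds s u x y| * `|Ds s h x y| * kern x y <=
  C * (`|h x| * (g `|u x| * tailw y + g (`|th y| / (1 + enorm y) `^ s) * tailw y)).
Proof.
have [c c0 hc] := tail_comparison oOm' bOm cOm.
pose L : R := 1 + c `^ (- s).
have L1 : 1 <= L by rewrite lerDl powR_ge0.
pose C1 := q / p * L `^ q * (q / p * 2 `^ q).
have C10 : 0 < C1.
  by rewrite !mulr_gt0 ?invr_gt0 ?powR_gt0// (lt_le_trans ltr01).
have C20 : 0 < c `^ (- (n%:R + s)) by rewrite powR_gt0.
exists (C1 * c `^ (- (n%:R + s))); first exact: mulr_gt0.
move=> u h x y uth h0 Ox nOy.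
have nOy2 : ~ Om y by move=> Oy; apply/nOy/cOm/subset_closure.
have cw := hc x y Ox nOy.
set w := 1 + enorm y; rewrite -/w in cw.
have w1 : 1 <= w by rewrite lerDl enorm_ge0.
have w0 : 0 < w := lt_le_trans ltr01 w1.
have cw0 : 0 < c * w by exact: mulr_gt0.
set r := enorm (x - y); rewrite -/r in cw.
have r0 : 0 < r := lt_le_trans cw0 cw.
have ws1 : 1 <= w `^ s by rewrite -(powRr0 w) ler_powR// ltW.
have ws0 : 0 < w `^ s := lt_le_trans ltr01 ws1.
set b := `|th y| / w `^ s.
have b0 : 0 <= b by rewrite divr_ge0// ltW.
have rs : (r `^ s)^-1 <= c `^ (- s) * (w `^ s)^-1.
  rewrite -!powRN -powRM ?(ltW c0) ?(ltW w0)//.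
  by apply: powRN_le => //; exact: ltW.
have Du : `|Ds s u x y| <= L * (`|u x| + b).
  rewrite /Ds -/r (uth y nOy2) normrM (@ger0_norm _ (_^-1)) ?invr_ge0 ?powR_ge0//.
  apply: (@le_trans _ _ ((`|u x| + `|th y|) * (c `^ (- s) * (w `^ s)^-1))).
    by apply: ler_pM; rewrite ?invr_ge0 ?powR_ge0// ler_normB.
  rewrite mulrCA; apply: ler_pM; rewrite ?powR_ge0//.
    by rewrite mulr_ge0 ?invr_ge0 ?addr_ge0// ltW.
    by rewrite /L lerDr.
  by rewrite mulrDl lerD2r ler_pdivrMr// ler_peMr.
have gDu : g `|Ds s u x y| <= C1 * (g `|u x| + g b).
  apply: (le_trans (young_g_le Y (normr_ge0 _) Du)).
  apply: (le_trans (young_g_scale Y L1 (addr_ge0 (normr_ge0 _) b0))).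
  rewrite /C1 -[leRHS]mulrA ler_wpM2l//; last exact: (young_g_add Y).
  by rewrite mulr_ge0 ?powR_ge0// divr_ge0// ltW.
have Dh : `|Ds s h x y| * kern x y <= `|h x| * (c `^ (- (n%:R + s)) * tailw y).
  rewrite /Ds -/r (h0 y nOy2) subr0 normrM (@ger0_norm _ (_^-1)) ?invr_ge0 ?powR_ge0//.
  rewrite -mulrA ler_wpM2l//.
  rewrite /tailw -/w -powRM ?(ltW c0) ?(ltW w0)//.
  have -> : (r `^ s)^-1 * kern x y = r `^ (- (n%:R + s)).
    rewrite /kern -/r -powR_mulrn ?(ltW r0)// -!powRN -powRD; last by rewrite (gt_eqF r0) implybT.
    by congr (_ `^ _); ring.
  by apply: powRN_le => //; rewrite addr_ge0// ltW.
rewrite -mulrA; apply: (@le_trans _ _ (C1 * (g `|u x| + g b) * (`|h x| * (c `^ (- (n%:R + s)) * tailw y)))).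
  apply: ler_pM => //; first exact: g_ge0.
  by rewrite mulr_ge0// invr_ge0 exprn_ge0// enorm_ge0.
rewrite le_eqVlt; apply/orP; left; apply/eqP; ring.
Qed.


Lemma measurable_bint_density u h : measurable_fun setT u -> measurable_fun setT h ->
  measurable_fun setT (fun z => g `|Dz u z| * `|Dz h z| * kz z).
Proof.
move=> mu' mh; apply: measurable_funM; last exact: measurable_kz.
apply: measurable_funM; first exact: measurableT_comp measurable_g (measurable_Dz s mu').
exact: measurable_normf (measurable_Dz s mh).
Qed.

Lemma bint_density_ge0 u h z : 0 <= g `|Dz u z| * `|Dz h z| * kz z.
Proof. by rewrite !mulr_ge0 ?kz_ge0 ?g_ge0. Qed.

(** As [h] vanishes off [Om], the integrand vanishes unless one of the two points is in [Om];
    symmetry reduces to the first one at the price of a factor 2. Pairs in [Om] x [Om'] are kept,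
    and for the others [tail_pointwise] separates variables, leaving finite constants as integrals
    in [y]. *)
Lemma bint_bound : exists2 C : R, 0 < C & forall (u h : T -> R),
  measurable_fun setT u -> measurable_fun setT h ->
  (forall y, ~ Om y -> u y = th y) -> (forall y, ~ Om y -> h y = 0) ->
  (bint u h <= C%:E *
    (\int[mu2]_(z in pairs) (g `|Dz u z| * `|Dz h z| * kz z)%:E +
     \int[mu]_x (`|h x| * (g `|u x| + 1))%:E))%E.
Proof.
have [C C0 hC] := tail_pointwise.
have tw0 y : 0 <= tailw y by exact: powR_ge0.
pose tt y := g (`|th y| / (1 + enorm y) `^ s) * tailw y.
have tt0 y : 0 <= tt y.
  by rewrite mulr_ge0// (young_g_ge0 Y)// divr_ge0// powR_ge0.
have mtw : measurable_fun setT (tailw : T -> R) by exact: (@measurable_tailw R n s).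
have mtt : measurable_fun setT tt.
  apply: measurable_funM => //.
  have -> : (fun y => g (`|th y| / (1 + enorm y) `^ s)) =
      (fun t => g `|t|) \o (fun y => th y * (1 + enorm y) `^ (- s)).
    apply/funext => y /=; rewrite normrM powRN (@ger0_norm _ (_^-1))//.
    by rewrite invr_ge0 powR_ge0.
  apply: measurableT_comp measurable_g _; apply: measurable_funM; first exact: (es_th E).
  apply: (measurableT_comp (@measurable_powR R _)).
  by apply: measurable_funD => //; exact: measurable_enorm.
have itw := tail_weight_integrable n s0; have itt := es_tail E.
pose iw := fine (\int[mu]_y (tailw y)%:E)%E.
pose it := fine (\int[mu]_y (tt y)%:E)%E.
have iwE : (\int[mu]_y (tailw y)%:E = iw%:E)%E.
  rewrite fineK// ge0_fin_numE//; apply: integral_ge0 => y _.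
  by rewrite lee_fin.
have itE : (\int[mu]_y (tt y)%:E = it%:E)%E.
  rewrite fineK// ge0_fin_numE//; apply: integral_ge0 => y _.
  by rewrite lee_fin.
have iw0 : 0 <= iw by apply: fine_ge0; apply: integral_ge0 => y _; rewrite lee_fin.
have it0 : 0 <= it by apply: fine_ge0; apply: integral_ge0 => y _; rewrite lee_fin.
pose K := 1 + C * (iw + it).
have K0 : 0 < K by rewrite ltr_wpDr// mulr_ge0 ?addr_ge0// ltW.
exists (2 * K); first by rewrite mulr_gt0.
move=> u h mu' mh uth h0.
pose F z := g `|Dz u z| * `|Dz h z| * kz z.
have F0 z : 0 <= F z by exact: bint_density_ge0.
have mF : measurable_fun setT F by exact: measurable_bint_density.
pose F1 z := F z * \1_Om (lsubmx z).
have F10 z : 0 <= F1 z by rewrite mulr_ge0// indicE.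
have mF1 : measurable_fun setT F1.
  apply: measurable_funM => //; apply: measurable_lsub.
  by apply: measurable_indic; exact: mOm.
have mF1s : measurable_fun setT (fun z => F1 (swapz z)).
  exact: measurableT_comp mF1 (@measurable_swapz R n).
pose a x := `|h x| * (g `|u x| + 1).
have a0 x : 0 <= a x by rewrite mulr_ge0// addr_ge0// g_ge0.
have ma : measurable_fun setT a.
  apply: measurable_funM; first exact: measurable_normf.
  by apply: measurable_funD => //; exact: measurableT_comp measurable_g mu'.
have step1 : (bint u h <= 2%:E * \int[mu2]_z (F1 z)%:E)%E.
  apply: (@le_trans _ _ (\int[mu2]_z (F1 z + F1 (swapz z))%:E)%E).
    apply: le_integral_EFin => //; first exact: measurable_funD.
    move=> z _; rewrite /F1 !indicE.
    have [Ox|nOx] := boolP (lsubmx z \in Om); first by rewrite mulr1 lerDl mulr_ge0.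
    have [Oy|nOy] := boolP (lsubmx (swapz z) \in Om).
      rewrite mulr0 add0r mulr1 le_eqVlt; apply/orP; left; apply/eqP.
      by rewrite /F !Dz_swap !normrN kz_swap.
    rewrite !mulr0 addr0; move: nOx nOy; rewrite !notin_setE /swapz row_mxKl => nOx nOy.
    by rewrite [Dz h z]DzE !h0// subrr mul0r normr0 mulr0 mul0r.
  rewrite integralD_EFin// (integral_swap (f := fun z => (F1 z)%:E)); first last.
  - by move=> z; rewrite lee_fin.
  - exact/measurable_EFinP.
  by rewrite -mule2n mule_natl.
pose H (z : Z) := C * (`|h (lsubmx z)| * (g `|u (lsubmx z)| * tailw (rsubmx z) + tt (rsubmx z))).
have H0 z : 0 <= H z.
  by rewrite mulr_ge0 ?(ltW C0)// mulr_ge0// addr_ge0// mulr_ge0// g_ge0.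
have mH : measurable_fun setT H.
  apply: measurable_funM => //; apply: measurable_funM.
    by apply: measurable_normf; exact: measurable_lsub.
  apply: measurable_funD; last exact: measurable_rsub.
  apply: measurable_funM; last exact: measurable_rsub.
  exact: measurableT_comp measurable_g (measurable_lsub mu').
have mFP : measurable_fun setT (fun z => F z * \1_pairs z).
  by apply: measurable_funM => //; apply: measurable_indic; exact: measurable_pairs.
have FP0 z : 0 <= F z * \1_pairs z by rewrite mulr_ge0// indicE.
have step2 : (\int[mu2]_z (F1 z)%:E <=
    \int[mu2]_(z in pairs) (F z)%:E + \int[mu2]_z (H z)%:E)%E.
  rewrite (integral_mul_indic _ F measurable_pairs) -integralD_EFin//.
  apply: le_integral_EFin => //; first exact: measurable_funD.
  move=> z _; rewrite /F1 !indicE.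
  have [Ox|nOx] := boolP (lsubmx z \in Om); last by rewrite mulr0 addr_ge0// mulr_ge0.
  rewrite mulr1; have [Py|nPy] := boolP (z \in pairs); first by rewrite mulr1 lerDl.
  rewrite mulr0 add0r; apply: (hC u h (lsubmx z) (rsubmx z)) => //; first exact: set_mem.
  by move=> Oy; move: nPy; rewrite notin_setE; apply; split => //; exact: set_mem.
have step3 : (\int[mu2]_z (H z)%:E <= (C * (iw + it))%:E * \int[mu]_x (a x)%:E)%E.
  rewrite leb_tonelli; first last.
  - by move=> z; rewrite lee_fin.
  - exact/measurable_EFinP.
  rewrite -integralZ_EFin//; last by rewrite mulr_ge0 ?addr_ge0// ltW.
  have E1 x : (\int[mu]_y (H (row_mx x y))%:E =
      (C * `|h x| * (g `|u x| * iw + it))%:E)%E.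
    rewrite /H; under eq_integral do rewrite row_mxKl row_mxKr mulrA.
    have gu0 := g_ge0 (u x).
    have m1 : measurable_fun setT (fun y => g `|u x| * tailw y) by exact: measurable_funM.
    have n1 y : 0 <= g `|u x| * tailw y by exact: mulr_ge0.
    rewrite integralZ_EFin//; last by rewrite mulr_ge0// ltW.
    - by rewrite integralD_EFin// integralZ_EFin// iwE itE -EFinM.
    - exact: measurable_funD.
    - by move=> y; rewrite addr_ge0.
  rewrite [leLHS](eq_integral (fun x => (C * `|h x| * (g `|u x| * iw + it))%:E)); last first.
    by move=> x _; exact: E1.
  apply: le_integral_EFin => //.
  - apply: measurable_funM.
      by apply: measurable_funM => //; exact: measurable_normf.
    apply: measurable_funD => //; apply: measurable_funM => //.
    exact: measurableT_comp measurable_g mu'.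
  - exact: measurable_funM.
  - move=> x; rewrite mulr_ge0// ?addr_ge0 ?mulr_ge0 ?g_ge0//; exact: ltW.
  - move=> x _; rewrite /a -!mulrA ler_wpM2l ?(ltW C0)// mulrCA ler_wpM2l//.
    have gu := g_ge0 (u x); nra.
apply: (le_trans step1); rewrite EFinM -muleA lee_pmul2l//.
apply: (le_trans step2).
have iP0 : (0 <= \int[mu2]_(z in pairs) (F z)%:E)%E.
  by apply: integral_ge0 => z _; rewrite lee_fin.
have ia0 : (0 <= \int[mu]_x (a x)%:E)%E.
  by apply: integral_ge0 => z _; rewrite lee_fin.
rewrite ge0_muleDr//; apply: leeD.
  by rewrite -[leLHS]mul1e lee_wpmul2r// lee_fin /K lerDl mulr_ge0 ?addr_ge0// ltW.
apply: (le_trans step3); rewrite lee_wpmul2r// lee_fin /K.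
by rewrite lerDr.
Qed.


(** * Inequalities between modulars, and Young's inequality for [bint] *)

Let mOmE : measurable Om := mOm.
Let mP : measurable pairs := measurable_pairs.

Lemma measurable_GG u : measurable_fun setT u -> measurable_fun setT (fun x => GG (u x)).
Proof. by move=> mu'; exact: measurableT_comp (measurable_even_ext Y) mu'. Qed.

Lemma measurable_GD u : measurable_fun setT u ->
  measurable_fun setT (fun z => GG (Dz u z) * kz z).
Proof.
move=> mu'; apply: measurable_funM; last exact: measurable_kz.
exact: measurableT_comp (measurable_even_ext Y) (measurable_Dz s mu').
Qed.

Lemma GG_ge0 (t : R) : 0 <= GG t. Proof. exact: (even_ext_ge0 Y). Qed.

Lemma GD_ge0 u z : 0 <= GG (Dz u z) * kz z.
Proof. by rewrite mulr_ge0 ?kz_ge0 ?GG_ge0. Qed.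

Lemma modL_ge0 u : (0 <= modL u)%E.
Proof. by apply: integral_ge0 => x _; rewrite lee_fin GG_ge0. Qed.

Lemma modD_ge0 u : (0 <= modD u)%E.
Proof. by apply: integral_ge0 => x _; rewrite lee_fin GD_ge0. Qed.

Lemma modWE u : modW u = (modL u + modD u)%E. Proof. by []. Qed.

Lemma modW_ge0 u : (0 <= modW u)%E.
Proof. by rewrite modWE adde_ge0 ?modL_ge0 ?modD_ge0. Qed.

(* Every modular inequality below comes from one for [GG] because [Dz] is linear. *)
Lemma modW_le_comb u v w (a b : R) : measurable_fun setT u ->
  measurable_fun setT v -> measurable_fun setT w -> 0 <= a -> 0 <= b ->
  (forall x, GG (w x) <= a * GG (u x) + b * GG (v x)) ->
  (forall z, GG (Dz w z) <= a * GG (Dz u z) + b * GG (Dz v z)) ->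
  (modW w <= a%:E * modW u + b%:E * modW v)%E.
Proof.
move=> mu' mv mw a0 b0 hL hD.
have L : (modL w <= a%:E * modL u + b%:E * modL v)%E.
  apply: le_integral_comb; [exact: mOmE|exact: measurable_GG|exact: measurable_GG|
    exact: measurable_GG|by move=> x; exact: GG_ge0|by move=> x; exact: GG_ge0|
    by move=> x; exact: GG_ge0|exact: a0|exact: b0|by move=> x _; exact: hL].
have D : (modD w <= a%:E * modD u + b%:E * modD v)%E.
  apply: le_integral_comb; [exact: mP|exact: measurable_GD|exact: measurable_GD|
    exact: measurable_GD|exact: GD_ge0|exact: GD_ge0|exact: GD_ge0|exact: a0|exact: b0|].
  by move=> z _; rewrite !mulrA -mulrDl ler_wpM2r ?kz_ge0.
rewrite !modWE; move: (modL_ge0 u) (modD_ge0 u) (modL_ge0 v) (modD_ge0 v) L D.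
move: (modL u) (modD u) (modL v) (modD v) (modL w) (modD w) => lu du lv dv lw dw.
by move=> lu0 du0 lv0 dv0 L D; rewrite !ge0_muleDr// addeACA; exact: leeD.
Qed.

Lemma modW_add u v : measurable_fun setT u -> measurable_fun setT v ->
  (modW (fun x => (u x + v x)%R) <= (2 `^ q)%:E * (modW u + modW v))%E.
Proof.
move=> mu' mv; rewrite (ge0_muleDr _ (modW_ge0 u) (modW_ge0 v)); apply: modW_le_comb => //.
- exact: measurable_funD.
- by move=> x; rewrite -mulrDr; exact: (even_ext_add Y).
- by move=> z; rewrite -mulrDr DzD; exact: (even_ext_add Y).
Qed.

Lemma modW_sub u v : measurable_fun setT u -> measurable_fun setT v ->
  (modW (fun x => (u x - v x)%R) <= (2 `^ q)%:E * (modW u + modW v))%E.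
Proof.
move=> mu' mv; rewrite (ge0_muleDr _ (modW_ge0 u) (modW_ge0 v)); apply: modW_le_comb => //.
- exact: measurable_funB.
- by move=> x; rewrite -mulrDr; exact: (even_ext_sub Y).
- by move=> z; rewrite -mulrDr DzB; exact: (even_ext_sub Y).
Qed.

Lemma modW_convex (t : R) u v : 0 <= t <= 1 -> measurable_fun setT u ->
  measurable_fun setT v ->
  (modW (fun x => ((1 - t) * u x + t * v x)%R) <= (1 - t)%:E * modW u + t%:E * modW v)%E.
Proof.
move=> t01 mu' mv; case/andP: (t01) => t0 t1; apply: modW_le_comb => //.
- by apply: measurable_funD; exact: measurable_funM.
- by rewrite subr_ge0.
- by move=> x; exact: (even_ext_convex Y).
- by move=> z; rewrite DzD !DzZ; exact: (even_ext_convex Y).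
Qed.

Lemma adde_fin_split (a b : \bar R) : (0 <= a)%E -> (0 <= b)%E -> (a + b < +oo)%E ->
  exists x y : R, [/\ a = x%:E, b = y%:E, 0 <= x & 0 <= y].
Proof.
move=> a0 b0 ab; exists (fine a), (fine b); split; try exact: fine_ge0.
  by rewrite fineK// ge0_fin_numE//; apply: le_lt_trans ab; rewrite leeDl.
by rewrite fineK// ge0_fin_numE//; apply: le_lt_trans ab; rewrite leeDr.
Qed.

Definition admissible h := [/\ measurable_fun setT h,
  forall y, ~ Om y -> h y = 0 & (modW h < +oo)%E].

Let muOm_fin : (mu Om < +oo)%E := ebounded_measure_fin mOmE (es_bOm E).

(** [C0] is chosen before [e1] and [e2], so a small coefficient in the pointwise inequality stays
    small. The [+ 1] next to [modW u] comes from the summand [|h|] in [bint_bound]: it is estimated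
    by the same inequality at [b = 1], where [g 1 >= 1], and integrated over [Om], which has finite
    measure. *)
Lemma bint_young : exists2 C0 : R, 0 < C0 & forall e1 e2 : R, 0 <= e1 -> 0 <= e2 ->
  (forall a b, 0 <= a -> 0 <= b -> a * g b <= e1 * G a + e2 * G b) ->
  forall u h, measurable_fun setT u -> measurable_fun setT h ->
  (forall y, ~ Om y -> u y = th y) -> (forall y, ~ Om y -> h y = 0) ->
  (modW u < +oo)%E -> (modW h < +oo)%E ->
  (bint u h <= (C0 * e1)%:E * modW h + (C0 * e2)%:E * (modW u + 1))%E.
Proof.
have [C C0 hC] := bint_bound.
pose m0 := fine (mu Om).
have m00 : 0 <= m0 by exact: fine_ge0.
have muOm : mu Om = m0%:E by rewrite fineK// ge0_fin_numE.
exists (2 * C * (1 + m0)); first by rewrite !mulr_gt0// ltr_wpDr.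
move=> e1 e2 e10 e20 he u h mu' mh uth h0 uoo hoo.
have gu0 (t : R) : 0 <= g `|t| by exact: (young_g_ge0 Y).
apply: (le_trans (hC u h mu' mh uth h0)).
have P1 : (\int[mu2]_(z in pairs) (g `|Dz u z| * `|Dz h z| * kz z)%:E <=
    e1%:E * modD h + e2%:E * modD u)%E.
  apply: le_integral_comb; [exact: mP|exact: measurable_bint_density|exact: measurable_GD|
    exact: measurable_GD|exact: bint_density_ge0|exact: GD_ge0|exact: GD_ge0|exact: e10|exact: e20|].
  by move=> z _; rewrite !mulrA -mulrDl ler_wpM2r ?kz_ge0// mulrC; exact: he.
have g1 : 1 <= g 1.
  have [h1 _] := yp_grow Y (@ler01 R); move: h1; rewrite (yp_G1 Y) mulr1 mul1r.
  by apply: le_trans; exact: ltW (yp_p1 Y).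
have P2 : (\int[mu]_x (`|h x| * (g `|u x| + 1))%:E <=
    (2 * e1)%:E * modL h + e2%:E * modL u + (e2 * m0)%:E)%E.
  have ma : measurable_fun setT (fun x => `|h x| * (g `|u x| + 1)).
    apply: measurable_funM; first exact: measurable_normf.
    by apply: measurable_funD => //; exact: measurableT_comp measurable_g mu'.
  have -> : (\int[mu]_x (`|h x| * (g `|u x| + 1))%:E =
      \int[mu]_(x in Om) (`|h x| * (g `|u x| + 1))%:E)%E.
    rewrite [RHS]integral_mul_indic//; apply: eq_integral => x _; rewrite indicE.
    have [xO|] := boolP (x \in Om); first by rewrite mulr1.
    by rewrite notin_setE => /h0 ->; rewrite normr0 !mul0r.
  have -> : (e2 * m0)%:E = (\int[mu]_(x in Om) e2%:E)%E.
    by rewrite integral_cst//= EFinM; congr (_ * _)%E; exact: esym muOm.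
  rewrite -!integralZ_EFin//; [|exact: measurable_GG|by move=> x; exact: GG_ge0|
    exact: measurable_GG|by move=> x; exact: GG_ge0|by rewrite mulr_ge0].
  have m1 := measurable_funM (measurable_cst (2 * e1)) (measurable_GG mh).
  have m2 := measurable_funM (measurable_cst e2) (measurable_GG mu').
  rewrite -integralD_EFin//; first last.
  - by move=> x; rewrite mulr_ge0 ?GG_ge0.
  - by move=> x; rewrite !mulr_ge0 ?GG_ge0.
  rewrite -integralD_EFin//; first last.
  - by move=> x; rewrite addr_ge0// !mulr_ge0 ?GG_ge0.
  - exact: measurable_funD.
  apply: le_integral_EFin => //.
  - by apply: measurable_funD => //; exact: measurable_funD.
  - by move=> x; rewrite mulr_ge0// addr_ge0// gu0.
  - move=> x _; have E1 := he _ _ (normr_ge0 (h x)) (normr_ge0 (u x)).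
    have E2 := he _ _ (normr_ge0 (h x)) (@ler01 R).
    have E3 : `|h x| <= `|h x| * g 1 by rewrite ler_peMr.
    rewrite /even_ext; rewrite (yp_G1 Y) mulr1 in E2; lra.
have l0 := modL_ge0 h; have d0 := modD_ge0 h.
have l1 := modL_ge0 u; have d1 := modD_ge0 u.
apply: (@le_trans _ _ (C%:E * (e1%:E * modD h + e2%:E * modD u +
    ((2 * e1)%:E * modL h + e2%:E * modL u + (e2 * m0)%:E)))%E).
  by rewrite lee_wpmul2l ?lee_fin ?(ltW C0)//; exact: leeD.
move: uoo hoo; rewrite !modWE => uoo hoo.
have [lu [du [-> -> lu0 du0]]] := adde_fin_split l1 d1 uoo.
have [lh [dh [-> -> lh0 dh0]]] := adde_fin_split l0 d0 hoo.
suff H : C * (e1 * dh + e2 * du + (2 * e1 * lh + e2 * lu + e2 * m0)) <=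
    2 * C * (1 + m0) * e1 * (lh + dh) + 2 * C * (1 + m0) * e2 * (lu + du + 1).
  by rewrite -lee_fin in H; exact: H.
have -> : 2 * C * (1 + m0) * e1 * (lh + dh) + 2 * C * (1 + m0) * e2 * (lu + du + 1) =
  C * (2 * (1 + m0) * e1 * (lh + dh) + 2 * (1 + m0) * e2 * (lu + du + 1)) by ring.
rewrite ler_pM2l//.
have m1 : 0 <= m0 * (e1 * (lh + dh)) by rewrite !mulr_ge0 ?addr_ge0.
have m2 : 0 <= m0 * (e2 * (lu + du)) by rewrite !mulr_ge0 ?addr_ge0.
have m3 := mulr_ge0 e20 m00; have m4 := mulr_ge0 e10 lh0; have m5 := mulr_ge0 e10 dh0.
have m6 := mulr_ge0 e20 lu0; have m7 := mulr_ge0 e20 du0.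
nra.
Qed.

(** The small factor in front of the increment [h] serves coercivity; the mirror image [bint_r],
    small in front of [u], serves the passage to the limit in the energy. *)
Lemma bint_l (e : R) : 0 < e -> exists2 C : R, 0 <= C & forall u h,
  measurable_fun setT u -> measurable_fun setT h ->
  (forall y, ~ Om y -> u y = th y) -> (forall y, ~ Om y -> h y = 0) ->
  (modW u < +oo)%E -> (modW h < +oo)%E ->
  (bint u h <= e%:E * modW h + C%:E * (modW u + 1))%E.
Proof.
move=> e0; have [C0 C00 hC] := bint_young.
have [C C_0 hY] := young_ineq_l Y (divr_gt0 e0 C00).
exists (C0 * C); first by rewrite mulr_ge0// ltW.
move=> u h *; have := hC _ _ (ltW (divr_gt0 e0 C00)) C_0 hY u h.
by rewrite mulrC divfK ?gt_eqF//; apply.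
Qed.

Lemma bint_r (e : R) : 0 < e -> exists2 C : R, 0 <= C & forall u h,
  measurable_fun setT u -> measurable_fun setT h ->
  (forall y, ~ Om y -> u y = th y) -> (forall y, ~ Om y -> h y = 0) ->
  (modW u < +oo)%E -> (modW h < +oo)%E ->
  (bint u h <= C%:E * modW h + e%:E * (modW u + 1))%E.
Proof.
move=> e0; have [C0 C00 hC] := bint_young.
have [C C_0 hY] := young_ineq_r Y (divr_gt0 e0 C00).
exists (C0 * C); first by rewrite mulr_ge0// ltW.
move=> u h *; have := hC _ _ C_0 (ltW (divr_gt0 e0 C00)) hY u h.
by rewrite [(C0 * (e / C0))]mulrC divfK ?gt_eqF//; apply.
Qed.

(** Tonelli over [Om] x [A]. It serves the Poincare inequality and the comparison of almost
    minimizers, both of which bound an integrand on pairs from below by a function of [x] alone. *)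
Lemma product_lower_bound (A : set T) (f : T -> R) (F : Z -> R) :
  measurable A -> A `<=` Om' -> measurable_fun setT f -> measurable_fun setT F ->
  (forall x, 0 <= f x) -> (forall z, 0 <= F z) ->
  (forall x y, Om x -> A y -> f x <= F (row_mx x y)) ->
  (mu A * \int[mu]_(x in Om) (f x)%:E <= \int[mu2]_(z in pairs) (F z)%:E)%E.
Proof.
move=> mA AO mf mF f0 F0 fF.
have fO0 x : 0 <= f x * \1_Om x by rewrite mulr_ge0// indicE.
have mfO : measurable_fun setT (fun x => f x * \1_Om x).
  by apply: measurable_funM => //; exact: measurable_indic.
have mFP : measurable_fun setT (fun z => F z * \1_pairs z).
  by apply: measurable_funM => //; exact: measurable_indic.
rewrite (integral_mul_indic _ f mOmE) (integral_mul_indic _ F mP) leb_tonelli; first last.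
- by move=> z; rewrite lee_fin mulr_ge0// indicE.
- exact/measurable_EFinP.
rewrite -ge0_integralZl//; first last.
- by move=> x _; rewrite lee_fin.
- exact/measurable_EFinP.
apply: ge0_le_integral => //.
- by move=> x _; rewrite mule_ge0// lee_fin.
- by apply: measurable_funeM; exact/measurable_EFinP.
- have := @measurable_tonelli R n n (fun z => (F z * \1_pairs z)%:E).
  apply; first exact/measurable_EFinP.
  by move=> z; rewrite lee_fin mulr_ge0// indicE.
move=> x _; have -> : mu A = (\int[mu]_y (\1_A y)%:E)%E by rewrite integral_indic// setIT.
rewrite muleC -ge0_integralZl_EFin//; last first.
  by apply/measurable_EFinP; exact: measurable_indic.
apply: ge0_integral_mono => y.
  by rewrite mule_ge0// lee_fin.
rewrite -EFinM lee_fin !indicE.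
have [xO|xO] := boolP (x \in Om); last first.
  by rewrite mulr0 mul0r mulr_ge0.
have [yA|yA] := boolP (y \in A); last by rewrite mulr0 mulr_ge0.
rewrite mem_set; last by rewrite /pairs /= row_mxKl row_mxKr; split; [exact: set_mem|apply: AO; exact: set_mem].
by rewrite !mulr1; apply: fF; exact: set_mem.
Qed.

(* Away from [Om] the function vanishes, so the energy on [Om x A], for a set
   [A] between [Om] and [Om'], already controls [int_Om G |h|]. *)
Lemma outer_set : Om !=set0 -> exists A M d, [/\ measurable A, A `<=` Om' `\` Om,
  (0 < mu A < +oo)%E, 0 < d & [/\ 1 <= M, forall y, A y -> `|th y| <= M &
  forall x y, Om x -> A y -> d <= enorm (x - y) <= M]].
Proof.
move=> Om0; have [c [r [r0 hA]]] := cube_outside (es_Om' E) (es_bOm E) (es_cOm E) (es_n E) Om0.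
have [M M0 hM] := ebounded_dist (es_bOm E) (es_bOm' E).
have r20 : 0 < r / 2 by rewrite divr_gt0.
pose Q := cube c (r / 2); pose B (j : nat) := Q `&` [set y | `|th y| <= j%:R].
have mQ : measurable Q by exact: measurable_cube.
have muQ : mu Q = ((2 * (r / 2)) ^+ n)%:E by exact: leb_cube (ltW r20).
have QA : Q `<=` Om' `\` Om.
  by move=> y Qy; apply: hA => i; apply: lt_le_trans (Qy i) _; rewrite ler_pdivrMr// ler_peMr ?(ltW r0)// ler1n.
have mB j : measurable (B j).
  apply: measurableI => //; apply: measurable_le_set => //.
  by apply: measurable_normf; exact: (es_th E).
have [j Bj] : exists j, mu (B j) <> 0%E.
  apply: contrapT => /forallNP h.
  have : (mu Q <= \sum_(j <oo) mu (B j))%E.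
    apply: measure_sigma_subadditive => //.
    move=> y Qy; exists (Num.bound `|th y|) => //; split => //.
    by rewrite /= ltW// archi_boundP.
  rewrite eseries0 => [|i _ _]; last by apply: contrapT; exact: h.
  by rewrite muQ lee_fin leNgt exprn_gt0// mulr_gt0.
exists (B j), (1 + M + j%:R), (r / 2); split => //.
- by move=> y [/QA].
- rewrite lt0e measure_ge0 andbT; apply/andP; split; first exact/eqP.
  have muQoo : (mu Q < +oo)%E by rewrite muQ ltry.
  apply: le_lt_trans muQoo; apply: le_measure; rewrite ?inE//; exact: subIsetl.
split.
- by rewrite -addrA lerDl addr_ge0// ltW.
- by move=> y [_ /= h]; rewrite (le_trans h)// lerDr addr_ge0// ltW.
move=> x y Ox [Qy _]; apply/andP; split; last first.
  have [Oy' _] := QA _ Qy; rewrite (le_trans (hM x y Ox Oy'))// addrAC lerDr addr_ge0//.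
have [i ri] : exists i, r <= `|x 0 i - c 0 i|.
  apply: contrapT => /forallNP h; have [] := hA x; last by [].
  by move=> i; rewrite ltNge; apply/negP; exact: h.
apply: le_trans (norm_le_enorm _); apply: le_trans (coord_le_norm _ i).
rewrite !mxE; have := Qy i; have := ler_distD (y 0 i) (x 0 i) (c 0 i); lra.
Qed.

Lemma poincare : exists2 C : R, 0 < C & forall h, measurable_fun setT h ->
  (forall y, ~ Om y -> h y = 0) -> (modL h <= C%:E * modD h)%E.
Proof.
have [Om0|/set0P /outer_set[A [M [d [mA AO /andP[A0 Aoo] d0 [M1 _ hM]]]]]] := eqVneq Om set0.
  exists 1 => // h _ _; have -> : modL h = 0%E by rewrite -(integral_set0 mu (fun x => (GG (h x))%:E)) -Om0.
  by rewrite mul1e modD_ge0.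
have M0 : 0 < M by exact: lt_le_trans M1.
(* Since [h y = 0] and [enorm (x - y) <= M], the quotient of [h] is at least [M ^ (- s) * |h x|] in
   absolute value and the kernel at least [M ^ (- n)]; taking the factor [M ^ (- s) <= 1] out of [G]
   costs the power [q]. *)
pose c := (M `^ (- s)) `^ q * (M ^+ n)^-1.
have Ms0 : 0 < M `^ (- s) by exact: powR_gt0.
have Ms1 : M `^ (- s) <= 1.
  by rewrite powRN invf_le1 ?powR_gt0// -(powRr0 M) ler_powR// ltW.
have c0 : 0 < c by rewrite mulr_gt0 ?powR_gt0// invr_gt0 exprn_gt0.
pose a := fine (mu A).
have aE : mu A = a%:E by rewrite fineK// ge0_fin_numE.
have a0 : 0 < a by rewrite -lte_fin -aE.
exists (c * a)^-1; first by rewrite invr_gt0 mulr_gt0.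
move=> h mh h0.
have key : (mu A * \int[mu]_(x in Om) (c * GG (h x))%:E <= modD h)%E.
  apply: product_lower_bound => //.
  - by move=> y /AO[].
  - by apply: measurable_funM => //; exact: measurable_GG.
  - exact: measurable_GD.
  - by move=> x; rewrite mulr_ge0 ?GG_ge0 ?(ltW c0).
  - by move=> z; exact: GD_ge0.
  move=> x y Ox Ay; have [_ nOy] := AO y Ay.
  have /andP[dr rM] := hM x y Ox Ay; have r0 := lt_le_trans d0 dr.
  rewrite Dz_row kz_row /Ds (h0 y nOy) subr0 /kern /c mulrAC; apply: ler_pM.
  - by rewrite mulr_ge0 ?powR_ge0 ?GG_ge0.
  - by rewrite invr_ge0 exprn_ge0 ?(ltW M0).
  - rewrite /even_ext (le_trans (young_scale_le1_q Y _ _))//; first by rewrite Ms0.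
    apply: (young_G_le Y); first by rewrite mulr_ge0 ?(ltW Ms0).
    rewrite normrM mulrC ler_wpM2l// (@ger0_norm _ (_^-1)) ?invr_ge0 ?powR_ge0//.
    rewrite powRN lef_pV2 ?posrE ?powR_gt0//.
    by rewrite ge0_ler_powR ?(ltW s0)// nnegrE ltW.
  - rewrite lef_pV2 ?posrE ?exprn_gt0//.
    by rewrite lerXn2r ?nnegrE ?(ltW r0) ?(ltW M0).
move: key; rewrite integralZ_EFin//; [|exact: measurable_GG|by move=> x; exact: GG_ge0|exact: ltW].
rewrite aE muleA -EFinM => key.
by rewrite (mulrC c) lee_pdivlMl ?(mulr_gt0 a0 c0).
Qed.


(** * Competitors, the normalized energy and its coercivity *)

Variables (Lam : R) (K : Z -> R).
Hypotheses (L0 : 0 < Lam) (mK : measurable_fun setT K).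
Hypothesis Kb : forall z, Lam^-1 <= K z <= Lam.
Local Notation RI := (Rintegral mu2 setT).
Local Notation intg f := (mu2.-integrable setT (EFin \o f)).

Definition competitor u := [/\ measurable_fun setT u,
  forall y, ~ Om y -> u y = th y & (modW u < +oo)%E].

Let eq_real u : (modW u < +oo)%E -> exists a b : R,
  [/\ modL u = a%:E, modD u = b%:E, 0 <= a & 0 <= b].
Proof. by move=> h; apply: adde_fin_split => //; [exact: modL_ge0 _|exact: modD_ge0 _]. Qed.

Lemma competitor_th : competitor th.
Proof. by split => //; [exact: (es_th E)|exact: (es_modth E)]. Qed.

Lemma competitor_sub u v : competitor u -> competitor v ->
  admissible (fun x => u x - v x).
Proof.
move=> [mu' hu uoo] [mv hv voo]; split; first exact: measurable_funB.
- by move=> y nOy; rewrite hu// hv// subrr.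
- apply: le_lt_trans (modW_sub mu' mv) _.
  have [a [b [la lb _ _]]] := eq_real uoo; have [c [d [lc ld _ _]]] := eq_real voo.
  rewrite !modWE la lb lc ld; exact: ltry.
Qed.

Lemma competitor_convex (t : R) u v : 0 <= t <= 1 -> competitor u -> competitor v ->
  competitor (fun x => (1 - t) * u x + t * v x).
Proof.
move=> t01 [mu' hu uoo] [mv hv voo]; split.
- by apply: measurable_funD; exact: measurable_funM.
- by move=> y nOy; rewrite hu// hv//; ring.
- apply: le_lt_trans (modW_convex t01 mu' mv) _.
  have [a [b [la lb _ _]]] := eq_real uoo; have [c [d [lc ld _ _]]] := eq_real voo.
  rewrite !modWE la lb lc ld; exact: ltry.
Qed.

Lemma bint_fin u h : competitor u -> admissible h -> (bint u h < +oo)%E.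
Proof.
move=> [mu' hu uoo] [mh h0 hoo].
have [C C0 hC] := bint_l ltr01.
apply: le_lt_trans (hC u h mu' mh hu h0 uoo hoo) _.
have [a [b [la lb _ _]]] := eq_real uoo; have [c [d [lc ld _ _]]] := eq_real hoo.
rewrite !modWE la lb lc ld; exact: ltry.
Qed.

Lemma bint_integrable u h : competitor u -> admissible h ->
  intg (fun z => g `|Dz u z| * `|Dz h z| * kz z).
Proof.
move=> cu ah; have [mu' _ _] := cu; have [mh _ _] := ah; apply/integrableP; split.
  apply/measurable_EFinP; exact: measurable_bint_density.
rewrite (eq_integral (fun z => (g `|Dz u z| * `|Dz h z| * kz z)%:E)); first exact: bint_fin.
by move=> z _ /=; rewrite ger0_norm//; exact: bint_density_ge0.
Qed.

Lemma Rint_bint u h : competitor u -> admissible h ->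
  ((RI (fun z => g `|Dz u z| * `|Dz h z| * kz z))%:E = bint u h)%E.
Proof.
move=> cu ah; rewrite fineK// ge0_fin_numE; first exact: bint_fin.
by apply: integral_ge0 => z _; rewrite lee_fin bint_density_ge0.
Qed.

Definition wz z := kz z * K z.

Lemma wz_bounds z : [/\ 0 <= wz z, wz z <= Lam * kz z & Lam^-1 * kz z <= wz z].
Proof.
have k0 := kz_ge0 z; have /andP[K1 K2] := Kb z; rewrite /wz; split.
- by rewrite mulr_ge0// (le_trans _ K1)// invr_ge0 ltW.
- by rewrite mulrC ler_wpM2r.
- by rewrite mulrC ler_wpM2l.
Qed.

Lemma measurable_wz : measurable_fun setT wz.
Proof. by apply: measurable_funM => //; exact: measurable_kz. Qed.

Lemma norm_even_ext_sub (a b : R) :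
  `|GG a - GG b| <= (g `|a| + g `|b|) * `|a - b|.
Proof.
have h1 := even_ext_tangent Y a b; have h2 := even_ext_tangent Y b a.
have n1 : `|gg a * (b - a)| = g `|a| * `|a - b| by rewrite normrM (norm_odd_ext Y) distrC.
have n2 : `|gg b * (a - b)| = g `|b| * `|a - b| by rewrite normrM (norm_odd_ext Y).
have g1 : 0 <= g `|a| * `|a - b| by rewrite -n1.
have g2 : 0 <= g `|b| * `|a - b| by rewrite -n2.
have i1 := ler_norm (- (gg a * (b - a))); have i2 := ler_norm (gg b * (a - b)).
have i3 := ler_norm ((gg a * (b - a))); have i4 := ler_norm (- (gg b * (a - b))).
rewrite normrN n1 in i1; rewrite n2 in i2; rewrite n1 in i3; rewrite normrN n2 in i4.
rewrite ler_norml mulrDl; apply/andP; split; lra.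
Qed.

(** The two tangent inequalities give [norm_even_ext_sub], where the factor [|a - b|] is here the
    quotient of [u - v]. That function vanishes off [Om], so [bint] bounds the difference even when
    the separate terms are not integrable. *)
Lemma energy_diff_integrable u v : competitor u -> competitor v ->
  intg (fun z => (GG (Dz u z) - GG (Dz v z)) * wz z).
Proof.
move=> cu cv; have [mu' _ _] := cu; have [mv _ _] := cv.
have auv := competitor_sub cu cv.
have i1 := bint_integrable cu auv; have i2 := bint_integrable cv auv.
apply: (dominated_intg _ (intgZ Lam (intgD i1 i2))).
  apply: measurable_funM; last exact: measurable_wz.
  apply: measurable_funB.
    exact: measurableT_comp (measurable_even_ext Y) (measurable_Dz s mu').
  exact: measurableT_comp (measurable_even_ext Y) (measurable_Dz s mv).
move=> z; have [w0 w1 _] := wz_bounds z; have k0 := kz_ge0 z.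
rewrite normrM (ger0_norm w0) DzB -!mulrDl.
apply: (@le_trans _ _ ((g `|Dz u z| + g `|Dz v z|) * `|Dz u z - Dz v z| * (Lam * kz z))).
  by apply: ler_pM => //; exact: norm_even_ext_sub.
by rewrite le_eqVlt; apply/orP; left; apply/eqP; ring.
Qed.

(* Normalized by [th]: the integral of [GG (Dz u) * wz] alone may be infinite,
   since [th] has no growth control off [Om] beyond the tail condition. *)
Definition energy u := RI (fun z => (GG (Dz u z) - GG (Dz th z)) * wz z).

Lemma energyB u v : competitor u -> competitor v ->
  energy u - energy v = RI (fun z => (GG (Dz u z) - GG (Dz v z)) * wz z).
Proof.
move=> cu cv; rewrite /energy -RintegralB//; first last.
- exact: energy_diff_integrable cv competitor_th.
- exact: energy_diff_integrable cu competitor_th.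
by apply: eq_Rintegral => z _; ring.
Qed.

Lemma energyB_le u v : competitor u -> competitor v ->
  ((energy u - energy v)%:E <= Lam%:E * bint u (fun x => (u x - v x)%R))%E.
Proof.
move=> cu cv; have auv := competitor_sub cu cv; have i1 := bint_integrable cu auv.
rewrite -(Rint_bint cu auv) -EFinM lee_fin -RintegralZl// energyB//.
apply: le_Rintegral => //.
- exact: energy_diff_integrable.
- exact: intgZ.
move=> z _; have [w0 w1 _] := wz_bounds z; have k0 := kz_ge0 z.
apply: (@le_trans _ _ (g `|Dz u z| * `|Dz u z - Dz v z| * wz z)).
  rewrite ler_wpM2r//; have := even_ext_tangent Y (Dz u z) (Dz v z).
  have := ler_norm (gg (Dz u z) * (Dz u z - Dz v z)).
  by rewrite normrM (norm_odd_ext Y); lra.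
rewrite DzB (mulrC Lam) -[leRHS]mulrA (mulrC _ Lam) ler_wpM2l//.
by rewrite mulr_ge0// (young_g_ge0 Y).
Qed.

Lemma measurable_gap v w : measurable_fun setT v -> measurable_fun setT w ->
  measurable_fun setT (fun z => convex_gap G (Dz v z) (Dz w z)).
Proof.
have mGD f : measurable_fun setT f -> measurable_fun setT (fun z => GG (Dz f z)).
  by move=> mf; exact: measurableT_comp (measurable_even_ext Y) (measurable_Dz s mf).
move=> mv mw; rewrite /convex_gap; apply: measurable_funB.
  by apply: measurable_funM => //; apply: measurable_funD; exact: mGD.
apply: measurableT_comp (measurable_even_ext Y) _.
by apply: measurable_funM => //; apply: measurable_funD; exact: measurable_Dz.
Qed.

(** The convexity defect of the energy at the midpoint is the integral of the gap against [wz] over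
    all pairs, the reference density of [th] having cancelled. Nonnegativity permits restriction to
    [pairs], and [K >= Lam^-1] removes the coefficient. *)
Lemma gap_integral u v : competitor u -> competitor v ->
  (\int[mu2]_(z in pairs) (convex_gap G (Dz u z) (Dz v z) * kz z)%:E <=
   (Lam * ((energy u + energy v) / 2 - energy (fun x => ((1 - 2^-1) * u x + 2^-1 * v x)%R)))%:E)%E.
Proof.
move=> cu cv; set m := (fun x => _ : R).
have cm : competitor m by apply: competitor_convex => //; lra.
have [mu' _ _] := cu; have [mv _ _] := cv; have [mm _ _] := cm.
have DmE z : Dz m z = (Dz u z + Dz v z) / 2 by rewrite /m DzD !DzZ; field.
have gap0 z := convex_gap_ge0 Y (Dz u z) (Dz v z).
have iu := energy_diff_integrable cu cm; have iv := energy_diff_integrable cv cm.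
have gapE z : convex_gap G (Dz u z) (Dz v z) * wz z =
    2^-1 * ((GG (Dz u z) - GG (Dz m z)) * wz z + (GG (Dz v z) - GG (Dz m z)) * wz z).
  by rewrite /convex_gap DmE; field.
have ig : intg (fun z => convex_gap G (Dz u z) (Dz v z) * wz z).
  apply: eq_integrable (intgZ 2^-1 (intgD iu iv)) => // z _ /=.
  by rewrite gapE.
have -> : (energy u + energy v) / 2 - energy m =
    RI (fun z => convex_gap G (Dz u z) (Dz v z) * wz z).
  under [RHS]eq_Rintegral do rewrite gapE.
  rewrite RintegralZl//; last exact: intgD.
  by rewrite RintegralD// -!energyB//; field.
rewrite -RintegralZl// /Rintegral fineK; last first.
  by apply: integrable_fin_num => //; exact: (intgZ Lam ig).
rewrite (integral_mul_indic _ _ mP); apply: ge0_integral_mono => z; rewrite lee_fin.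
  by rewrite !mulr_ge0 ?kz_ge0// indicE.
have [w0 _ w1] := wz_bounds z; have k0 := kz_ge0 z.
apply: (@le_trans _ _ (convex_gap G (Dz u z) (Dz v z) * kz z)).
  by rewrite ler_piMr ?mulr_ge0// indicE; case: (_ \in _).
rewrite mulrCA ler_wpM2l//; move: w1; rewrite -ler_pdivlMl ?invr_gt0// invrK.
by [].
Qed.

(** On [pairs] the two modulars bound the energy density from below. Off [pairs] the tangent
    inequality at [th] leaves a linear term bounded by [bint th (u - th)]; it is absorbed by
    [bint_l], once the Poincare inequality has bounded the modular of [u - th] by its difference
    part. *)
Lemma coercive : exists2 C : R, 0 < C & forall u, competitor u ->
  (modW u <= (C * (energy u + C))%:E)%E.
Proof.
have [CP CP0 poin] := poincare.
have [t [tD [tL tDE t0 tD0]]] := eq_real (es_modth E).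
pose A := (2 : R) `^ q; have A0 : 0 < A by rewrite powR_gt0.
(* Makes the contribution of [u - th] in [P7] at most half of [du + tD], so that [du] can be moved
   to the left. *)
pose e := (Lam * Lam * 2 * ((1 + CP) * A))^-1.
have e0 : 0 < e by rewrite invr_gt0 !mulr_gt0// addr_gt0.
have [Ce Ce0 hCe] := bint_l e0.
pose C2 := 2 * Lam * Lam * tD + tD + 2 * Lam * Lam * (Ce * (t + tD + 1)).
have C20 : 0 <= C2 by rewrite /C2 !(addr_ge0, mulr_ge0)// ltW.
pose B := A * CP * A + 1.
have B0 : 0 < B by rewrite /B addr_gt0// !mulr_gt0.
pose W := B * tD + A * t.
have W0 : 0 <= W by rewrite /W addr_ge0// mulr_ge0// ltW.
pose V := C2 / (2 * Lam).
have V0 : 0 <= V by rewrite /V divr_ge0// mulr_ge0// ltW.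
have X0 : 0 < 2 * Lam * B by rewrite !mulr_gt0.
(* The estimate [P9] reads [lu + du <= 2 * Lam * B * (energy u + V) + W] with [energy u + V >= 0];
   one constant that is large enough for the factor and for both shifts yields the form
   [C * (energy u + C)]. *)
exists (2 * Lam * B + V + W + 1); first by rewrite !ltr_wpDr.
move=> u cu; have [mu' hu uoo] := cu.
have ah := competitor_sub cu competitor_th; have [mh h0 hoo] := ah.
set h := (fun x => u x - th x : R) in ah mh h0 hoo.
have [lu [du [luE duE lu0 du0]]] := eq_real uoo.
have [lh [dh [lhE dhE lh0 dh0]]] := eq_real hoo.
have P1 : lh <= CP * dh.
  by have := poin h mh h0; rewrite lhE dhE -EFinM lee_fin.
have P2 : dh <= A * du + A * tD.
  have : (modD h <= A%:E * modD u + A%:E * modD th)%E.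
    apply: le_integral_comb; [exact: mP|exact: measurable_GD _ mh|exact: measurable_GD _ mu'|
      exact: measurable_GD _ (es_th E)|exact: GD_ge0 _|exact: GD_ge0 _|
      exact: GD_ge0 _|exact: ltW|exact: ltW|].
    move=> z _; rewrite DzB !mulrA -mulrDl ler_wpM2r ?kz_ge0// -mulrDr.
    exact: (even_ext_sub Y).
  by rewrite dhE duE tDE -!EFinM -EFinD lee_fin.
have P3 : (bint th h <= (e * (lh + dh) + Ce * (t + tD + 1))%:E)%E.
  have := hCe th h (es_th E) mh (fun y _ => erefl) h0 (es_modth E) hoo.
  by rewrite !modWE lhE dhE tL tDE; exact.
have P4 : Lam^-1 * du - Lam * tD <= energy u + Lam * (e * (lh + dh) + Ce * (t + tD + 1)).
  have [iu iuE] := Rintegral_indic_fin mP (measurable_GD mu') (GD_ge0 u) duE.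
  have [it itE] := Rintegral_indic_fin mP (measurable_GD (es_th E)) (GD_ge0 th) tDE.
  have ib := bint_integrable competitor_th ah.
  move: P3; rewrite -(Rint_bint competitor_th ah) lee_fin => P3.
  have ij := energy_diff_integrable cu competitor_th.
  apply: (@le_trans _ _ (energy u + Lam * RI (fun z => g `|Dz th z| * `|Dz h z| * kz z))); last first.
    rewrite lerD2l (ler_pM2l L0); exact: P3.
  rewrite -iuE -itE /energy -!RintegralZl// -RintegralD//; last exact: intgZ.
  rewrite -RintegralB//; [|exact: intgZ|exact: intgZ].
  apply: le_Rintegral => //; first by apply: intgB; exact: intgZ.
    by apply: intgD => //; exact: intgZ.
  move=> z _; have [w0 w1 w2] := wz_bounds z; have k0 := kz_ge0 z.
  have b0 := bint_density_ge0 th h z.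
  have [Pz|nPz] := boolP (z \in pairs); rewrite indicE.
    rewrite Pz !mulr1; apply: (@le_trans _ _ ((GG (Dz u z) - GG (Dz th z)) * wz z)); last first.
      by rewrite lerDl mulr_ge0// ltW.
    have h1 := ler_wpM2l (GG_ge0 (Dz u z)) w2.
    have h2 := ler_wpM2l (GG_ge0 (Dz th z)) w1.
    by rewrite mulrBl (mulrCA Lam^-1) (mulrCA Lam); apply: lerB.
  rewrite (negbTE nPz) !mulr0 subrr.
  have h1 := even_ext_tangent Y (Dz th z) (Dz u z).
  have h2 := ler_norm (- (gg (Dz th z) * (Dz u z - Dz th z))).
  rewrite normrN normrM (norm_odd_ext Y) in h2.
  have gh : 0 <= g `|Dz th z| * `|Dz h z| by rewrite mulr_ge0// (young_g_ge0 Y).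
  have h3 := ler_wpM2l gh w1.
  have h4 : - (g `|Dz th z| * `|Dz h z|) * wz z <= (GG (Dz u z) - GG (Dz th z)) * wz z.
    by rewrite ler_wpM2r// DzB; lra.
  have -> : Lam * (g `|Dz th z| * `|Dz h z| * kz z) = g `|Dz th z| * `|Dz h z| * (Lam * kz z).
    by ring.
  by rewrite mulNr in h4; lra.
have P5 : lu <= A * lh + A * t.
  have : (modL u <= A%:E * modL h + A%:E * modL th)%E.
    apply: le_integral_comb; [exact: mOmE|exact: measurable_GG _ mu'|exact: measurable_GG _ mh|
      exact: measurable_GG _ (es_th E)|by move=> x; exact: GG_ge0 _|
      by move=> x; exact: GG_ge0 _|by move=> x; exact: GG_ge0 _|exact: ltW|exact: ltW|].
    move=> x _; rewrite -mulrDr; have := even_ext_add Y (h x) (th x).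
    by rewrite /h subrK.
  by rewrite luE lhE tL -!EFinM -EFinD lee_fin.
rewrite modWE luE duE -EFinD lee_fin.
have P6 : lh + dh <= (1 + CP) * A * (du + tD).
  have : (1 + CP) * dh <= (1 + CP) * (A * du + A * tD) by rewrite ler_pM2l// addr_gt0.
  lra.
have P7 : du <= 2 * Lam * energy u + C2.
  have h1 : Lam * Lam * (e * (lh + dh)) <= 2^-1 * (du + tD).
    have -> : 2^-1 * (du + tD) = Lam * Lam * (e * ((1 + CP) * A * (du + tD))).
      rewrite /e; field; rewrite !gt_eqF// addr_gt0//.
    by rewrite ler_pM2l ?mulr_gt0// ler_pM2l.
  have h2 : Lam * (Lam^-1 * du - Lam * tD) <= Lam * (energy u + Lam * (e * (lh + dh) + Ce * (t + tD + 1))).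
    by rewrite ler_pM2l.
  rewrite mulrBr mulrA divff ?gt_eqF// mul1r in h2.
  rewrite /C2; lra.
have P8 : 0 <= energy u + V.
  have : 0 <= 2 * Lam * (energy u + V).
    have -> : 2 * Lam * (energy u + V) = 2 * Lam * energy u + C2 by rewrite /V; field; rewrite gt_eqF.
    exact: le_trans P7.
  by rewrite pmulr_rge0// mulr_gt0.
have P9 : lu + du <= 2 * Lam * B * (energy u + V) + W.
  have h1 : A * lh <= A * (CP * dh) by rewrite ler_pM2l.
  have h2 : A * CP * dh <= A * CP * (A * du + A * tD) by rewrite ler_pM2l// mulr_gt0.
  have h3 : B * du <= B * (2 * Lam * energy u + C2) by rewrite ler_pM2l.
  have -> : 2 * Lam * B * (energy u + V) = B * (2 * Lam * energy u + C2).
    by rewrite /V; field; rewrite gt_eqF.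
  apply: le_trans (_ : B * du + W <= _); last by rewrite lerD2r.
  by rewrite /W /B; nra.
apply: (le_trans P9); clearbody V W.
have h4 : 0 <= (V + W + 1) * (energy u + V) by rewrite mulr_ge0// !addr_ge0.
have h5 : W <= (2 * Lam * B + V + W + 1) * (2 * Lam * B + W + 1).
  have h6 := mulr_ge0 V0 W0; have h7 := mulr_ge0 W0 W0.
  have h8 := mulr_ge0 (ltW X0) W0; have h9 := mulr_ge0 (ltW X0) V0.
  have h10 := mulr_ge0 (ltW X0) (ltW X0).
  nra.
lra.
Qed.


(** * Invariance under null sets, and convergence in modular *)

Lemma ae_Dz u v : {ae mu, forall x, u x = v x} -> {ae mu2, forall z, Dz u z = Dz v z}.
Proof.
move=> h; have h1 := @ae_lsubmx _ n n _ h; have h2 := @ae_rsubmx _ n n _ h.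
by apply: filterS2 h1 h2 => z; rewrite !DzE => -> ->.
Qed.

Lemma modL_ae u v : measurable_fun setT u -> measurable_fun setT v ->
  {ae mu, forall x, u x = v x} -> modL u = modL v.
Proof.
move=> mu' mv h; apply: integral_ae_eq_EFin => //; [exact: measurable_GG|exact: measurable_GG|].
by apply: filterS h => x ->.
Qed.

Lemma modD_ae u v : measurable_fun setT u -> measurable_fun setT v ->
  {ae mu, forall x, u x = v x} -> modD u = modD v.
Proof.
move=> mu' mv h; apply: integral_ae_eq_EFin => //; [exact: measurable_GD|exact: measurable_GD|].
by apply: filterS (ae_Dz h) => z ->.
Qed.

Lemma modW_ae u v : measurable_fun setT u -> measurable_fun setT v ->
  {ae mu, forall x, u x = v x} -> modW u = modW v.
Proof. by move=> mu' mv h; rewrite !modWE (modL_ae mu' mv h) (modD_ae mu' mv h). Qed.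

Lemma measurable_energy_density u : measurable_fun setT u ->
  measurable_fun setT (fun z => (GG (Dz u z) - GG (Dz th z)) * wz z).
Proof.
move=> mu'; apply: measurable_funM; last exact: measurable_wz.
apply: measurable_funB.
  exact: measurableT_comp (measurable_even_ext Y) (measurable_Dz s mu').
exact: measurableT_comp (measurable_even_ext Y) (measurable_Dz s (es_th E)).
Qed.

Lemma energy_ae u v : measurable_fun setT u -> measurable_fun setT v ->
  {ae mu, forall x, u x = v x} -> energy u = energy v.
Proof.
move=> mu' mv h; apply: Rintegral_ae_eq; [exact: measurable_energy_density|exact: measurable_energy_density|].
by apply: filterS (ae_Dz h) => z ->.
Qed.

Lemma Dz_cvg (u_ : nat -> T -> R) u : (forall x, u_ ^~ x @ \oo --> u x) ->
  forall z, (fun k => Dz (u_ k) z) @ \oo --> Dz u z.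
Proof.
move=> h z; rewrite DzE; under eq_fun do rewrite DzE.
by apply: cvgM; [apply: cvgB; exact: h|exact: cvg_cst].
Qed.

Lemma GG_cvg (a_ : nat -> R) (a : R) : a_ @ \oo --> a -> (GG \o a_) @ \oo --> GG a.
Proof. by move=> h; apply: continuous_cvg h; exact: (continuous_even_ext Y). Qed.

(* Fatou in the second argument turns a Cauchy-type bound on the gaps into a
   bound on the gaps with the limit; coercivity of the gap then allows dominated
   convergence with the fixed majorant [GG (Dz u)]. *)
Lemma modular_limit (u_ : nat -> T -> R) (r : nat -> R) u :
  (forall k, measurable_fun setT (u_ k)) -> (forall x, u_ ^~ x @ \oo --> u x) ->
  (modD u < +oo)%E -> r @ \oo --> 0 ->
  (forall k l, (\int[mu2]_(z in pairs) (convex_gap G (Dz (u_ k) z) (Dz (u_ l) z) * kz z)%:E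
     <= (r k + r l)%:E)%E) ->
  forall e : R, 0 < e -> \forall k \near \oo, (modD (fun x => u x - u_ k x)%R <= e%:E)%E.
Proof.
move=> mu_ hu uoo r0 hr.
have mu' : measurable_fun setT u.
  exact: (measurable_fun_cvg (h := u_) (fun k => mu_ k) (fun x _ => hu x)).
have [c [C [c0 C0 hc]]] := convex_gap_coercive Y.
have gap0 a b : 0 <= convex_gap G a b := convex_gap_ge0 Y a b.
have gap_lim k (e0 : R) : 0 < e0 ->
    (\int[mu2]_(z in pairs) (convex_gap G (Dz (u_ k) z) (Dz u z) * kz z)%:E
    <= (r k + e0)%:E)%E.
  move=> e00.
  apply: (@fatou_bound _ _ _ _ _ (fun l z => convex_gap G (Dz (u_ k) z) (Dz (u_ l) z) * kz z)) => //.
  - by move=> l; apply: measurable_funM; [exact: measurable_gap|exact: measurable_kz].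
  - by move=> l z; rewrite mulr_ge0 ?kz_ge0.
  - move=> z _; apply: cvgM; last exact: cvg_cst.
    have hz := Dz_cvg hu (z := z); rewrite /convex_gap; apply: cvgB.
      by apply: cvgM; [apply: cvgD; [exact: cvg_cst|exact: GG_cvg hz]|exact: cvg_cst].
    apply: GG_cvg; apply: cvgM; last exact: cvg_cst.
    by apply: cvgD; [exact: cvg_cst|exact: hz].
  - move/cvgrPdist_lt: r0 => /(_ _ e00); apply: filterS => l; rewrite sub0r normrN => hl.
    apply: (le_trans (hr k l)); rewrite lee_fin lerD2l (le_trans (ler_norm _))//; exact: ltW.
(* What the gap leaves uncovered. It tends to 0, being at most [c * GG (Dz (u_ k) z - Dz u z)], and
   it has the majorant [2 * C * GG (Dz u z)], because the coercive bound is applied with [b] and [f]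
   both equal to [Dz u z]. *)
pose V k z := Num.max 0 (c * GG (Dz (u_ k) z - Dz u z) - convex_gap G (Dz (u_ k) z) (Dz u z)).
have V0 : forall k z, 0 <= V k z by move=> k z; rewrite /V le_max lexx.
have mcG k : measurable_fun setT (fun z => c * GG (Dz (u_ k) z - Dz u z)).
  apply: measurable_funM => //; apply: measurableT_comp (measurable_even_ext Y) _.
  by apply: measurable_funB; exact: measurable_Dz.
have mV k : measurable_fun setT (V k).
  apply: measurable_maxr => //.
  by apply: measurable_funB; [exact: mcG|exact: measurable_gap].
have V1 k z : V k z <= 2 * C * GG (Dz u z).
  rewrite /V ge_max mulr_ge0 ?GG_ge0 ?mulr_ge0//=.
  have := hc (Dz (u_ k) z) (Dz u z) (Dz u z); lra.
have V2 k z : V k z <= c * GG (Dz (u_ k) z - Dz u z).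
  rewrite /V ge_max mulr_ge0 ?GG_ge0 ?(ltW c0)//=.
  by rewrite gerBl.
have [ud udE] : exists b : R, modD u = b%:E.
  by exists (fine (modD u)); rewrite fineK// ge0_fin_numE//; exact: modD_ge0.
have Vlim : (fun k => \int[mu2]_(z in pairs) (V k z * kz z)%:E)%E @ \oo --> 0%E.
  have := @dominated_convergence _ _ _ mu2 _ mP (fun k z => (V k z * kz z)%:E) (cst 0%E)
    (fun z => (2 * C * (GG (Dz u z) * kz z))%:E).
  have h1 k : measurable_fun pairs (fun z => (V k z * kz z)%:E).
    apply: measurable_funTS; apply/measurable_EFinP; apply: measurable_funM; [exact: mV|exact: measurable_kz].
  have h3 : {ae mu2, forall z, pairs z -> (fun k => (V k z * kz z)%:E) @ \oo --> (cst 0%E : Z -> \bar R) z}.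
    apply: aeW => z _; apply: cvg_EFin; first exact: nearW.
    rewrite -(mul0r (kz z)); apply: cvgM; last exact: cvg_cst.
    apply: (@squeeze_cvgr _ _ _ _ (fun=> 0) (fun k => c * GG (Dz (u_ k) z - Dz u z))).
    - by apply: nearW => k; rewrite V0 V2.
    - exact: cvg_cst.
    rewrite -(mulr0 c); apply: cvgM; first exact: cvg_cst.
    rewrite -[X in _ --> X](even_ext0 Y) -(subrr (Dz u z)); apply: GG_cvg.
    by apply: cvgB; [exact: Dz_cvg|exact: cvg_cst].
  have h4 : mu2.-integrable pairs (fun z => (2 * C * (GG (Dz u z) * kz z))%:E).
    apply/integrableP; split.
      apply: measurable_funTS; apply/measurable_EFinP; apply: measurable_funM => //.
      exact: measurable_GD.
    rewrite (eq_integral (fun z => (2 * C * (GG (Dz u z) * kz z))%:E)).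
      rewrite integralZ_EFin//; last by rewrite mulr_ge0.
      - by rewrite [X in (_ * X)%E](_ : _ = ud%:E)// -EFinM ltry.
      - exact: measurable_GD.
      - exact: GD_ge0.
    by move=> z _ /=; rewrite ger0_norm// !mulr_ge0 ?kz_ge0// GG_ge0.
  have h5 : {ae mu2, forall z k, pairs z -> (`|(V k z * kz z)%:E| <= (2 * C * (GG (Dz u z) * kz z))%:E)%E}.
    apply: aeW => z k _; rewrite /= ger0_norm ?mulr_ge0 ?kz_ge0// lee_fin mulrA.
    by rewrite ler_wpM2r ?kz_ge0.
  move=> /(_ h1 (measurable_cst _) h3 h4 h5)[_ _].
  by rewrite integral0.
move=> e e0; have ce0 : 0 < c * e / 3 by rewrite divr_gt0// mulr_gt0.
have n1 : \forall k \near \oo, (\int[mu2]_(z in pairs) (V k z * kz z)%:E <= (c * e / 3)%:E)%E.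
  have /fine_cvgP[f1 /cvgrPdist_lt/(_ _ ce0) f2] := Vlim.
  apply: filterS2 f1 f2 => k /= hf; rewrite sub0r normrN => hk.
  by rewrite -(fineK hf) lee_fin (le_trans (ler_norm _))// ltW.
move/cvgrPdist_lt: r0 => /(_ _ ce0) n2.
apply: filterS2 n1 n2 => k h1; rewrite sub0r normrN => h2.
have h3 : (c%:E * modD (fun x => (u x - u_ k x)%R) <= (c * e / 3)%:E + (r k + c * e / 3)%:E)%E.
  apply: le_trans (leeD h1 (gap_lim k _ ce0)).
  rewrite -integralD_EFin//; first last.
  - by move=> z; rewrite mulr_ge0 ?kz_ge0.
  - by move=> z; rewrite mulr_ge0 ?kz_ge0.
  - by apply: measurable_funM; [exact: measurable_gap|exact: measurable_kz].
  - by apply: measurable_funM; [exact: mV|exact: measurable_kz].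
  have mk : measurable_fun setT (fun x => u x - u_ k x) by exact: measurable_funB.
  rewrite -integralZ_EFin//; [|exact: measurable_GD|exact: GD_ge0|exact: ltW].
  apply: le_integral_EFin => //.
  - by apply: measurable_funM => //; exact: measurable_GD.
  - apply: measurable_funD; apply: measurable_funM; [exact: mV|exact: measurable_kz|exact: measurable_gap|exact: measurable_kz].
  - by move=> z; rewrite mulr_ge0 ?GD_ge0 ?(ltW c0).
  move=> z _; rewrite DzB -mulrDl mulrA ler_wpM2r ?kz_ge0//.
  have -> : GG (Dz u z - Dz (u_ k) z) = GG (Dz (u_ k) z - Dz u z) by rewrite -even_extN opprB.
  by rewrite -lerBlDr /V le_max lexx orbT.
have -> : e%:E = (c^-1%:E * (c * e)%:E)%E by rewrite -EFinM mulrA mulVf ?mul1r// gt_eqF.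
rewrite lee_pdivlMl//; apply: (le_trans h3); rewrite -EFinD lee_fin.
have := ler_norm (r k); lra.
Qed.


(** * Existence of minimizers *)

Section Minimization.
Variable KB : (T -> R) -> Prop.
Hypothesis KBc : forall u, KB u -> competitor u.
Hypothesis KB_convex : forall (t : R) u v, 0 <= t <= 1 -> KB u -> KB v ->
  KB (fun x => (1 - t) * u x + t * v x).
Hypothesis KB_ae : forall u v, KB u -> competitor v ->
  {ae mu, forall x, v x = u x} -> KB v.
Hypothesis KB_lim : forall (u_ : nat -> T -> R) u, (forall k, KB (u_ k)) ->
  competitor u -> (forall x, u_ ^~ x @ \oo --> u x) ->
  (forall e : R, 0 < e -> exists k, (modW (fun x => u x - u_ k x)%R <= e%:E)%E) -> KB u.


Lemma gap_bound (m r1 r2 : R) u v : (forall w, KB w -> m <= energy w) ->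
  KB u -> KB v -> energy u <= m + r1 -> energy v <= m + r2 ->
  (\int[mu2]_(z in pairs) (convex_gap G (Dz u z) (Dz v z) * kz z)%:E <=
   (Lam * r1 / 2 + Lam * r2 / 2)%:E)%E.
Proof.
move=> hm Ku Kv h1 h2; apply: (le_trans (gap_integral (KBc Ku) (KBc Kv))).
have h3 : m <= energy (fun x => (1 - 2^-1) * u x + 2^-1 * v x).
  by apply: hm; apply: KB_convex => //; lra.
rewrite lee_fin -!mulrA -mulrDr ler_pM2l//; lra.
Qed.

(** Coercivity and Fatou make the pointwise limit a competitor. As the gaps are small,
    [modular_limit] and the Poincare inequality upgrade the convergence to the modular one demanded
    by [KB_lim]; [energyB_le] and [bint_r] then compare the energy of the limit with that of
    [u_ k]. *)
Lemma minimizing_limit (m : R) (u_ : nat -> T -> R) (r : nat -> R) u :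
  (forall v, KB v -> m <= energy v) -> (forall k, KB (u_ k)) ->
  (forall k, energy (u_ k) <= m + r k) -> r @ \oo --> 0 ->
  (forall x, u_ ^~ x @ \oo --> u x) -> KB u /\ energy u <= m.
Proof.
move=> hm Ku hr r0 hu.
have cu_ k := KBc (Ku k); have mu_ k : measurable_fun setT (u_ k) by case: (cu_ k).
have mu' : measurable_fun setT u.
  exact: (measurable_fun_cvg (h := u_) (fun k => mu_ k) (fun x _ => hu x)).
have [C C0 hC] := coercive.
pose B := C * (m + 1 + C).
have near_r (e : R) : 0 < e -> \forall k \near \oo, r k <= e.
  move=> e0; move/cvgrPdist_lt: r0 => /(_ _ e0); apply: filterS => k.
  by rewrite sub0r normrN => h; rewrite (le_trans (ler_norm _))// ltW.
have hB : \forall k \near \oo, (modW (u_ k) <= B%:E)%E.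
  apply: filterS (near_r _ ltr01) => k rk; apply: (le_trans (hC _ (cu_ k))).
  rewrite lee_fin ler_pM2l// lerD2r (le_trans (hr k))// lerD2l//.
have LB : (modL u <= B%:E)%E.
  apply: (@fatou_bound _ _ _ _ _ (fun k x => GG (u_ k x))) => //.
  - by move=> k; exact: measurable_GG.
  - by move=> k x; exact: GG_ge0.
  - by move=> x _; exact: GG_cvg.
  - apply: filterS hB => k; apply: le_trans; rewrite modWE leeDl//; exact: modD_ge0.
have DB : (modD u <= B%:E)%E.
  apply: (@fatou_bound _ _ _ _ _ (fun k z => GG (Dz (u_ k) z) * kz z)) => //.
  - by move=> k; exact: measurable_GD.
  - by move=> k z; exact: GD_ge0.
  - by move=> z _; apply: cvgM; [apply: GG_cvg; exact: Dz_cvg|exact: cvg_cst].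
  - apply: filterS hB => k; apply: le_trans; rewrite modWE leeDr//; exact: modL_ge0.
have Doo : (modD u < +oo)%E by apply: le_lt_trans DB _; rewrite ltry.
have cu : competitor u.
  split => //; last by rewrite modWE lte_add_pinfty//; apply: le_lt_trans LB _; rewrite ltry.
  move=> y nOy; have := hu y; have -> : u_^~ y = (fun=> th y).
    by apply/funext => k; case: (cu_ k) => _ h _; exact: h.
  by move=> /(@cvg_unique _ _ _ _ _ _ (@cvg_cst _ (th y) _ _ _)) ->.
have [_ _ uoo] := cu.
have r20 : (fun k => Lam * r k / 2) @ \oo --> (0 : R).
  rewrite -[X in _ --> X](mul0r (2^-1 : R)); apply: cvgM; last exact: cvg_cst.
  by rewrite -[X in _ --> X](mulr0 Lam); apply: cvgM; [exact: cvg_cst|exact: r0].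
have Dlim := modular_limit mu_ hu Doo r20 (fun k l => gap_bound hm (Ku k) (Ku l) (hr k) (hr l)).
have [CP CP0 poin] := poincare.
have adm k : admissible (fun x => u x - u_ k x) by exact: competitor_sub.
have Wlim (e : R) : 0 < e -> \forall k \near \oo, (modW (fun x => u x - u_ k x)%R <= e%:E)%E.
  move=> e0; have CP1 : 0 < CP + 1 by rewrite addr_gt0.
  apply: filterS (Dlim _ (divr_gt0 e0 CP1)) => k hD.
  have [mh h0 hoo] := adm k; have := poin _ mh h0; have [a [b [aE bE a0 b0]]] := eq_real hoo.
  rewrite modWE; move: hD; rewrite aE bE -!EFinM -EFinD !lee_fin ler_pdivlMr// => h1 h2.
  by apply: le_trans h1; rewrite mulrDr mulr1 lerD2r mulrC.
have Kuu : KB u.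
  apply: (KB_lim Ku cu hu) => e /Wlim [N _ hN]; exists N; apply: hN => /=; exact: leqnn.
split => //; apply/ler_addgt0Pr => e e0.
have [lw [dw [lE dE lw0 dw0]]] := eq_real uoo.
have W0 : 0 < lw + dw + 1 by rewrite ltr_wpDl// addr_ge0.
(* One third of [e] goes to [r k], one to the term in [modW u + 1], whose coefficient is fixed
   before [k], and one to the term in the modular of [u - u_ k]. *)
have e10 : 0 < e / 3 / (Lam * (lw + dw + 1)) by rewrite !divr_gt0// mulr_gt0.
have [C1 C10 hC1] := bint_r e10.
have e20 : 0 < e / 3 / (Lam * (C1 + 1)) by rewrite !divr_gt0// mulr_gt0// ltr_wpDl.
have e30 : 0 < e / 3 by rewrite divr_gt0.
have [k [rk Wk]] : exists k, r k <= e / 3 /\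
    (modW (fun x => u x - u_ k x)%R <= (e / 3 / (Lam * (C1 + 1)))%:E)%E.
  have [N _ hN] : \forall k \near \oo, r k <= e / 3 /\
      (modW (fun x => u x - u_ k x)%R <= (e / 3 / (Lam * (C1 + 1)))%:E)%E.
    by apply: filterS2 (near_r _ e30) (Wlim _ e20) => k.
  by exists N; apply: hN => /=; exact: leqnn.
have [mh h0 hoo] := adm k; have [_ hth _] := cu.
have hb := hC1 _ _ mu' mh hth h0 uoo hoo.
have [a [b [aE bE a0 b0]]] := eq_real hoo.
move: hb Wk; rewrite !modWE aE bE lE dE => hb.
rewrite -EFinD lee_fin => Wk.
have := energyB_le cu (cu_ k).
move=> /le_trans/(_ (lee_wpmul2l _ hb)); rewrite lee_fin (ltW L0) => /(_ isT) hJ.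
have {}hJ : energy u - energy (u_ k) <= Lam * (C1 * (a + b) +
    e / 3 / (Lam * (lw + dw + 1)) * (lw + dw + 1)) by rewrite -lee_fin; exact: hJ.
have t1 : Lam * (e / 3 / (Lam * (lw + dw + 1)) * (lw + dw + 1)) = e / 3.
  by field; rewrite !gt_eqF.
have t2 : Lam * (C1 * (a + b)) <= e / 3.
  have C11 : 0 < C1 + 1 by rewrite ltr_wpDl.
  have -> : e / 3 = Lam * ((C1 + 1) * (e / 3 / (Lam * (C1 + 1)))) by field; rewrite !gt_eqF.
  rewrite ler_pM2l//; apply: (@le_trans _ _ ((C1 + 1) * (a + b))); last by rewrite ler_pM2l.
  by rewrite ler_wpM2r ?addr_ge0// lerDl.
have := hr k; rewrite mulrDr t1 in hJ; lra.
Qed.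

Hypothesis KB_ne : exists u, KB u.

(** Where [|v x| > t >= 1] one has [t <= |v x| <= |v x| ^ p <= G |v x|], the last step by
    [G 1 = 1]. *)
Lemma chebyshev_modL v (t : R) : measurable_fun setT v -> 1 <= t ->
  (t%:E * mu (Om `&` [set x | (t < `|v x|)%R]) <= modL v)%E.
Proof.
move=> mv t1; have mS : measurable (Om `&` [set x | t < `|v x|]).
  apply: measurableI => //; apply: measurable_lt_set => //; exact: measurable_normf.
have -> : (t%:E * mu (Om `&` [set x | (t < `|v x|)%R]) =
    \int[mu]_(x in Om) (t * \1_(Om `&` [set x | t < `|v x|]) x)%:E)%E.
  rewrite integralZ_EFin//; last by apply: (le_trans ler01).
  by rewrite integral_indic// setIAC setIid.
  have t0 := le_trans ler01 t1.
apply: le_integral_EFin => //.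
- by apply: measurable_funM => //; exact: measurable_indic.
- exact: measurable_GG.
- by move=> x; rewrite mulr_ge0// (le_trans ler01).
move=> x _; rewrite indicE; have [|_] := boolP (_ \in _); last by rewrite mulr0 GG_ge0.
move=> /set_mem[_ /= tv]; rewrite mulr1.
have := young_powR_p Y ltr01 (le_trans t1 (ltW tv)).
rewrite (yp_G1 Y) mul1r powR1 mulr1 => h; apply: le_trans h.
apply: (le_trans (ltW tv)); rewrite -{1}(powRr1 (normr_ge0 (v x))) ler_powR//.
  exact: le_trans t1 (ltW tv).
exact: ltW (yp_p1 Y).
Qed.

Lemma inf_energy : exists m : R, (forall v, KB v -> m <= energy v) /\
  forall e, 0 < e -> exists2 v, KB v & energy v < m + e.
Proof.
have [C C0 hC] := coercive.
have hl : has_inf [set energy u | u in [set u | KB u]].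
  split; first by have [u Ku] := KB_ne; exists (energy u), u.
  exists (- C) => _ [u Ku <-]; have := hC _ (KBc Ku).
  move=> /(le_trans (modW_ge0 _)); rewrite lee_fin pmulr_rge0//; lra.
exists (inf [set energy u | u in [set u | KB u]]); split.
  by move=> v Kv; apply: ge_inf; [exact: hl.2|exists v].
by move=> e e0; have [_ [v Kv <-] h] := inf_adherent e0 hl; exists v.
Qed.

(* On [Om x A] the exterior datum cancels in [Dz u - Dz v], so the gap of two
   almost minimizers bounds the measure of the set where they differ. *)
Lemma close_minimizers (A : set T) (M d : R) : measurable A -> A `<=` Om' `\` Om ->
  (0 < mu A < +oo)%E -> 0 < d -> 1 <= M -> (forall y, A y -> `|th y| <= M) ->
  (forall x y, Om x -> A y -> d <= enorm (x - y) <= M) ->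
  exists2 C : R, 0 < C & forall (m t e : R), 0 < t -> 0 < e ->
  (forall v, KB v -> m <= energy v) -> exists2 dl : R, 0 < dl &
  forall u v r1 r2, KB u -> KB v -> energy u <= m + r1 -> energy v <= m + r2 ->
  (mu (Om `&` [set x | (`|u x| <= t)%R] `&` [set x | (`|v x| <= t)%R] `&`
       [set x | (e <= `|v x - u x|)%R]) <= (C * ((r1 + r2) / dl))%:E)%E.
Proof.
move=> mA AO /andP[A0 Aoo] d0 M1 thM hM.
have M0 : 0 < M := lt_le_trans ltr01 M1.
pose a := fine (mu A).
have aE : mu A = a%:E by rewrite fineK// ge0_fin_numE.
have a0 : 0 < a by rewrite -lte_fin -aE.
exists (Lam * M ^+ n / 2 / a); first by rewrite !divr_gt0// mulr_gt0// exprn_gt0.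
move=> m t e t0 e0 hm.
have e'0 : 0 < e * M `^ (- s) by rewrite mulr_gt0// powR_gt0.
(* Both quotients are at most [(t + M) * d ^ (- s)], from [|u x| <= t], [|th y| <= M] and
   [enorm (x - y) >= d]; they differ by at least [e * M ^ (- s)], from [enorm (x - y) <= M]. *)
have [dl dl0 hdl] := @convex_gap_bounded_below _ _ _ _ _ Y ((t + M) * d `^ (- s)) _ e'0.
exists dl => // u v r1 r2 Ku Kv hu hv; set S := _ `&` _.
have [mu' uth _] := KBc Ku; have [mv vth _] := KBc Kv.
have mS : measurable S.
  apply: measurableI; last by apply: measurable_le_set => //; apply: measurable_normf; exact: measurable_funB.
  apply: measurableI; last by apply: measurable_le_set => //; exact: measurable_normf.
  apply: measurableI => //; by apply: measurable_le_set => //; exact: measurable_normf.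
pose c := dl * (M ^+ n)^-1.
have c0 : 0 < c by rewrite mulr_gt0// invr_gt0 exprn_gt0.
have key : (mu A * \int[mu]_(x in Om) (c * \1_S x)%:E <=
    \int[mu2]_(z in pairs) (convex_gap G (Dz u z) (Dz v z) * kz z)%:E)%E.
  apply: product_lower_bound => //.
  - by move=> y /AO[].
  - by apply: measurable_funM => //; exact: measurable_indic.
  - by apply: measurable_funM; [exact: measurable_gap|exact: measurable_kz].
  - by move=> x; rewrite mulr_ge0// ltW.
  - by move=> z; rewrite mulr_ge0 ?kz_ge0// (convex_gap_ge0 Y).
  move=> x y Ox Ay; rewrite indicE; have [xS|_] := boolP (x \in S); last first.
    by rewrite mulr0 mulr_ge0 ?kz_ge0// (convex_gap_ge0 Y).
  move: xS => /set_mem [[[_ /= ut] /= vt] /= ev]; have [_ nOy] := AO y Ay.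
  have /andP[dr rM] := hM x y Ox Ay; have r0 := lt_le_trans d0 dr.
  have inv1 : (enorm (x - y) `^ s)^-1 <= d `^ (- s).
    by rewrite -powRN; apply: powRN_le => //; exact: ltW.
  have inv2 : M `^ (- s) <= (enorm (x - y) `^ s)^-1.
    by rewrite -powRN; apply: powRN_le => //; exact: ltW.
  have i0 : 0 <= (enorm (x - y) `^ s)^-1 by rewrite invr_ge0 powR_ge0.
  have bnd w : `|w x| <= t -> w y = th y -> `|Ds s w x y| <= (t + M) * d `^ (- s).
    move=> wt wy; rewrite /Ds normrM (ger0_norm i0); apply: ler_pM => //.
    by rewrite (le_trans (ler_normB _ _))// lerD// wy thM.
  rewrite mulr1 /c !Dz_row kz_row /kern; apply: ler_pM.
  - exact: ltW.
  - by rewrite invr_ge0 exprn_ge0// ltW.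
  - apply: hdl; [apply: bnd => //; exact: uth|apply: bnd => //; exact: vth|].
    rewrite /Ds (uth y nOy) (vth y nOy) -mulrBl normrM (ger0_norm i0).
    rewrite (_ : _ - _ = u x - v x); last by ring.
    by apply: ler_pM; [exact: ltW|exact: powR_ge0|rewrite distrC|].
  - rewrite lef_pV2 ?posrE ?exprn_gt0//.
    by rewrite lerXn2r ?nnegrE ?(ltW r0) ?(ltW M0).
have SO : S `<=` Om by move=> x [[[]]].
move: key => /le_trans/(_ (gap_bound hm Ku Kv hu hv)).
rewrite integralZ_EFin//; last exact: ltW.
rewrite integral_indic// (setIidl SO) aE muleA -EFinM => key.
have -> : ((Lam * M ^+ n / 2 / a * ((r1 + r2) / dl))%:E =
    (a * c)^-1%:E * (Lam * r1 / 2 + Lam * r2 / 2)%:E)%E.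
  rewrite -EFinM; congr EFin; rewrite /c; field.
  by rewrite !gt_eqF// exprn_gt0.
by rewrite lee_pdivlMl ?(mulr_gt0 a0 c0)//; exact: key.
Qed.



Lemma exists_minimizer : exists2 u, KB u & forall v, KB v -> energy u <= energy v.
Proof.
have [m [hm hadh]] := inf_energy.
(* If [Om] is empty, every member of the class equals [th], and any of them is a minimizer. *)
have [Om0|/set0P/(outer_set)[A [M [d [mA AO A0 d0 [M1 thM hM]]]]]] := eqVneq Om set0.
  have [u Ku] := KB_ne; exists u => // v Kv.
  suff -> : u = v by [].
  have [_ hu _] := KBc Ku; have [_ hv _] := KBc Kv; apply/funext => x.
  by rewrite hu ?hv// Om0.
have [C C0 hC] := close_minimizers mA AO A0 d0 M1 thM hM.
(* Truncation levels and step tolerances: [t k] makes the Chebyshev bounds summable, [e k] the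
   increments. *)
pose t k : R := 2 ^+ k.+1; pose e k : R := 2^-1 ^+ k.
have t1 k : 1 <= t k by rewrite exprn_ege1// ler1n.
have t0 k : 0 < t k by exact: lt_le_trans (t1 k).
have e0 k : 0 < e k by rewrite exprn_gt0// invr_gt0.
pose S u v k := Om `&` [set x | `|u x| <= t k] `&` [set x | `|v x| <= t k] `&`
       [set x | e k <= `|v x - u x|].
have /choice[dl hdl] : forall k, exists dl : R, 0 < dl /\ forall u v r1 r2,
    KB u -> KB v -> energy u <= m + r1 -> energy v <= m + r2 ->
    (mu (S u v k) <= (C * ((r1 + r2) / dl))%:E)%E.
  by move=> k; have [dl dl0 h] := hC m _ _ (t0 k) (e0 k) hm; exists dl.
have dl0 k : 0 < dl k by case: (hdl k).
(* [u_ k] and [u_ k.+1] are compared with the gap constant [dl k], which has to beat both [r k] and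
   [r k.+1]; therefore [r k] involves [dl k] and [dl k.-1], which coincide at [k = 0]. *)
pose r k := e k * Num.min (Num.min 1 (dl k)) (dl k.-1).
have r0 k : 0 < r k by rewrite mulr_gt0// !lt_min ltr01 !dl0.
have r1 k : r k <= e k by rewrite ger_pMr// !ge_min lexx.
have r2 k : r k <= e k * dl k by rewrite ler_pM2l// !ge_min lexx orbT.
have r3 k : r k.+1 <= e k * dl k.
  apply: (@le_trans _ _ (e k.+1 * dl k)); first by rewrite ler_pM2l// /= !ge_min lexx !orbT.
  by rewrite ler_pM2r// /e exprS ler_piMl// invf_le1// ler1n.
have /choice[u_ hu_] : forall k, exists v, KB v /\ energy v <= m + r k.
  by move=> k; have [v Kv hv] := hadh _ (r0 k); exists v; split => //; exact: ltW.
have Ku k : KB (u_ k) by case: (hu_ k).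
have mu_ k : measurable_fun setT (u_ k) by case: (KBc (Ku k)).
have uth k : forall y, ~ Om y -> u_ k y = th y by case: (KBc (Ku k)).
have [B [B0 hB]] : exists B : R, 0 <= B /\ forall k, (modL (u_ k) <= B%:E)%E.
  have [C' C'0 hC'] := coercive.
  have bd k : (modW (u_ k) <= (C' * (m + 1 + C'))%:E)%E.
    apply: (le_trans (hC' _ (KBc (Ku k)))); rewrite lee_fin ler_pM2l// lerD2r.
    apply: (le_trans (hu_ k).2); rewrite lerD2l (le_trans (r1 k))// /e.
    by rewrite exprn_ile1// ?invr_ge0// invf_le1// ler1n.
  exists (C' * (m + 1 + C')); split.
    by have := le_trans (modW_ge0 _) (bd 0%N); rewrite lee_fin.
  move=> k; apply: le_trans (bd k); rewrite modWE leeDl//; exact: modD_ge0.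
pose Sk k := S (u_ k) (u_ k.+1) k.
pose Hk i k := Om `&` [set x | t k < `|u_ i x|].
(* Bad set of step [k]: one of the two functions exceeds the truncation level, or they differ by at
   least [e k]. Its measure is of order [2 ^ (- k)], as Borel-Cantelli requires. *)
pose F k := Sk k `|` (Hk k k `|` Hk k.+1 k).
have mHk i k : measurable (Hk i k).
  by apply: measurableI => //; apply: measurable_lt_set => //; exact: measurable_normf.
have mSk k : measurable (Sk k).
  apply: measurableI; last by apply: measurable_le_set => //; apply: measurable_normf; exact: measurable_funB.
  apply: measurableI; last by apply: measurable_le_set => //; exact: measurable_normf.
  by apply: measurableI => //; apply: measurable_le_set => //; exact: measurable_normf.
have mF k : measurable (F k) by apply: measurableU => //; exact: measurableU.
have muH i k : (mu (Hk i k) <= (B * e k)%:E)%E.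
  have := le_trans (chebyshev_modL (mu_ i) (t1 k)) (hB i).
  rewrite -[mu _]/(mu (Hk i k)) -lee_pdivlMl// -EFinM => /le_trans; apply.
  rewrite lee_fin mulrC ler_wpM2l// /t /e -exprVn exprS ler_piMl//.
  by rewrite invf_le1// ler1n.
have muS k : (mu (Sk k) <= (2 * C * e k)%:E)%E.
  have [_ h] := hdl k; apply: le_trans (h _ _ _ _ (Ku k) (Ku k.+1) (hu_ k).2 (hu_ k.+1).2) _.
  rewrite lee_fin (mulrC 2) -mulrA ler_pM2l// ler_pdivrMr//.
  by rewrite -mulrA mulr2n mulrDl mul1r lerD.
pose cc := 2 * (2 * C + B + B).
have muF k : (mu (F k) <= (cc / (2 ^ k.+1)%:R)%:E)%E.
  have U1 := measureU2 mu (mSk k) (measurableU _ _ (mHk k k) (mHk k.+1 k)).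
  have U2 := measureU2 mu (mHk k k) (mHk k.+1 k).
  have U3 := le_trans U2 (leeD (muH k k) (muH k.+1 k)).
  apply: (le_trans (le_trans U1 (leeD (muS k) U3))).
  rewrite -!EFinD lee_fin le_eqVlt; apply/orP; left; apply/eqP.
  rewrite /cc /e natrX exprS exprVn; field.
  by rewrite gt_eqF// exprn_gt0.
pose N := lim_sup_set F.
have mN : measurable N.
  by apply: bigcap_measurable => // k _; exact: bigcup_measurable.
have muN : mu N = 0%E.
  apply: lim_sup_set_cvg0 => //; apply: (@le_lt_trans _ _ cc%:E); last by rewrite ltry.
  apply: le_trans (epsilon_trick0 xpredT _); last by rewrite /cc mulr_ge0// !addr_ge0// mulr_ge0// ltW.
  by apply: lee_nneseries => k *; [exact: measure_ge0|exact: muF].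
have cvg_u x : ~ N x -> cvgn (u_^~ x).
  move=> nNx; have [Ox|nOx] := pselect (Om x); last first.
    by rewrite (_ : u_^~ x = fun=> th x); [exact: is_cvg_cst|apply/funext => k; exact: uth].
  have [j hj] : exists j, forall k, (j <= k)%N -> ~ F k x.
    apply: contrapT => /forallNP h; apply: nNx => j _.
    have /existsNP[k /not_implyP[jk /contrapT Fk]] := h j.
    by exists k.
  apply: cvg_of_geometric_steps; exists j => // k /= jk; have := hj _ jk.
  rewrite leNgt => hF; apply/negP => hlt; apply: hF.
  have [h1|h1] := ltP (t k) `|u_ k x|; first by right; left.
  have [h2|h2] := ltP (t k) `|u_ k.+1 x|; first by right; right.
  by left; do !split => //; exact: ltW.
(* The sequence is reset to [th] on the null set [N], so that it converges at every point; [KB_ae]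
   keeps it in the class. *)
pose v_ k x := u_ k x * (1 - \1_N x) + th x * \1_N x.
have v_in k x : N x -> v_ k x = th x.
  by move=> Nx; rewrite /v_ indicE mem_set// subrr mulr0 add0r mulr1.
have v_out k x : ~ N x -> v_ k x = u_ k x.
  by move=> Nx; rewrite /v_ indicE memNset// subr0 mulr0 addr0 mulr1.
have mv k : measurable_fun setT (v_ k).
  have m1 : measurable_fun setT (\1_N : T -> R) by exact: measurable_indic.
  apply: measurable_funD; apply: measurable_funM => //; last exact: (es_th E).
  exact: measurable_funB.
have vu k : {ae mu, forall x, v_ k x = u_ k x}.
  exists N; split => // x /= h; apply: contrapT => nN; apply: h; exact: v_out.
have cv k : competitor (v_ k).
  split => //.
  - by move=> y nOy; rewrite /v_ uth//; ring.
  - by rewrite (modW_ae (mv k) (mu_ k) (vu k)); case: (KBc (Ku k)).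
have Kv k : KB (v_ k) by exact: KB_ae (Ku k) (cv k) (vu k).
have ev k : energy (v_ k) <= m + r k.
  by rewrite (energy_ae (mv k) (mu_ k) (vu k)); case: (hu_ k).
have rlim : r @ \oo --> (0 : R).
  apply: (@squeeze_cvgr _ _ _ _ (fun=> 0) e).
  - by apply: nearW => k; rewrite (ltW (r0 k)) r1.
  - exact: cvg_cst.
  - have h : `|2^-1 : R| < 1 by rewrite ger0_norm ?invr_ge0// invf_lt1// ltr1n.
    rewrite (_ : e = geometric 1 2^-1); first exact: cvg_geometric.
    by apply/funext => k; rewrite /e /geometric /= mul1r.
have hlim x : v_^~ x @ \oo --> limn (v_^~ x).
  have [Nx|nNx] := pselect (N x).
    by rewrite (_ : v_^~ x = fun=> th x); [exact: is_cvg_cst|apply/funext => k; exact: v_in].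
  rewrite (_ : v_^~ x = u_^~ x); first exact: cvg_u.
  by apply/funext => k; exact: v_out.
have [KBu hu] := minimizing_limit hm Kv ev rlim hlim.
by exists (fun x => limn (v_^~ x)) => // v /hm; exact: le_trans.
Qed.


End Minimization.

(** * First variation and uniqueness *)

Definition first_var u w : R := RI (fun z => gg (Dz u z) * Dz w z * wz z).

(** The derivative along [t = 1 / (k + 1)], as a sequence ready for dominated convergence. *)
Lemma even_ext_quotient (a b : R) :
  (fun k => (GG (a + k.+1%:R^-1 * b) - GG a) * k.+1%:R) @ \oo --> gg a * b.
Proof.
have [->|b0] := eqVneq b 0.
  rewrite mulr0 (_ : (fun k : nat => _) = fun=> 0); first exact: cvg_cst.
  by apply/funext => k; rewrite mulr0 addr0 subrr mul0r.
have [dG dE] := is_derive_even_ext Y a.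
have h : (fun h : R => h^-1 *: (GG (h *: 1 + a) - GG a)) x @[x --> 0^'] --> gg a.
  by rewrite -dE; exact: dG.
have ht : (fun k : nat => k.+1%:R^-1 * b) @ \oo --> (0 : R)^'.
  have c0 : (fun k : nat => k.+1%:R^-1 * b) @ \oo --> (0 : R).
    by rewrite -[X in _ --> X](mul0r b); apply: cvgM; [exact: cvg_harmonic|exact: cvg_cst].
  move=> P hP; have c1 : \forall k \near \oo,
    k.+1%:R^-1 * b != 0 -> P (k.+1%:R^-1 * b) by exact: c0 _ hP.
  change (\forall k \near \oo, P (k.+1%:R^-1 * b)).
  by apply: filterS c1 => k; apply; rewrite mulf_neq0// invr_eq0 pnatr_eq0.
have {}h := cvg_comp _ _ ht h.
suff <- : (fun k : nat => (k.+1%:R^-1 * b)^-1 *: (GG (k.+1%:R^-1 * b *: 1 + a) - GG a) * b) =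
    (fun k => (GG (a + k.+1%:R^-1 * b) - GG a) * k.+1%:R).
  by apply: cvgM; [exact: h|exact: cvg_cst].
apply/funext => k; rewrite /GRing.scale /= mulr1 [_ + a]addrC; field.
by rewrite b0 addrC natr1 pnatr_eq0.
Qed.

Lemma measurable_first_var u w : measurable_fun setT u -> measurable_fun setT w ->
  measurable_fun setT (fun z => gg (Dz u z) * Dz w z * wz z).
Proof.
move=> mu' mw; apply: measurable_funM; last exact: measurable_wz.
apply: measurable_funM; last exact: measurable_Dz.
exact: measurableT_comp (measurable_odd_ext Y) (measurable_Dz s mu').
Qed.

Lemma first_var_integrable u w : competitor u -> admissible w ->
  intg (fun z => gg (Dz u z) * Dz w z * wz z).
Proof.
move=> cu aw; have [mu' _ _] := cu; have [mw _ _] := aw.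
apply: (dominated_intg _ (intgZ Lam (bint_integrable cu aw))); first exact: measurable_first_var.
move=> z; have [w0 w1 _] := wz_bounds z.
rewrite normrM (ger0_norm w0) normrM (norm_odd_ext Y) [leRHS]mulrCA.
by rewrite ler_wpM2l// mulr_ge0// (young_g_ge0 Y).
Qed.

Lemma competitor_add u w : competitor u -> admissible w ->
  competitor (fun x => u x + w x).
Proof.
move=> [mu' hu uoo] [mw hw woo]; split; first exact: measurable_funD.
- by move=> y nOy; rewrite hu// hw// addr0.
- apply: le_lt_trans (modW_add mu' mw) _.
  by apply: lte_mul_pinfty; [rewrite lee_fin powR_ge0|by []|exact: lte_add_pinfty].
Qed.

(** The energy quotients along [t = 1 / (k + 1)] are nonnegative and converge by dominated
    convergence. The majorant is uniform in [k] because [Dz (v k) z] is a convex combination, so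
    that [g] of its absolute value is at most the sum of the values at the two ends. *)
Lemma first_variation u w : competitor u -> admissible w ->
  (forall t, 0 < t <= 1 -> energy u <= energy (fun x => (1 - t) * u x + t * (u x + w x))) ->
  0 <= first_var u w.
Proof.
move=> cu aw hmin; have [mu' _ _] := cu; have [mw _ _] := aw.
have cuw := competitor_add cu aw; have [muw _ _] := cuw.
pose t k : R := k.+1%:R^-1.
have t01 k : 0 < t k <= 1 by rewrite invr_gt0 ltr0n invf_le1// ler1n.
pose v k x := (1 - t k) * u x + t k * (u x + w x).
have cv k : competitor (v k).
  by apply: competitor_convex => //; have /andP[tk0 tk1] := t01 k; rewrite (ltW tk0).
have Dv k z : Dz (v k) z = Dz u z + t k * Dz w z by rewrite /v DzD !DzZ DzD; ring.
pose f k z := (GG (Dz (v k) z) - GG (Dz u z)) * wz z * k.+1%:R.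
have if_ k : intg (f k).
  rewrite (_ : f k = fun z => k.+1%:R * ((GG (Dz (v k) z) - GG (Dz u z)) * wz z)).
    by apply: intgZ; exact: energy_diff_integrable.
  by apply/funext => z; rewrite /f mulrC.
have f0 k : (0 <= \int[mu2]_z (f k z)%:E)%E.
  rewrite -[leRHS]fineK; last by apply: integrable_fin_num => //; exact: if_.
  rewrite lee_fin -[leRHS]/(RI (f k)).
  rewrite (_ : f k = fun z => k.+1%:R * ((GG (Dz (v k) z) - GG (Dz u z)) * wz z)); last first.
    by apply/funext => z; rewrite /f mulrC.
  rewrite RintegralZl//; last exact: energy_diff_integrable.
  rewrite -(energyB)// mulr_ge0// subr_ge0; exact: hmin.
pose F z := Lam * (2 * (g `|Dz u z| * `|Dz w z| * kz z) +
   g `|Dz (fun x => u x + w x) z| * `|Dz w z| * kz z).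
have iF : intg F.
  apply: intgZ; apply: intgD; first apply: intgZ; exact: bint_integrable.
have := @dominated_convergence _ _ _ mu2 _ measurableT (fun k z => (f k z)%:E)
  (fun z => (gg (Dz u z) * Dz w z * wz z)%:E) (EFin \o F).
case.
- by move=> k; have /integrableP[] := if_ k.
- by apply/measurable_EFinP; exact: measurable_first_var.
- apply: aeW => z _; apply: cvg_EFin; first exact: nearW.
  rewrite /f; under eq_fun do rewrite Dv mulrAC.
  by apply: cvgM; [exact: even_ext_quotient|exact: cvg_cst].
- exact: iF.
- apply: aeW => z k _; rewrite /= lee_fin.
  have [w0 w1 _] := wz_bounds z.
  have /andP[tk0 tk1] := t01 k.
  rewrite /f normrM (@ger0_norm _ (k.+1%:R))// normrM (ger0_norm w0).
  have h1 := norm_even_ext_sub (Dz (v k) z) (Dz u z).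
  have h2 : `|Dz (v k) z - Dz u z| * k.+1%:R = `|Dz w z|.
    rewrite Dv addrC addKr normrM (gtr0_norm tk0) mulrAC /t mulVf ?mul1r// pnatr_eq0.
  have h3 : g `|Dz (v k) z| <= g `|Dz u z| + g `|Dz (fun x => u x + w x) z|.
    have c1 : `|Dz (v k) z| <= (1 - t k) * `|Dz u z| + t k * `|Dz (fun x => u x + w x) z|.
      rewrite Dv DzD [X in `|X| <= _](_ : _ = (1 - t k) * Dz u z + t k * (Dz u z + Dz w z)); last by ring.
      rewrite (le_trans (ler_normD _ _))// !normrM (gtr0_norm tk0).
      by rewrite ger0_norm// subr_ge0.
    have ga : 0 <= g `|Dz u z| by exact: (young_g_ge0 Y).
    have gb : 0 <= g `|Dz (fun x => u x + w x) z| by exact: (young_g_ge0 Y).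
    have [h|h] := leP `|Dz u z| `|Dz (fun x => u x + w x) z|.
      apply: (@le_trans _ _ (g `|Dz (fun x => u x + w x) z|)); last by rewrite lerDr.
      apply: (young_g_le Y) => //; apply: (le_trans c1); nra.
    apply: (@le_trans _ _ (g `|Dz u z|)); last by rewrite lerDl.
    apply: (young_g_le Y) => //; apply: (le_trans c1); nra.
  apply: (@le_trans _ _ ((g `|Dz (v k) z| + g `|Dz u z|) * `|Dz (v k) z - Dz u z| * wz z * k.+1%:R)).
    by rewrite ler_wpM2r// ler_wpM2r.
  rewrite mulrAC -(mulrA _ _ k.+1%:R) h2.
  apply: (@le_trans _ _ ((g `|Dz u z| + g `|Dz (fun x => u x + w x) z| + g `|Dz u z|) * `|Dz w z| * (Lam * kz z))).
    by apply: ler_pM => //; [rewrite mulr_ge0// addr_ge0// (young_g_ge0 Y)|rewrite ler_wpM2r// lerD2r].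
  by rewrite /F le_eqVlt; apply/orP; left; apply/eqP; ring.
move=> _ _ hlim; rewrite /first_var /Rintegral; apply: fine_ge0.
rewrite -(cvg_lim _ hlim)//; apply: lime_ge; first by apply/cvg_ex; eexists; exact: hlim.
by apply: nearW => k; exact: f0.
Qed.

(** Each function is tested with the other one; the sum of the two inequalities is minus the
    integral of the nonnegative density [f], which must vanish a.e. Equal quotients give
    [modD (u - v) = 0], and the Poincare inequality passes to [modL]. *)
Lemma uniqueness u v : competitor u -> competitor v ->
  0 <= first_var u (fun x => v x - u x) -> 0 <= first_var v (fun x => u x - v x) ->
  {ae mu, forall x, v x = u x}.
Proof.
move=> cu cv; have auv := competitor_sub cu cv; have avu := competitor_sub cv cu.
have i1 := first_var_integrable cu avu; have i2 := first_var_integrable cv auv.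
have [mu' uth _] := cu; have [mv vth _] := cv; have [md d0 _] := auv.
move=> h1 h2; have := addr_ge0 h1 h2; rewrite /first_var -RintegralD//.
pose f z := (gg (Dz u z) - gg (Dz v z)) * (Dz u z - Dz v z) * wz z.
have f0 z : 0 <= f z.
  have [w0 _ _] := wz_bounds z; rewrite mulr_ge0//; exact: (odd_ext_mono Y).
have ig : intg f.
  rewrite (_ : f = fun z => (-1) * (gg (Dz u z) * Dz (fun x => v x - u x) z * wz z +
      gg (Dz v z) * Dz (fun x => u x - v x) z * wz z)).
    by apply: intgZ; exact: intgD.
  by apply/funext => z; rewrite /f !DzB; ring.
rewrite (_ : (fun z => _ + _) = fun z => (-1) * f z); last first.
  by apply/funext => z; rewrite /f !DzB; ring.
rewrite RintegralZl// mulN1r oppr_ge0 => fle.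
have fin : (\int[mu2]_z (f z)%:E = 0)%E.
  rewrite -[LHS]fineK; last by apply: integrable_fin_num => //; exact: ig.
  congr EFin; apply/eqP; rewrite eq_le fle/=.
  by apply: fine_ge0; apply: integral_ge0 => z _; rewrite lee_fin.
have aef : {ae mu2, forall z, f z = 0}.
  have mf : measurable_fun setT (EFin \o f) by have /integrableP[] := ig.
  have := (ae_eq_integral_abs mu2 measurableT mf).1.
  rewrite (eq_integral (fun z => (f z)%:E)); last by move=> z _ /=; rewrite ger0_norm.
  by move=> /(_ fin); apply: filterS => z /(_ I) /= [].
have D0 : modD (fun x => u x - v x) = 0%E.
  rewrite -(integral0 mu2 pairs); apply: (@integral_ae_eq_EFin _ _ _ _ _ _ (fun=> 0)) => //.
    exact: measurable_GD.
  apply: filterS aef => z; rewrite /f DzB.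
  (* [kz z] vanishes on the diagonal only, where the inverse of 0 is 0; elsewhere [wz z] is
     positive, and a vanishing density forces equal quotients. *)
  have [k0|k0] := eqVneq (kz z) 0; first by rewrite k0 mulr0.
  have kp : 0 < kz z by rewrite lt0r k0 kz_ge0.
  have [_ _ w1] := wz_bounds z.
  have wp : 0 < wz z by apply: lt_le_trans w1; rewrite mulr_gt0// invr_gt0.
  have [->|ne] := eqVneq (Dz u z) (Dz v z); first by move=> _; rewrite subrr (even_ext0 Y) mul0r.
  by move=> /eqP; rewrite gt_eqF// mulr_gt0//; exact: (odd_ext_mono_lt Y).
have [C C0 poin] := poincare.
have L00 : modL (fun x => u x - v x) = 0%E.
  apply/eqP; rewrite eq_le modL_ge0 andbT.
  by have := poin _ md d0; rewrite D0 mule0.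
have mG : measurable_fun Om (fun x => (GG (u x - v x))%:E).
  by apply: measurable_funTS; apply/measurable_EFinP; exact: measurable_GG.
have := (ae_eq_integral_abs mu mOmE mG).1.
rewrite (eq_integral (fun x => (GG (u x - v x))%:E)); last first.
  by move=> x _ /=; rewrite ger0_norm// GG_ge0.
move=> /(_ L00); apply: filterS => x h.
have [Ox|nOx] := pselect (Om x); last by rewrite uth// vth.
apply/eqP; apply: contrapT => /negP ne; have := h Ox => -[] /eqP.
by rewrite /even_ext gt_eqF// (young_G_gt0 Y)// normr_gt0 subr_eq0 eq_sym.
Qed.


Hypothesis s1 : s < 1.


(** With [r = enorm (x - y)], the Lipschitz bound makes the quotient at most [L * r ^ (1 - s)].
    Scaling bounds [G] of it by a multiple of [r ^ (1 - s)], and [r ^ (1 - s - n)] is integrable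
    over bounded regions because [s < 1]. *)
Lemma modW_Cc_inf f : Cc_inf Om f -> (modW f < +oo)%E.
Proof.
move=> cf; have [L L_ge0 hL] := Cc_inf_lipschitz cf.
have mf := Cc_inf_measurable cf.
have [B B0 hB] : exists2 B : R, 0 <= B & forall x, `|f x| <= B.
  have [_ [A [cA _ A0]]] := cf.
  exact: compact_supp_bounded cA (Cc_inf_continuous cf) A0.
rewrite modWE; apply: lte_add_pinfty.
  apply: (@le_lt_trans _ _ (\int[mu]_(x in Om) (G B)%:E)%E).
    apply: le_integral_EFin => //; first exact: measurable_GG.
    - by move=> x; exact: GG_ge0.
    - by move=> x _; apply: (young_G_le Y).
  rewrite integral_cst//; apply: lte_mul_pinfty => //.
  by rewrite lee_fin (young_G_ge0 Y).
have [M M0 hM] := ebounded_dist (es_bOm E) (es_bOm' E).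
have a0 : 0 < 1 - s by rewrite subr_gt0.
have [C hC] := @near_kernel_integrable R n _ _ a0 (ltr_wpDl (ltW M0) ltr01).
(* [t] bounds every quotient on [Om] x [Om']; at distance [r] the quotient is at most
   [(r / M) ^ (1 - s) * t], and this factor, being at most 1, comes out of [G]. That gives [C1]. *)
pose t := L * M `^ (1 - s).
have t0 : 0 <= t by rewrite mulr_ge0// powR_ge0.
pose C1 := G t * M `^ (- (1 - s)).
have C10 : 0 <= C1 by rewrite mulr_ge0 ?powR_ge0// (young_G_ge0 Y).
have pw x y : Om x -> Om' y -> GG (Ds s f x y) * kern x y <=
    C1 * (enorm (x - y) `^ (1 - s) * (enorm (x - y) ^+ n)^-1).
  move=> Ox Oy'; have rM := hM x y Ox Oy'.
  have k0 : 0 <= (enorm (x - y) ^+ n)^-1 by rewrite invr_ge0 exprn_ge0// enorm_ge0.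
  rewrite /kern mulrA ler_wpM2r//.
  have [xy|xy] := eqVneq (x - y) 0.
    move/eqP: xy; rewrite subr_eq0 => /eqP ->.
    by rewrite /Ds subrr mul0r (even_ext0 Y) mulr_ge0// powR_ge0.
  have r0 : 0 < enorm (x - y) by rewrite enorm_gt0.
  set r := enorm (x - y) in rM r0 *.
  have q1 : 0 <= r / M <= 1 by rewrite divr_ge0 ?(ltW r0) ?(ltW M0)//= ler_pdivrMr// mul1r.
  have l1 : 0 <= (r / M) `^ (1 - s) <= 1.
    rewrite powR_ge0/= [leRHS](_ : 1 = 1 `^ (1 - s)); last by rewrite powR1.
    by case/andP: q1 => q1 q2; rewrite ge0_ler_powR ?nnegrE// ltW.
  have rM1 : (r / M) `^ (1 - s) * M `^ (1 - s) = r `^ (1 - s).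
    by rewrite -powRM ?(ltW M0) ?divr_ge0 ?(ltW r0) ?(ltW M0)// divfK// gt_eqF.
  have rE : r `^ (1 - s) * M `^ (- (1 - s)) = (r / M) `^ (1 - s).
    by rewrite -rM1 powRN mulfK// gt_eqF// powR_gt0.
  have rs : r `^ (1 - s) = r / r `^ s.
    apply: (canRL (mulfK _)); first by rewrite gt_eqF// powR_gt0.
    by rewrite -powRD ?subrK ?powRr1 ?(ltW r0)// (gt_eqF r0) implybT.
  rewrite /C1 -mulrA (mulrC (M `^ _)) rE.
  apply: (@le_trans _ _ (G ((r / M) `^ (1 - s) * t))).
    apply: (young_G_le Y) => //.
    rewrite /Ds -/r normrM (@ger0_norm _ (_^-1)) ?invr_ge0 ?powR_ge0//.
    rewrite /t mulrCA rM1 rs mulrA ler_wpM2r ?invr_ge0 ?powR_ge0//; exact: hL.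
  apply: le_trans (young_scale_le1 Y l1 t0) _.
  rewrite mulrC ler_wpM2l ?(young_G_ge0 Y)//.
  case/andP: l1 => l0 l1; rewrite -[leRHS](powRr1 l0).
  have [->|z0] := eqVneq ((r / M) `^ (1 - s)) 0.
    by rewrite !powR0 ?gt_eqF ?ltr01.
  by apply: ger_powR; [rewrite lt0r z0 l0|exact: ltW (yp_p1 Y)].
rewrite (modDE s G Om Om') (integral_mul_indic _ _ mP).
have mGDP : measurable_fun setT (fun z => GG (Dz f z) * kz z * \1_pairs z).
  by apply: measurable_funM; [exact: measurable_GD|exact: measurable_indic].
have GDP0 z : 0 <= GG (Dz f z) * kz z * \1_pairs z by rewrite mulr_ge0 ?(GD_ge0)// indicE.
rewrite leb_tonelli; first last.
- by move=> z; rewrite lee_fin.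
- exact/measurable_EFinP.
apply: (@le_lt_trans _ _ (\int[mu]_(x in Om) (C1 * C)%:E)%E); last first.
  have C0 : (0 <= C%:E)%E.
    apply: le_trans (hC 0); apply: integral_ge0 => y _.
    by rewrite lee_fin !mulr_ge0 ?indicE// ?powR_ge0// invr_ge0 exprn_ge0// enorm_ge0.
  rewrite integral_cst//; apply: lte_mul_pinfty => //.
  by rewrite lee_fin mulr_ge0.
rewrite (integral_mul_indic _ (fun=> C1 * C) mOmE); apply: ge0_integral_mono => x.
  by apply: integral_ge0 => y _; rewrite lee_fin.
rewrite indicE; have [/set_mem Ox|] := boolP (x \in Om); last first.
  rewrite notin_setE => nOx; rewrite mulr0 le_eqVlt; apply/orP; left; apply/eqP.
  rewrite -[RHS](integral0 mu setT); apply: eq_integral => y _.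
  by rewrite indicE memNset ?mulr0// /pairs /= row_mxKl => -[].
rewrite mulr1 EFinM; apply: le_trans (lee_wpmul2l _ (hC x)); last by rewrite lee_fin.
have mr : measurable_fun setT (fun y : T => enorm (x - y)).
  apply: (measurableT_comp (@measurable_enorm R n)); apply: measurable_fun_rV => i.
  under eq_fun do rewrite !mxE; apply: measurable_funB => //; exact: measurable_coord.
have rr0 y : 0 <= (enorm (x - y) ^+ n)^-1 by rewrite invr_ge0 exprn_ge0// enorm_ge0.
rewrite -integralZ_EFin//; first last.
- by move=> y; rewrite !mulr_ge0 ?indicE// ?powR_ge0.
- apply: measurable_funM; first by apply: measurable_indic; exact: measurable_cube.
  apply: measurable_funM; first exact: measurableT_comp (@measurable_powR R _) mr.
  under eq_fun do rewrite -powR_inv1 ?exprn_ge0 ?enorm_ge0//.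
  exact: measurableT_comp (@measurable_powR R (- 1)) (measurable_funX n mr).
apply: ge0_integral_mono => y; first by rewrite lee_fin.
rewrite lee_fin !indicE; have [/set_mem[/= Ox' ]|_] := boolP (row_mx x y \in pairs); last first.
  rewrite mulr0; apply: mulr_ge0 => //; apply: mulr_ge0 => //.
  exact: mulr_ge0 (powR_ge0 _ _) (rr0 y).
rewrite row_mxKr => Oy'; rewrite mulr1 Dz_row kz_row mem_set ?mul1r; first exact: pw.
move=> i; rewrite distrC; have := coord_le_norm (x - y) i; rewrite !mxE => h.
apply: (le_lt_trans h); apply: (le_lt_trans (norm_le_enorm _)); apply: (le_lt_trans (hM x y Ox Oy')).
by rewrite ltrDl.
Qed.



(** * Luxemburg norms against modulars *)

Let GGs0 (c t : R) : 0 <= c -> `|c * t| = c * `|t|.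
Proof. by move=> c0; rewrite normrM ger0_norm. Qed.

Lemma modL_scale (c C : R) u : measurable_fun setT u -> 0 <= C ->
  (forall t : R, GG (c * t) <= C * GG t) -> (modL (fun x => (c * u x)%R) <= C%:E * modL u)%E.
Proof.
move=> mu' C0 hC; rewrite -integralZ_EFin//; [|exact: measurable_GG|by move=> x; exact: GG_ge0].
apply: le_integral_EFin => //.
- by apply: measurable_GG; exact: measurable_funM.
- by apply: measurable_funM => //; exact: measurable_GG.
- by move=> x; exact: GG_ge0.
Qed.

Lemma modD_scale (c C : R) u : measurable_fun setT u -> 0 <= C ->
  (forall t : R, GG (c * t) <= C * GG t) -> (modD (fun x => (c * u x)%R) <= C%:E * modD u)%E.
Proof.
move=> mu' C0 hC; rewrite -integralZ_EFin//; [|exact: measurable_GD|by move=> x; exact: GD_ge0].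
apply: le_integral_EFin => //.
- by apply: measurable_GD; exact: measurable_funM.
- by apply: measurable_funM => //; exact: measurable_GD.
- by move=> x; exact: GD_ge0.
- by move=> z _; rewrite mulrA ler_wpM2r ?kz_ge0// DzZ.
Qed.

Lemma even_ext_scale_le1 (c t : R) : 0 <= c <= 1 -> GG (c * t) <= c * GG t.
Proof.
move=> c01; case/andP: (c01) => c0 c1; rewrite /even_ext GGs0//.
apply: le_trans (young_scale_le1 Y c01 (normr_ge0 _)) _.
rewrite ler_wpM2r ?(young_G_ge0 Y)//.
have [->|z0] := eqVneq c 0; first by rewrite !powR0 ?gt_eqF.
by rewrite -[leRHS](powRr1 c0); apply: ger_powR; [rewrite lt0r z0 c0|exact: ltW (yp_p1 Y)].
Qed.

Lemma even_ext_scale_ge1 (c t : R) : 1 <= c -> GG (c * t) <= c `^ q * GG t.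
Proof.
move=> c1; rewrite /even_ext GGs0 ?(le_trans ler01 c1)//.
exact: (young_scale_ge1 Y).
Qed.

Lemma iint_on_modL u u' (lam : R) : measurable_fun setT u' -> ae (fun x => u x = u' x) ->
  0 < lam -> iint_on Om (fun x => (G (`|u x| / lam))%:E) = modL (fun x => lam^-1 * u' x).
Proof.
move=> mu' uu l0; have mlu : measurable_fun setT (fun x => lam^-1 * u' x) by exact: measurable_funM.
rewrite /iint_on (modLE G Om) (integral_mul_indic _ (fun x => GG (lam^-1 * u' x)) mOmE).
have G0 (t : R) : 0 <= G (`|t| / lam) by rewrite (young_G_ge0 Y)// divr_ge0// ltW.
apply: iint_ae.
- apply/measurable_EFinP; apply: measurable_funM; last exact: measurable_indic.
  exact: measurable_GG.
- by move=> x; case: ifP => _; rewrite lee_fin.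
- by move=> x; rewrite lee_fin mulr_ge0 ?(GG_ge0)// indicE.
move/ae_leb: uu => uu; apply/ae_leb; apply: filterS uu => x ->.
rewrite indicE; case: asboolP => Ox; last by rewrite memNset// mulr0.
have li0 : 0 <= lam^-1 by rewrite invr_ge0 ltW.
by rewrite mem_set// mulr1 /even_ext (GGs0 _ li0) (mulrC lam^-1).
Qed.

Lemma gag_mod_modD u u' (lam : R) : measurable_fun setT u' -> ae (fun x => u x = u' x) ->
  0 < lam -> gag_mod s G Om Om' u lam = modD (fun x => lam^-1 * u' x).
Proof.
move=> mu' /ae_leb uu l0; have mlu : measurable_fun setT (fun x => lam^-1 * u' x) by exact: measurable_funM.
rewrite /gag_mod /dint_on /iint_on (modDE s G Om Om') (integral_mul_indic _ (fun z => GG (Dz (fun x => lam^-1 * u' x) z) * kz z) mP).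
have G0 (t : R) : 0 <= G (`|t| / lam) by rewrite (young_G_ge0 Y)// divr_ge0// ltW.
apply: iint_ae.
- apply/measurable_EFinP; apply: measurable_funM; last exact: measurable_indic.
  exact: measurable_GD.
- move=> z; case: ifP => _; rewrite lee_fin// mulr_ge0//; exact: (kz_ge0 z).
- by move=> x; rewrite lee_fin mulr_ge0 ?(GD_ge0)// indicE.
apply/ae_leb; apply: filterS (ae_Dz uu) => z.
rewrite DzZ -/(Dz u z) => ->.
rewrite indicE; case: asboolP => Pz; last by rewrite memNset// mulr0.
have li0 : 0 <= lam^-1 by rewrite invr_ge0 ltW.
by rewrite mem_set// mulr1 /even_ext (GGs0 _ li0) (mulrC lam^-1).
Qed.

Lemma Wnorm_ae u u' : measurable_fun setT u' -> ae (fun x => u x = u' x) ->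
  Wnorm s G Om Om' u = Wnorm s G Om Om' u'.
Proof.
move=> mu' uu; rewrite /Wnorm /lux_norm /gag_norm.
have uu' : ae (fun x => u' x = u' x) by apply/ae_leb; exact: aeW.
congr (ereal_inf _ + ereal_inf _)%E; congr (image _ _); apply/seteqP; split => lam [l0].
- by rewrite /= (iint_on_modL mu' uu)// (iint_on_modL mu' uu').
- by rewrite /= (iint_on_modL mu' uu)// (iint_on_modL mu' uu').
- by rewrite /= (gag_mod_modD mu' uu)// (gag_mod_modD mu' uu').
- by rewrite /= (gag_mod_modD mu' uu)// (gag_mod_modD mu' uu').
Qed.

Let aeid u : ae (fun x => u x = u x).
Proof. by apply/ae_leb; exact: aeW. Qed.

Lemma Wnorm_ge0 u : (0 <= Wnorm s G Om Om' u)%E.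
Proof.
by apply: adde_ge0; apply: le_ereal_inf_tmp => _ [lam [l0 _] <-]; rewrite lee_fin ltW.
Qed.

(** If [l < lam] is admissible in one of the infima, then [u = l * (u / l)] and
    [G (l * t) <= l * G t] bound that modular by [l]; the factor 2 counts the two summands. *)
Lemma modW_le_Wnorm u (lam : R) : measurable_fun setT u -> lam <= 1 ->
  (Wnorm s G Om Om' u < lam%:E)%E -> (modW u <= (2 * lam)%:E)%E.
Proof.
move=> mu' l1 h.
have n1 : (0 <= lux_norm G Om u)%E by apply: le_ereal_inf_tmp => _ [l [l0 _] <-]; rewrite lee_fin ltW.
have n2 : (0 <= gag_norm s G Om Om' u)%E by apply: le_ereal_inf_tmp => _ [l [l0 _] <-]; rewrite lee_fin ltW.
have h1 : (lux_norm G Om u < lam%:E)%E by apply: le_lt_trans h; rewrite leeDl.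
have h2 : (gag_norm s G Om Om' u < lam%:E)%E by apply: le_lt_trans h; rewrite leeDr.
have aux (l : R) v : 0 < l -> v = (fun x => l * (l^-1 * v x)).
  by move=> l0; apply/funext => x; rewrite mulrA divff ?mul1r// gt_eqF.
rewrite modWE mulr2n mulrDl mul1r EFinD; apply: leeD.
  have /ereal_inf_lt[_ [l [l0 hl] <-]] := h1; rewrite lte_fin => ll.
  rewrite (iint_on_modL mu' (aeid u) l0) in hl.
  rewrite (aux l u l0); apply: (@le_trans _ _ (l%:E * modL (fun x => (l^-1 * u x)%R))%E).
    apply: modL_scale => //; [exact: measurable_funM|exact: ltW|].
    by move=> t; apply: even_ext_scale_le1; rewrite (ltW l0) (le_trans (ltW ll)).
  apply: (@le_trans _ _ (l%:E * 1)%E); first by rewrite lee_pmul2l.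
  by rewrite mule1 lee_fin ltW.
have /ereal_inf_lt[_ [l [l0 hl] <-]] := h2; rewrite lte_fin => ll.
rewrite (gag_mod_modD mu' (aeid u) l0) in hl.
rewrite (aux l u l0); apply: (@le_trans _ _ (l%:E * modD (fun x => (l^-1 * u x)%R))%E).
  apply: modD_scale => //; [exact: measurable_funM|exact: ltW|].
  by move=> t; apply: even_ext_scale_le1; rewrite (ltW l0) (le_trans (ltW ll)).
apply: (@le_trans _ _ (l%:E * 1)%E); first by rewrite lee_pmul2l.
by rewrite mule1 lee_fin ltW.
Qed.

(** The doubling property enters as [G (t / lam) <= lam ^ (- q) * G t]: a modular of size [lam ^ q]
    makes [lam] admissible for both norms. *)
Lemma Wnorm_le_modW u (lam : R) : measurable_fun setT u -> 0 < lam <= 1 ->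
  (modW u <= (lam `^ q)%:E)%E -> (Wnorm s G Om Om' u <= (2 * lam)%:E)%E.
Proof.
move=> mu' /andP[l0 l1]; rewrite modWE => h.
have c1 : 1 <= lam^-1 by rewrite invf_ge1.
have hq (t : R) : GG (lam^-1 * t) <= (lam `^ q)^-1 * GG t.
  have -> : (lam `^ q)^-1 = lam^-1 `^ q.
    by rewrite -(powR_inv1 (ltW l0)) -powRrM mulN1r powRN.
  exact: even_ext_scale_ge1.
have lq0 : 0 < lam `^ q by rewrite powR_gt0.
rewrite /Wnorm mulr2n mulrDl mul1r EFinD; apply: leeD; apply: ereal_inf_le.
  exists lam%:E => //; exists lam => //; split => //.
  rewrite (iint_on_modL mu' (aeid u) l0); apply: le_trans (modL_scale mu' _ hq) _.
    by rewrite invr_ge0 ltW.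
  rewrite lee_pdivrMl// mule1.
  by apply: le_trans h; rewrite leeDl// modD_ge0.
exists lam%:E => //; exists lam => //; split => //.
rewrite (gag_mod_modD mu' (aeid u) l0); apply: le_trans (modD_scale mu' _ hq) _.
  by rewrite invr_ge0 ltW.
rewrite lee_pdivrMl// mule1.
by apply: le_trans h; rewrite leeDr// modL_ge0.
Qed.

(* [W0] for Borel functions, with the norm replaced by the modular. *)
Definition W0b w := forall e : R, 0 < e -> exists2 f, Cc_inf Om f &
  (modW (fun x => (w x - f x)%R) <= e%:E)%E.

Lemma W0_W0b u u' : measurable_fun setT u' -> ae (fun x => u x = u' x) ->
  W0 s G Om Om' u <-> ae (fun x => ~ Om x -> u' x = 0) /\ W0b u'.
Proof.
move=> mu' uu.
have uuf f : ae (fun x => u x - f x = u' x - f x).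
  by move/ae_leb: uu => uu; apply/ae_leb; apply: filterS uu => x ->.
have muf f : Cc_inf Om f -> measurable_fun setT (fun x => u' x - f x).
  by move=> cf; apply: measurable_funB => //; exact: Cc_inf_measurable cf.
have aeO : ae (fun x => ~ Om x -> u x = 0) <-> ae (fun x => ~ Om x -> u' x = 0).
  move/ae_leb: uu => uu; split => /ae_leb h; apply/ae_leb; apply: filterS2 uu h => x.
    by move=> ->.
  by move=> ->.
split => [[/aeO u0 [phi [cphi hphi]]]|[/aeO u0 hW]]; split => //.
  move=> e e0; pose lam := Num.min 1 (e / 2).
  have l0 : 0 < lam by rewrite lt_min ltr01 divr_gt0.
  have l1 : lam <= 1 by rewrite ge_min lexx.
  have /fine_cvgP[f1 /cvgrPdist_lt/(_ _ l0) f2] := hphi.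
  have [N _ hN] := filterI f1 f2; have [/= hf] := hN N (leqnn N).
  rewrite sub0r normrN => hl; exists (phi N) => //.
  have := @modW_le_Wnorm (fun x => u' x - phi N x) lam (muf _ (cphi N)) l1.
  rewrite -(Wnorm_ae (muf _ (cphi N)) (uuf (phi N))) -(fineK hf) lte_fin.
  move=> /(_ (le_lt_trans (ler_norm _) hl)) /le_trans; apply.
  by rewrite lee_fin -ler_pdivlMl// mulrC ge_min lexx orbT.
have /choice[phi hphi] : forall k : nat, exists f, Cc_inf Om f /\
    (Wnorm s G Om Om' (fun x => (u x - f x)%R) <= (2 * k.+1%:R^-1)%:E)%E.
  move=> k; have l01 : 0 < (k.+1%:R^-1 : R) <= 1 by rewrite invr_gt0 ltr0n invf_le1// ler1n.
  have [f cf hf] := hW _ (powR_gt0 q (proj1 (andP l01))).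
  exists f; split => //; rewrite (Wnorm_ae (muf _ cf) (uuf f)).
  exact: Wnorm_le_modW (muf _ cf) l01 hf.
exists phi; split; first by move=> k; case: (hphi k).
apply: (@squeeze_cvge _ _ _ _ (fun=> 0%E) _ (fun k => (2 * k.+1%:R^-1)%:E)).
- by apply: nearW => k; rewrite Wnorm_ge0; case: (hphi k).
- exact: cvg_cst.
apply: cvg_EFin; first exact: nearW.
by rewrite -(mulr0 2); apply: cvgM; [exact: cvg_cst|exact: cvg_harmonic].
Qed.

(** * The obstacle class and its closure properties *)

Variable psi : T -> \bar R.

(** Borel representatives of the members of [Kset], normalized to equal [th] everywhere off [Om] and
    not only a.e.; [Kset_oclass] and [oclass_Kset] translate between the two. *)
Definition obstacle_class u := [/\ competitor u,
  {ae mu, forall x, Om x -> (psi x <= (u x)%:E)%E} & W0b (fun x => u x - th x)].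

Let KBc u : obstacle_class u -> competitor u. Proof. by case. Qed.

Lemma obstacle_class_convex (t : R) u v : 0 <= t <= 1 ->
  obstacle_class u -> obstacle_class v -> obstacle_class (fun x => (1 - t) * u x + t * v x).
Proof.
move=> t01 [cu pu wu] [cv pv wv]; case/andP: (t01) => t0 t1; split.
- exact: (competitor_convex t01 cu cv).
- apply: filterS2 pu pv => x hu hv Ox; have := hu Ox; have := hv Ox.
  case: (psi x) => [r| |]; rewrite ?leNye// ?leye_eq// !lee_fin => h1 h2.
  have h3 : (1 - t) * r <= (1 - t) * u x by rewrite ler_wpM2l// subr_ge0.
  have h4 : t * r <= t * v x by rewrite ler_wpM2l.
  lra.
move=> e e0; have [f cf hf] := wu e e0; have [h ch hh] := wv e e0.
exists (fun x => (1 - t) * f x + t * h x); first exact: Cc_inf_lincomb.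
have [mu' _ _] := cu; have [mv _ _] := cv.
have mf := Cc_inf_measurable cf; have mh := Cc_inf_measurable ch.
have := modW_convex (u := fun x => u x - th x - f x) (v := fun x => v x - th x - h x) t01.
rewrite (_ : (fun x => (1 - t) * (u x - th x - f x) + t * (v x - th x - h x)) =
  (fun x => (1 - t) * u x + t * v x - th x - ((1 - t) * f x + t * h x))); last first.
  by apply/funext => x; ring.
have mth := es_th E.
have m1 : measurable_fun setT (fun x => u x - th x - f x).
  by apply: measurable_funB => //; exact: measurable_funB.
have m2 : measurable_fun setT (fun x => v x - th x - h x).
  by apply: measurable_funB => //; exact: measurable_funB.
move=> /(_ m1 m2) /le_trans; apply.
apply: (@le_trans _ _ ((1 - t)%:E * e%:E + t%:E * e%:E)%E).
  by apply: leeD; apply: lee_wpmul2l => //; rewrite lee_fin// subr_ge0.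
suff H : (1 - t) * e + t * e <= e by rewrite -lee_fin in H; exact: H.
by rewrite -mulrDl subrK mul1r.
Qed.

Lemma obstacle_class_ae u v : obstacle_class u -> competitor v ->
  {ae mu, forall x, v x = u x} -> obstacle_class v.
Proof.
move=> [cu pu wu] cv vu; split => //.
  by apply: filterS2 vu pu => x ->.
move=> e /wu[f cf hf]; exists f => //; apply: le_trans hf.
have [mu' _ _] := cu; have [mv _ _] := cv; have mth := es_th E.
have mf := Cc_inf_measurable cf.
rewrite (modW_ae (v := fun x => u x - th x - f x))//.
- by apply: measurable_funB => //; exact: measurable_funB.
- by apply: measurable_funB => //; exact: measurable_funB.
- by apply: filterS vu => x ->.
Qed.

Lemma obstacle_class_lim (u_ : nat -> T -> R) u : (forall k, obstacle_class (u_ k)) ->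
  competitor u -> (forall x, u_ ^~ x @ \oo --> u x) ->
  (forall e : R, 0 < e -> exists k, (modW (fun x => u x - u_ k x)%R <= e%:E)%E) ->
  obstacle_class u.
Proof.
move=> Ku cu hu hW; split => //.
  have h : {ae mu, forall x, forall k, Om x -> (psi x <= (u_ k x)%:E)%E}.
    by apply: ae_foralln => k; case: (Ku k).
  apply: filterS h => x h Ox.
  have c1 : (fun k => (u_ k x)%:E) @ \oo --> (u x)%:E.
    by apply: cvg_EFin; [exact: nearW|exact: hu].
  rewrite -(cvg_lim _ c1)//; apply: lime_ge; first by apply/cvg_ex; eexists; exact: c1.
  by apply: nearW => k; exact: h.
move=> e e0; pose A := (2 : R) `^ q; have A0 : 0 < A by rewrite powR_gt0.
have d0 : 0 < e / (2 * A) by rewrite divr_gt0// mulr_gt0.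
have [k hk] := hW _ d0; have [ck _ wk] := Ku k; have [f cf hf] := wk _ d0.
exists f => //; have [mu' _ _] := cu; have [mk _ _] := ck; have mth := es_th E.
have mf := Cc_inf_measurable cf.
rewrite (_ : (fun x => u x - th x - f x) =
   (fun x => (u x - u_ k x) + (u_ k x - th x - f x))); last by apply/funext => x; ring.
have m1 : measurable_fun setT (fun x => u x - u_ k x) by exact: measurable_funB.
have m2 : measurable_fun setT (fun x => u_ k x - th x - f x).
  by apply: measurable_funB => //; exact: measurable_funB.
apply: le_trans (modW_add m1 m2) _.
apply: (@le_trans _ _ (A%:E * ((e / (2 * A))%:E + (e / (2 * A))%:E))%E).
  by apply: lee_wpmul2l; [rewrite lee_fin ltW|exact: leeD].
suff H : A * (e / (2 * A) + e / (2 * A)) <= e by rewrite -lee_fin in H; exact: H.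
by rewrite le_eqVlt; apply/orP; left; apply/eqP; field; rewrite gt_eqF.
Qed.

Lemma test_admissible f : Cc_inf Om f -> admissible f.
Proof.
move=> cf; split; [exact: Cc_inf_measurable cf|exact: Cc_inf_out cf|].
exact: (modW_Cc_inf cf).
Qed.

Lemma obstacle_class_add u f : obstacle_class u -> Cc_inf Om f -> (forall x, 0 <= f x) ->
  obstacle_class (fun x => u x + f x).
Proof.
move=> [cu pu wu] cf f0; split.
- exact: (competitor_add cu (test_admissible cf)).
- apply: filterS pu => x h Ox; apply: le_trans (h Ox) _; rewrite lee_fin.
  by rewrite lerDl.
move=> e /wu[h ch hh]; exists (fun x => 1 * h x + 1 * f x); first exact: Cc_inf_lincomb.
rewrite (_ : (fun x => _) = (fun x => u x - th x - h x))//.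
by apply/funext => x; ring.
Qed.

Lemma obstacle_minimizer : (exists u, obstacle_class u) -> exists2 u, obstacle_class u &
  forall v, obstacle_class v -> 0 <= first_var u (fun x => v x - u x).
Proof.
move=> ne; have [u Ku hu] := exists_minimizer KBc obstacle_class_convex
  obstacle_class_ae obstacle_class_lim ne.
exists u => // v Kv; have cu := KBc Ku; have cv := KBc Kv.
apply: (first_variation cu (competitor_sub cv cu)) => t /andP[t0 t1].
apply: hu; rewrite (_ : (fun x => _) = (fun x => (1 - t) * u x + t * v x)).
  by apply: obstacle_class_convex => //; rewrite (ltW t0).
by apply/funext => x; ring.
Qed.

Lemma Wsp_modW u u' : measurable_fun setT u' -> ae (fun x => u x = u' x) ->
  lmeasurable_fun u -> Wsp s G Om Om' u <-> (modW u' < +oo)%E.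
Proof.
move=> mu' uu lu; have E1 : (fun x => 1^-1 * u' x) = u' by apply/funext => x; rewrite invr1 mul1r.
have L : iint_on Om (fun x => (G `|u x|)%:E) = modL u'.
  rewrite -E1 -(iint_on_modL mu' uu ltr01); congr iint_on.
  by apply/funext => x; rewrite divr1.
have D : gag_mod s G Om Om' u 1 = modD u' by rewrite (gag_mod_modD mu' uu ltr01) E1.
rewrite /Wsp L D modWE; split => [[_ h1 h2]|h]; first exact: lte_add_pinfty.
split => //; apply: le_lt_trans h; rewrite ?leeDl ?leeDr//; [exact: modD_ge0|exact: modL_ge0].
Qed.


(** * Transfer from Borel representatives to the notions of the statement *)

Variables (k : T -> T -> R) (theta : T -> R).
Hypothesis theta_th : ae (fun x => theta x = th x).
Hypothesis kK : ae (fun z : Z => k (lsubmx z) (rsubmx z) = K z).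
Hypothesis Lgs_theta : Lgs s g theta.
Local Notation Kset := (Kset s G Om Om' psi theta).

(** [sint] subtracts the integrals of the positive and the negative part. Absolute integrability
    through [bint] makes both finite, so the difference of extended reals is the real number
    [first_var]. *)
Lemma Eform_first_var u v u' v' : ae (fun x => u x = u' x) -> ae (fun x => v x = v' x) ->
  competitor u' -> admissible v' ->
  Eform s g k u v = (first_var u' v')%:E.
Proof.
move=> /ae_leb uu /ae_leb vv cu av; have [mu' _ _] := cu; have [mv _ _] := av.
have iF := first_var_integrable cu av.
pose F z := gg (Dz u' z) * Dz v' z * wz z.
have mF : measurable_fun setT F by exact: measurable_first_var.
have aeF : {ae mu2, forall z, g `|Dz u z| * (Dz u z / `|Dz u z|) * Dz v z *
    k (lsubmx z) (rsubmx z) * kz z = F z}.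
  move/ae_leb: kK => kK'.
  apply: filterS2 (filterI (ae_Dz uu) (ae_Dz vv)) kK' => z [-> ->] ->.
  by rewrite /F /odd_ext /wz; ring.
rewrite /Eform /sint.
rewrite (iint_ae (f' := fun z => (Num.max (F z) 0)%:E)); first last.
- by apply/ae_leb; apply: filterS aeF => z h; rewrite -h.
- by move=> z; rewrite lee_fin le_max lexx orbT.
- by move=> z; rewrite lee_fin le_max lexx orbT.
- by apply/measurable_EFinP; exact: measurable_maxr.
rewrite (iint_ae (f' := fun z => (Num.max (- F z) 0)%:E)); first last.
- by apply/ae_leb; apply: filterS aeF => z h; rewrite -h.
- by move=> z; rewrite lee_fin le_max lexx orbT.
- by move=> z; rewrite lee_fin le_max lexx orbT.
- by apply/measurable_EFinP; apply: measurable_maxr => //; exact: measurableT_comp.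
rewrite /first_var /Rintegral fineK; last by apply: integrable_fin_num => //; exact: iF.
rewrite [RHS]integralE; congr (_ - _)%E; apply: eq_integral => z _.
  by rewrite funeposE EFin_max.
by rewrite funenegE EFin_max.
Qed.

Lemma Kset_oclass u : Kset u -> exists2 u', ae (fun x => u x = u' x) & obstacle_class u'.
Proof.
move=> [[lu uG uD] pu wu]; have [v [mv uv]] := lmeasurable_fun_borel lu.
have mth := es_th E.
(* A Borel representative on [Om], glued with [th] outside. It agrees with [u] a.e., because [W0]
   forces [u - theta] to vanish a.e. off [Om]. *)
pose u' x := v x * \1_Om x + th x * (1 - \1_Om x).
have u'_in x : Om x -> u' x = v x by move=> Ox; rewrite /u' indicE mem_set// subrr mulr0 addr0 mulr1.
have u'_out x : ~ Om x -> u' x = th x by move=> Ox; rewrite /u' indicE memNset// subr0 mulr0 add0r mulr1.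
have mi : measurable_fun setT (\1_Om : T -> R) by exact: measurable_indic.
have mu' : measurable_fun setT u'.
  by apply: measurable_funD; apply: measurable_funM => //; exact: measurable_funB.
have uu : ae (fun x => u x = u' x).
  have [/ae_leb h _] := wu; move/ae_leb: uv => uv'; move/ae_leb: theta_th => tt.
  apply/ae_leb; apply: filterS2 (filterI h uv') tt => x [h1 h2] h3.
  have [Ox|nOx] := pselect (Om x); first by rewrite u'_in.
  by rewrite u'_out// -h3; apply/eqP; rewrite -subr_eq0; apply/eqP; exact: h1.
exists u' => //; split; first split => //.
- by apply/(Wsp_modW mu' uu lu); split.
- by move/ae_leb: pu => pu; move/ae_leb: uu => uu'; apply: filterS2 pu uu' => x h <-.
have mw : measurable_fun setT (fun x => u' x - th x) by exact: measurable_funB.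
have uw : ae (fun x => u x - theta x = u' x - th x).
  move/ae_leb: uu => uu'; move/ae_leb: theta_th => tt.
  by apply/ae_leb; apply: filterS2 uu' tt => x -> ->.
by have [/(_ wu)[]] := W0_W0b mw uw.
Qed.

Lemma oclass_Kset u : obstacle_class u -> Kset u.
Proof.
move=> [[mu' uth uoo] pu wu]; have lu := measurable_fun_lmeasurable mu'.
have uu : ae (fun x => u x = u x) by apply/ae_leb; exact: aeW.
have mth := es_th E.
split; first exact/(Wsp_modW mu' uu lu).
- exact/ae_leb.
have mw : measurable_fun setT (fun x => u x - th x) by exact: measurable_funB.
have uw : ae (fun x => u x - theta x = u x - th x).
  by move/ae_leb: theta_th => tt; apply/ae_leb; apply: filterS tt => x ->.
apply/(W0_W0b mw uw); split => //; apply/ae_leb; apply: aeW => x nOx.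
by rewrite uth// subrr.
Qed.

Lemma supersolution_Wloc u : obstacle_class u -> Wloc s G Om u.
Proof.
move=> ou; have [[lu uG uD] _ _] := oclass_Kset ou; split => // D oD cD DO.
have DOm : D `<=` Om by move=> x /subset_closure/DO.
have OmOm' : Om `<=` Om' by move=> x /subset_closure/(es_cOm E).
have G0 (t : R) : 0 <= G (`|t|) by rewrite (young_G_ge0 Y).
apply: lte_add_pinfty.
  apply: le_lt_trans uG; apply: iint_le => x.
    by case: ifP; rewrite lee_fin.
  case: asboolP => [/DOm|_]; first by case: asboolP.
  by case: ifP; rewrite lee_fin.
apply: le_lt_trans uD; apply: iint_le => z.
  by case: ifP; rewrite lee_fin// mulr_ge0 ?(kz_ge0 z)// (young_G_ge0 Y)// divr_ge0.
case: asboolP => [[/DOm Ox /DOm/OmOm' Oy']|_]; first by case: asboolP => // -[].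
by case: ifP; rewrite lee_fin// mulr_ge0 ?(kz_ge0 z)// (young_G_ge0 Y)// divr_ge0.
Qed.

Lemma young_g_le_G (t : R) : 0 <= t -> g t <= g 1 + q * G t.
Proof.
move=> t0; have G0 := young_G_ge0 Y t0; have [t1|t1] := leP t 1.
  by rewrite (le_trans (young_g_le Y t0 t1))// lerDl mulr_ge0// ltW.
have [_ h] := yp_grow Y t0; apply: (@le_trans _ _ (t * g t)).
  by rewrite ler_peMl ?(ltW t1)// (young_g_ge0 Y).
by rewrite (le_trans h)// lerDr (young_g_ge0 Y).
Qed.

Let negp (u : T -> R) x := Num.max (- u x) 0.

Let negp_le u x : `|negp u x| <= `|u x|.
Proof.
rewrite /negp; case: (leP (- u x) 0) => h; first by rewrite normr0.
by rewrite normrN.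
Qed.

(** Off [Om] the function is [th], whose weighted integral is known. In [Om] the weights only
    decrease the left side, and [g] is dominated by [g 1 + q * G], integrable over [Om] for
    functions of finite modular. *)
Lemma tail_negp u x (c d : R) : 1 <= c -> 0 <= d <= 1 -> (forall y, ~ Om y -> u y = th y) ->
  g (`|negp u x| / c) * d <= g (`|th x| / c) * d + (g 1 + q * GG (u x)) * \1_Om x.
Proof.
move=> c1 /andP[d0 d1] uth; have c0 : 0 < c := lt_le_trans ltr01 c1.
have g0 (t : R) : 0 <= g (`|t| / c) by rewrite (young_g_ge0 Y)// divr_ge0// ltW.
have le1 : g (`|negp u x| / c) <= g (`|u x| / c).
  apply: (young_g_le Y); first by rewrite divr_ge0// ltW.
  by rewrite ler_pM2r ?invr_gt0.
rewrite indicE; have [/set_mem Ox|] := boolP (x \in Om); last first.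
  rewrite notin_setE => nOx; rewrite mulr0 addr0 ler_wpM2r//.
  by rewrite -(uth _ nOx).
rewrite mulr1; apply: (@le_trans _ _ (g 1 + q * GG (u x))); last by rewrite lerDr mulr_ge0.
apply: (@le_trans _ _ (g (`|u x| / c))).
  by apply: le_trans le1; rewrite ler_piMr.
apply: le_trans (young_g_le_G (normr_ge0 (u x))).
apply: (young_g_le Y); first by rewrite divr_ge0// ltW.
by rewrite ler_pdivrMr// ler_peMr.
Qed.

Lemma supersolution_Lgs u : obstacle_class u -> Lgs s g (negp u).
Proof.
move=> [[mu' uth uoo] _ _]; have [lth hloc htail] := Lgs_theta; have mth := es_th E.
have mneg : measurable_fun setT (negp u).
  by apply: measurable_maxr => //; exact: measurableT_comp.
have q1 (t : R) : 0 <= g 1 + q * GG t.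
  by rewrite addr_ge0 ?(young_g_ge0 Y)// mulr_ge0 ?(ltW q0)// GG_ge0.
have mOmfin : measurable_fun setT (fun x => (g 1 + q * GG (u x)) * \1_Om x).
  apply: measurable_funM; last exact: measurable_indic.
  by apply: measurable_funD => //; apply: measurable_funM => //; exact: measurable_GG.
have Omfin : (\int[mu]_x ((g 1 + q * GG (u x)) * \1_Om x)%:E < +oo)%E.
  rewrite -(integral_mul_indic _ (fun x => g 1 + q * GG (u x)) mOmE).
  rewrite integralD_EFin//; first last.
  - by move=> x; rewrite mulr_ge0 ?(ltW q0)// GG_ge0.
  - by move=> x; rewrite (young_g_ge0 Y).
  - by apply: measurable_funM => //; exact: measurable_GG.
  have muO : (mu Om < +oo)%E := ebounded_measure_fin mOmE (es_bOm E).
  apply: lte_add_pinfty.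
    rewrite integral_cst//; apply: lte_mul_pinfty => //.
    by rewrite lee_fin (young_g_ge0 Y).
  rewrite integralZ_EFin ?(ltW q0)//; [|exact: measurable_GG|by move=> x; exact: GG_ge0].
  apply: lte_mul_pinfty => //; first by rewrite lee_fin ltW.
  by apply: le_lt_trans uoo; rewrite modWE leeDl// modD_ge0.
have g0 (v : T -> R) (c : T -> R) x : 0 <= c x -> 0 <= g (`|v x| / c x).
  by move=> cx; rewrite (young_g_ge0 Y)// divr_ge0.
have mg (v c : T -> R) : measurable_fun setT v -> measurable_fun setT c ->
    (forall x, 0 < c x) -> measurable_fun setT (fun x => g (`|v x| / c x)).
  move=> mv mc c0; rewrite (_ : (fun x => _) = (fun t => g `|t|) \o (fun x => v x * c x `^ (-1))).
    apply: measurableT_comp measurable_g _; apply: measurable_funM => //.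
    exact: measurableT_comp (@measurable_powR R (-1)) mc.
  apply/funext => x /=; rewrite powR_inv1 ?(ltW (c0 x))// normrM (@ger0_norm _ (_^-1))//.
  by rewrite invr_ge0 ltW.
(* The local and the tail condition are two instances of one weighted estimate. *)
have main (c d : T -> R) : measurable_fun setT c -> measurable_fun setT d ->
    (forall x, 1 <= c x) -> (forall x, 0 <= d x <= 1) ->
    (iint (fun x => (g (`|theta x| / c x) * d x)%:E) < +oo)%E ->
    (iint (fun x => (g (`|negp u x| / c x) * d x)%:E) < +oo)%E.
  move=> mc md c1 d01 hth.
  have c0 x : 0 < c x := lt_le_trans ltr01 (c1 x).
  have d0 x : 0 <= d x by case/andP: (d01 x).
  have m1 : measurable_fun setT (fun x => g (`|th x| / c x) * d x).
    by apply: measurable_funM => //; exact: mg.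
  have m2 : measurable_fun setT (fun x => g (`|negp u x| / c x) * d x).
    by apply: measurable_funM => //; exact: mg.
  have p1 (v : T -> R) x : 0 <= g (`|v x| / c x) * d x by rewrite mulr_ge0// g0// ltW.
  have hth' : (\int[mu]_x (g (`|th x| / c x) * d x)%:E < +oo)%E.
    rewrite -(iint_ae (f := fun x => (g (`|theta x| / c x) * d x)%:E))//.
    - exact/measurable_EFinP.
    - by move=> x; rewrite lee_fin.
    - by move=> x; rewrite lee_fin.
    - by move/ae_leb: theta_th => tt; apply/ae_leb; apply: filterS tt => x ->.
  rewrite (iint_ae (f' := fun x => (g (`|negp u x| / c x) * d x)%:E)); first last.
  - by apply/ae_leb; exact: aeW.
  - by move=> x; rewrite lee_fin.
  - by move=> x; rewrite lee_fin.
  - exact/measurable_EFinP.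
  apply: le_lt_trans (lte_add_pinfty hth' Omfin).
  rewrite -integralD_EFin//; last by move=> x; rewrite mulr_ge0// indicE.
  apply: le_integral_EFin => //; first exact: measurable_funD.
  by move=> x _; exact: tail_negp.
split; first exact: measurable_fun_lmeasurable.
  move=> A cA; have mA : measurable A.
    rewrite -(setCK A); apply: measurableC; apply: open_measurable_rV.
    by apply: closed_openC; apply: compact_closed cA; exact: norm_hausdorff.
  have conv (v : T -> R) : iint_on A (fun x => (g `|v x|)%:E) =
      iint (fun x => (g (`|v x| / 1) * \1_A x)%:E).
    rewrite /iint_on; congr iint; apply/funext => x; rewrite divr1 indicE.
    by case: asboolP => Ax; [rewrite mem_set// mulr1|rewrite memNset// mulr0].
  rewrite conv; apply: (main (fun=> 1) \1_A) => //; last by rewrite -conv; exact: hloc.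
  by move=> x; rewrite indicE; case: (_ \in _); rewrite ?lexx ?ler01.
have w1 (x : T) : 1 <= 1 + enorm x by rewrite lerDl enorm_ge0.
have mw : measurable_fun setT (fun x : T => 1 + enorm x).
  by apply: measurable_funD => //; exact: measurable_enorm.
apply: main => //.
- exact: measurableT_comp (@measurable_powR R _) mw.
- exact: measurableT_comp (@measurable_powR R _) mw.
- by move=> x; rewrite -[leLHS](powRr0 (1 + enorm x)) ler_powR// ltW.
- move=> x; rewrite powR_ge0/= -[leRHS](powRr0 (1 + enorm x)) ler_powR// oppr_le0.
  by rewrite addr_ge0// ltW.
Qed.

Lemma obstacle_problem : (exists u, Kset u) ->
  exists u, [/\ obstacle_solution s G g k Om Om' psi theta u,
    (forall v, obstacle_solution s G g k Om Om' psi theta v -> ae (fun x => v x = u x)) &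
    supersolution s G g k Om u].
Proof.
move=> [u0 /Kset_oclass[u0' _ ou0]].
have [u ou hu] := obstacle_minimizer (ex_intro _ _ ou0).
have cu : competitor u by case: ou.
have uu : ae (fun x => u x = u x) by apply/ae_leb; exact: aeW.
have ae_sub v v' w w' : ae (fun x => v x = v' x) -> ae (fun x => w x = w' x) ->
    ae (fun x => v x - w x = v' x - w' x :> R).
  move=> /ae_leb h1 /ae_leb h2; apply/ae_leb.
  by apply: filterS2 h1 h2 => x -> ->.
exists u; split.
- split; first exact: oclass_Kset.
  move=> v /Kset_oclass[v' vv ov]; have cv : competitor v' by case: ov.
  rewrite (Eform_first_var uu (ae_sub _ _ _ _ vv uu) cu (competitor_sub cv cu)) lee_fin.
  exact: hu.
- move=> v [/Kset_oclass[v' vv ov] hv]; have cv : competitor v' by case: ov.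
  have := hv _ (oclass_Kset ou).
  rewrite (Eform_first_var vv (ae_sub _ _ _ _ uu vv) cv (competitor_sub cu cv)) lee_fin => h2.
  have h1 := hu _ ov; have := uniqueness cu cv h1 h2.
  move/ae_leb: vv => vv' h3; apply/ae_leb; apply: filterS2 vv' h3 => x -> ->//.
- split; [exact: supersolution_Wloc|exact: supersolution_Lgs|].
  move=> f cf f0; have af := test_admissible cf.
  have ff : ae (fun x => f x = f x) by apply/ae_leb; exact: aeW.
  rewrite (Eform_first_var uu ff cu af) lee_fin.
  (* The variational inequality is tested with [u + f], whose increment over [u] is exactly [f]. *)
  have := hu _ (obstacle_class_add ou cf f0); congr (0 <= first_var _ _).
  by apply/funext => x; rewrite addrC addKr.
Qed.


End Energy.


(* A setting available before [theta] has been shown to satisfy [es_modth]. *)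
Lemma zero_energy_setting (R : realType) (n : nat) (s p q : R) (G g : R -> R)
    (Om Om' : set 'rV[R]_n) : (0 < n)%N -> 0 < s -> young_pair G g p q ->
  open Om -> open Om' -> ebounded Om -> ebounded Om' -> closure Om `<=` Om' ->
  energy_setting s p q G g Om Om' (fun=> 0).
Proof.
move=> n0 s0 Y oO oO' bO bO' cO; split => //.
- under eq_integral do rewrite normr0 mul0r (yp_g0 Y) mul0r.
  by rewrite integral0.
- rewrite /modW /modL /modD.
  under eq_integral do rewrite (even_ext0 Y).
  rewrite integral0 add0e.
  under eq_integral do rewrite /Dz /Ds subrr mul0r (even_ext0 Y) mul0r.
  by rewrite integral0.
Qed.

Theorem theorem4p3 (R : realType) (n : nat) (s Lam p q : R) (G g : R -> R)
    (k : 'rV[R]_n -> 'rV[R]_n -> R) (Om Om' : set 'rV[R]_n)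
    (psi : 'rV[R]_n -> \bar R) (theta : 'rV[R]_n -> R) :
  (0 < n)%N -> 0 < s -> s < 1 -> 1 <= Lam ->
  diff_young G g -> G 1 = 1 -> 1 < p -> p <= q ->
  (forall t, 0 <= t -> p * G t <= t * g t /\ t * g t <= q * G t) ->
  lmeasurable_fun (fun z : 'rV[R]_(n + n) => k (lsubmx z) (rsubmx z)) ->
  ae (fun z : 'rV[R]_(n + n) =>
        Lam^-1 <= k (lsubmx z) (rsubmx z) /\
        k (lsubmx z) (rsubmx z) = k (rsubmx z) (lsubmx z) /\
        k (lsubmx z) (rsubmx z) <= Lam) ->
  (forall a b, 0 < a -> a <= b -> g b / b `^ (q - 1) <= g a / a `^ (q - 1)) ->
  open Om -> open Om' -> ebounded Om -> ebounded Om' -> closure Om `<=` Om' ->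
  Wsp s G Om Om' theta -> Lgs s g theta ->
  (exists u, Kset s G Om Om' psi theta u) ->
  exists u, [/\ obstacle_solution s G g k Om Om' psi theta u,
    (forall v, obstacle_solution s G g k Om Om' psi theta v -> ae (fun x => v x = u x)) &
    supersolution s G g k Om u].

Proof.
move=> n0 s0 s1 L1 [_ g0 ginc der _] G1 p1 pq grow lk kb _ oO oO' bO bO' cO Wth Lth ne.
have Y : young_pair G g p q by split.
have L0 : 0 < Lam := lt_le_trans ltr01 L1.
have lth : lmeasurable_fun theta by case: Wth.
have [th [mth thE]] := lmeasurable_fun_borel lth.
have E0 := zero_energy_setting n0 s0 Y oO oO' bO bO' cO.
have E : energy_setting s p q G g Om Om' th.
  split => //; last exact/(Wsp_modW E0 mth thE lth).
  have [_ _ tail] := Lth.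
  rewrite -(iint_ae (f := fun y => (g (`|theta y| / (1 + enorm y) `^ s) * tailw s y)%:E))//.
  - have m1 : measurable_fun setT (fun y : 'rV[R]_n => (1 + enorm y) `^ (- s)).
      apply: (measurableT_comp (@measurable_powR R _)).
      by apply: measurable_funD => //; exact: measurable_enorm.
    apply/measurable_EFinP; apply: measurable_funM; last exact: measurable_tailw.
    rewrite (_ : (fun y => _) = (fun t => g `|t|) \o (fun y => th y * (1 + enorm y) `^ (- s))).
      exact: measurableT_comp (measurable_g E0) (measurable_funM mth m1).
    by apply/funext => y /=; rewrite normrM powRN (@ger0_norm _ (_^-1))// invr_ge0 powR_ge0.
  - by move=> y; rewrite lee_fin mulr_ge0 ?powR_ge0// (young_g_ge0 Y)// divr_ge0// powR_ge0.
  - by move=> y; rewrite lee_fin mulr_ge0 ?powR_ge0// (young_g_ge0 Y)// divr_ge0// powR_ge0.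
  - by move/ae_leb: thE => h; apply/ae_leb; apply: filterS h => y ->.
have [k' [mk' kk']] := lmeasurable_fun_borel lk.
(* The bounds on the coefficient hold only a.e.; clamping its Borel representative makes them hold
   everywhere and changes it on a null set only. *)
pose K z := Num.max Lam^-1 (Num.min Lam (k' z)).
have LL : Lam^-1 <= Lam by rewrite (le_trans _ L1)// invf_le1.
have mK : measurable_fun setT K by apply: measurable_maxr => //; exact: measurable_minr.
have Kb z : Lam^-1 <= K z <= Lam by rewrite /K le_max lexx/= ge_max LL/= ge_min lexx.
have kK : ae (fun z : 'rV[R]_(n + n) => k (lsubmx z) (rsubmx z) = K z).
  move/ae_leb: kk' => h1; move/ae_leb: kb => h2; apply/ae_leb.
  by apply: filterS2 h1 h2 => z e [h3 [_ h4]]; rewrite /K -e min_r// max_r.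
exact: (obstacle_problem E L0 mK Kb s1 thE kK Lth ne).
Qed.
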